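(* Let $f\in\mathbb H^{-s}(\Omega)$. The map $E:\mathcal Q\to\mathring H^1_L(y^\alpha,\mathcal C)$ is Fréchet differentiable (with respect to the $L^\infty(\Omega)$ norm on $\mathcal Q$). In addition, for $q\in\mathcal Q$ and $h\in L^\infty(\Omega)$, $E'(q)h=\psi$, where $\psi\in\mathring H^1_L(y^\alpha,\mathcal C)$ is the unique solution of $$a_{\mathcal C}(\psi,\phi)(q)=-\int_{\mathcal C}y^\alpha h\,E(q)\,\phi\,dx\qquad\forall\phi\in\mathring H^1_L(y^\alpha,\mathcal C),$$ and $$\|\nabla E'(q)h\|_{L^2(y^\alpha,\mathcal C)}\le C\|f\|_{\mathbb H^{-s}(\Omega)}\|h\|_{L^\infty(\Omega)},$$ where $C$ is independent of $q$ and $h$.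
   Context: Setting: $d\in\{2,3\}$; $\Omega\subset\mathbb R^d$ is an open bounded convex polytope; $A\in C^{0,1}(\Omega;\mathrm{GL}(\mathbb R^d))$ is symmetric and uniformly positive definite; $\bar q>0$ and $\mathcal Q=\{q\in L^\infty(\Omega): 0\le q\le\bar q \text{ a.e.}\}$; $s\in(0,1)$, $\alpha=1-2s$, $d_s=2^{1-2s}\Gamma(1-s)/\Gamma(s)$. For $q\in\mathcal Q$ let $\mathcal L w=-\mathrm{div}_{x'}(A\nabla_{x'}w)+qw$ with homogeneous Dirichlet conditions, with eigenpairs $(\lambda_k,\varphi_k)_{k\ge1}$, $(\varphi_k)$ orthonormal in $L^2(\Omega)$. For $r\ge 0$, $\mathbb H^r(\Omega)=\{w=\sum_k w_k\varphi_k:\|w\|_{\mathbb H^r(\Omega)}^2=\sum_k\lambda_k^r w_k^2<\infty\}$, and $\mathbb H^{-r}(\Omega)$ is its dual, with pairing $\langle\cdot,\cdot\rangle$. For $r\in[0,1]$ different $q\in\mathcal Q$ give the same space with equivalent norms (constants uniform in $q\in\mathcal Q$). Extension: $\mathcal C=\Omega\times(0,\infty)$ with points $x=(x',y)$; $\mathbf A=\mathrm{diag}\{A,1\}$; $\mathring H^1_L(y^\alpha,\mathcal C)$ is the space of $w\in L^2(y^\alpha,\mathcal C)$ with $\nabla w\in L^2(y^\alpha,\mathcal C)$ and $w=0$ on $\partial\Omega\times(0,\infty)$, normed by $\|\nabla w\|_{L^2(y^\alpha,\mathcal C)}$ (equivalent to the full norm by a weighted Poincaré inequality), where $L^2(y^\alpha,\cdot)$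 is the $L^2$ space for the measure $y^\alpha dx$; $\operatorname{tr}:\mathring H^1_L(y^\alpha,\mathcal C)\to\mathbb H^s(\Omega)$ is the bounded trace operator onto $\Omega\times\{0\}$. Let $a_{\mathcal C}(w,\phi)(q)=\int_{\mathcal C}y^\alpha(\mathbf A\nabla w\cdot\nabla\phi+qw\phi)\,dx$. $E(q)\in\mathring H^1_L(y^\alpha,\mathcal C)$ is the unique solution of $a_{\mathcal C}(E(q),\phi)(q)=d_s\langle f,\operatorname{tr}\phi\rangle$ for all $\phi\in\mathring H^1_L(y^\alpha,\mathcal C)$. Fréchet differentiability at $q\in\mathcal Q$ means: there is a bounded linear map $E'(q):L^\infty(\Omega)\to\mathring H^1_L(y^\alpha,\mathcal C)$ with $\|\nabla(E(q+h)-E(q)-E'(q)h)\|_{L^2(y^\alpha,\mathcal C)}=o(\|h\|_{L^\infty(\Omega)})$ as $\|h\|_{L^\infty(\Omega)}\to0$ with $q+h\in\mathcal Q$. *)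

(* Defs.v *)
From HB Require Import structures.
From mathcomp Require Import all_boot all_order all_algebra.
From mathcomp Require Import all_classical all_reals all_analysis.

Set Implicit Arguments.
Unset Strict Implicit.
Unset Printing Implicit Defensive.

Import Order.TTheory GRing.Theory Num.Theory.
Import numFieldNormedType.Exports.

Local Open Scope classical_set_scope.
Local Open Scope ring_scope.

(** * Lebesgue measure on R^n

    Row vectors carry the product sigma-algebra; the measure on R^n is the
    n-fold product, transported along (x, y) |-> (x_1, ..., x_n, y). *)

Definition measure_rV_display : measure_display -> measure_display.
Proof. exact. Qed.

Section rV_measurable.
Context {d : measure_display} {T : measurableType d}.
Variable n : nat.

Let coord : 'I_n -> 'rV[T]_n -> T := fun i x => x ord0 i.

Let rV_set0 : g_sigma_preimage coord set0.
Proof. exact: sigma_algebra0. Qed.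

Let rV_setC A : g_sigma_preimage coord A -> g_sigma_preimage coord (~` A).
Proof. exact: sigma_algebraC. Qed.

Let rV_bigcup (F : (set 'rV[T]_n)^nat) :
  (forall i, g_sigma_preimage coord (F i)) ->
  g_sigma_preimage coord (\bigcup_i (F i)).
Proof. exact: sigma_algebra_bigcup. Qed.

HB.instance Definition _ := @isMeasurable.Build (measure_rV_display d)
  'rV[T]_n (g_sigma_preimage coord) rV_set0 rV_setC rV_bigcup.

End rV_measurable.

Lemma measurable_fun_rV (d1 d2 : measure_display) (T1 : measurableType d1)
    (T2 : measurableType d2) (n : nat) (f : T1 -> 'rV[T2]_n) :
  (forall i, measurable_fun [set: T1] (fun x => f x ord0 i)) ->
  measurable_fun [set: T1] f.
Proof.
move=> mf.
suff prefS : g_sigma_preimage (fun i x => f x ord0 i) `<=` measurable.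
  move: prefS; rewrite (g_sigma_preimage_comp (fun i (v : 'rV[T2]_n) => v ord0 i) f).
  by move=> prefS _ A mA; apply: prefS; exists A.
apply: smallest_sub; first exact: sigma_algebra_measurable.
case: n => [|n] in f mf *; first by rewrite big_ord0.
rewrite -bigcup_mkord_ord; apply: bigcup_sub => i Ii.
by move=> A [B mB <-]; exact: mf.
Qed.

Section lebesgue_rV.
Variable R : realType.

Definition rV_rcons n (p : 'rV[R]_n * measurableTypeR R) : 'rV[R]_n.+1 :=
  castmx (erefl, addn1 n) (row_mx p.1 (const_mx p.2)).

Lemma measurable_rV_coord n (i : 'I_n) :
  measurable_fun [set: 'rV[R]_n] (fun v : 'rV[R]_n => v ord0 i).
Proof.
move=> _ Y mY; rewrite setTI; apply: sub_sigma_algebra => /=.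
rewrite -bigcup_seq/=; exists i => /=; first by rewrite mem_index_enum.
by exists Y => //; rewrite setTI.
Qed.

Lemma measurable_rV_rcons n : measurable_fun [set: _] (@rV_rcons n).
Proof.
apply: measurable_fun_rV => i.
under eq_fun do rewrite /rV_rcons castmxE/= cast_ord_id mxE.
case: (fintype.split _) => j.
  exact: (measurableT_comp (measurable_rV_coord j) measurable_fst).
under eq_fun do rewrite mxE.
exact: measurable_snd.
Qed.

Section step.
Variables (n : nat) (m : {measure set 'rV[R]_n -> \bar R}).

Definition rV_step : set 'rV[R]_n.+1 -> \bar R :=
  pushforward (m \x @lebesgue_measure R)%E (@rV_rcons n).

Let step0 : rV_step set0 = 0%E.
Proof. by rewrite /rV_step /pushforward preimage_set0 measure0. Qed.

Let step_ge0 A : (0 <= rV_step A)%E.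
Proof. by rewrite /rV_step /pushforward; exact: measure_ge0. Qed.

Let step_sigma_additive : semi_sigma_additive rV_step.
Proof.
move=> F mF tF mUF; rewrite /rV_step /pushforward preimage_bigcup.
have mr B : measurable B -> measurable (@rV_rcons n @^-1` B).
  by move=> mB; rewrite -[X in measurable X]setTI; exact: measurable_rV_rcons.
apply: measure_semi_sigma_additive.
- by move=> k; exact: mr.
- apply/trivIsetP => /= i j _ _ ij; rewrite -preimage_setI.
  by move/trivIsetP : tF => /(_ _ _ _ _ ij) ->//; rewrite preimage_set0.
- by rewrite -preimage_bigcup; exact: mr.
Qed.

HB.instance Definition _ :=
  isMeasure.Build _ _ _ rV_step step0 step_ge0 step_sigma_additive.
End step.

Fixpoint lebesgue_rV n : {measure set 'rV[R]_n -> \bar R} :=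
  if n is n'.+1 then rV_step (lebesgue_rV n') else \d_(const_mx 0 : 'rV[R]_0).

End lebesgue_rV.

Arguments lebesgue_rV {R n}.

(** * Weighted Sobolev spaces on an open subset of R^n

    Elements of the L^2 and H^1 spaces are represented by functions on R^n of
    which only the values on [U], up to null sets, matter. *)

Section sobolev.
Variables (R : realType) (n : nat).
Implicit Types (U V : set 'rV[R]_n) (omega w v g eta : 'rV[R]_n -> R).

Definition partial (i : 'I_n) eta : 'rV[R]_n -> R :=
  fun x => 'D_(delta_mx ord0 i : 'rV[R]_n) eta x.

Definition smooth eta := forall l : seq 'I_n,
  let g := foldr partial eta l in
  continuous g /\
  forall i x, derivable g x (delta_mx ord0 i : 'rV[R]_n).

(* C_c^oo(V) *)
Definition test_function V : set ('rV[R]_n -> R) :=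
  [set eta : 'rV[R]_n -> R | smooth eta /\
    exists K, [/\ compact K, K `<=` V & forall x, ~ K x -> eta x = 0]].

(* L^2(omega, U) *)
Definition L2 omega U : set ('rV[R]_n -> R) :=
  [set w : 'rV[R]_n -> R | measurable_fun U w /\
    (\int[lebesgue_rV]_(x in U) (omega x * w x ^+ 2)%:E < +oo)%E].

Definition weak_partial U (i : 'I_n) w g := forall eta, test_function U eta ->
  (\int[lebesgue_rV]_(x in U) (w x * partial i eta x) =
   - \int[lebesgue_rV]_(x in U) (g x * eta x))%R.

Definition H1 omega U : set ('rV[R]_n -> R) :=
  [set w : 'rV[R]_n -> R | L2 omega U w /\
    forall i, exists2 g, L2 omega U g & weak_partial U i w g].

(* The weak gradient of an element of H1 omega U; the underlying choice is
   unique up to null sets when omega is locally bounded away from 0 in U. *)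
Definition grad omega U w : 'rV[R]_n -> 'rV[R]_n := fun x => \row_i
  xget (cst 0) [set g : 'rV[R]_n -> R | L2 omega U g /\ weak_partial U i w g] x.

Definition dot (a b : 'rV[R]_n) : R := (a *m b^T) ord0 ord0.

Definition L2_norm omega U w : R :=
  Num.sqrt (\int[lebesgue_rV]_(x in U) (omega x * w x ^+ 2)).

(* || grad w ||_{L^2(omega, U)} *)
Definition grad_norm omega U w : R :=
  Num.sqrt (\int[lebesgue_rV]_(x in U)
    (omega x * dot (grad omega U w x) (grad omega U w x))).

(* The closure of C_c^oo(V)|_U in H1 omega U, for U a subset of V: the
   functions of H1 omega U vanishing on the part of the boundary of U
   that lies on the boundary of V. *)
Definition H1_vanishing omega U V : set ('rV[R]_n -> R) :=
  [set w : 'rV[R]_n -> R | H1 omega U w /\ forall e : R, 0 < e ->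
    exists2 eta, test_function V eta &
      L2_norm omega U (w \- eta) + grad_norm omega U (w \- eta) < e].

(* int_U omega (M grad w . grad v + c w v) *)
Definition energy_form omega U (M : 'rV[R]_n -> 'M[R]_n) (c : 'rV[R]_n -> R)
    w v : R :=
  \int[lebesgue_rV]_(x in U) (omega x *
    (dot (grad omega U v x) (grad omega U w x *m (M x)^T) + c x * w x * v x)).

Definition Linfty U : set ('rV[R]_n -> R) :=
  [set h : 'rV[R]_n -> R | measurable_fun U h /\
    ('N[lebesgue_rV]_+oo [EFin \o (h \_ U)] < +oo)%E].

Definition Linfty_norm U (h : 'rV[R]_n -> R) : R :=
  fine ('N[lebesgue_rV]_+oo [EFin \o (h \_ U)])%E.

(* The open convex polytopes, as bounded intersections of half-spaces *)
Definition open_convex_polytope U :=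
  [/\ U !=set0, bounded_set U &
    exists (m : nat) (N : 'M[R]_(m, n)) (b : 'cV[R]_m),
      U = [set x | forall i, (N *m x^T) i ord0 < b i ord0]].

(* A in C^{0,1}(U; GL(R^n)), symmetric and uniformly positive definite *)
Definition coefficient U (A : 'rV[R]_n -> 'M[R]_n) :=
  [/\ [lipschitz A x | x in U],
      forall x, U x -> A x \in unitmx,
      forall x, U x -> (A x)^T = A x &
      exists2 c : R, 0 < c & forall x, U x -> forall xi : 'rV[R]_n,
        c * dot xi xi <= dot xi (xi *m (A x)^T)].

(* The set Q of admissible potentials *)
Definition potential U (qbar : R) : set ('rV[R]_n -> R) :=
  [set q : 'rV[R]_n -> R | measurable_fun U q /\
    {ae lebesgue_rV, forall x, U x -> 0 <= q x <= qbar}].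

End sobolev.

(** * The spectral spaces H^r(Omega) of the elliptic operator *)

Section spectral.
Variables (R : realType) (d : nat) (Omega : set 'rV[R]_d).
Implicit Types (w : 'rV[R]_d -> R) (f : ('rV[R]_d -> R) -> R).

Definition L2_dot (v w : 'rV[R]_d -> R) : R :=
  \int[lebesgue_rV]_(x in Omega) (v x * w x).

Definition H10 : set ('rV[R]_d -> R) := H1_vanishing (cst 1) Omega Omega.

(* (lam, phi) lists the eigenpairs of - div (A grad w) + q w with homogeneous
   Dirichlet conditions, counted with multiplicity and starting from index 0,
   for L^2-orthonormal eigenfunctions; completeness says that none is omitted. *)
Definition eigenpairs (A : 'rV[R]_d -> 'M[R]_d) (q : 'rV[R]_d -> R)
    (lam : nat -> R) (phi : nat -> 'rV[R]_d -> R) :=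
  [/\ forall k, H10 (phi k) /\ forall v, H10 v ->
        energy_form (cst 1) Omega A q (phi k) v = lam k * L2_dot (phi k) v,
      {homo lam : j k / (j <= k)%N >-> j <= k},
      forall j k, L2_dot (phi j) (phi k) = (j == k)%:R &
      forall w, L2 (cst 1) Omega w -> (forall k, L2_dot w (phi k) = 0) ->
        w = cst 0 %[ae lebesgue_rV in Omega]].

Variables (r : R) (lam : nat -> R) (phi : nat -> 'rV[R]_d -> R).

Definition Hr_sqnorm w : \bar R :=
  (\sum_(0 <= k <oo) (lam k `^ r * L2_dot w (phi k) ^+ 2)%:E)%E.

Definition Hr : set ('rV[R]_d -> R) :=
  [set w : 'rV[R]_d -> R | L2 (cst 1) Omega w /\ (Hr_sqnorm w < +oo)%E].

Definition Hr_norm w : R := Num.sqrt (fine (Hr_sqnorm w)).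

(* H^{-r}(Omega), the dual of H^r(Omega); the pairing < f, w > is f w. *)
Definition Hr_dual f :=
  (forall a v w, Hr v -> Hr w ->
     f (fun x => a * v x + w x) = a * f v + f w) /\
  exists M : R, forall w, Hr w -> `|f w| <= M * Hr_norm w.

Definition Hr_dual_norm f : R :=
  sup [set `|f w| | w in [set w : 'rV[R]_d -> R | Hr w /\ Hr_norm w <= 1]].

End spectral.

(** * The extension problem on the cylinder Omega x (0, oo) *)

Section extension.
Variables (R : realType) (d : nat) (Omega : set 'rV[R]_d).

(* A point (x', y) of R^d x R is the row vector of R^(d+1) with last
   coordinate y. *)
Definition base_pt (x : 'rV[R]_(d + 1)) : 'rV[R]_d := lsubmx x.
Definition height (x : 'rV[R]_(d + 1)) : R := x ord0 (rshift d ord0).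

Definition cylinder : set 'rV[R]_(d + 1) :=
  [set x | Omega (base_pt x) /\ 0 < height x].
Definition full_cylinder : set 'rV[R]_(d + 1) := [set x | Omega (base_pt x)].

Variable s : R.

Definition alpha : R := 1 - 2 * s.

Definition Gamma (x : R) : R :=
  \int[lebesgue_measure]_(t in `]0, +oo[) (t `^ (x - 1) * expR (- t)).

Definition d_s : R := 2 `^ (1 - 2 * s) * Gamma (1 - s) / Gamma s.

Definition weight (x : 'rV[R]_(d + 1)) : R := height x `^ alpha.

(* The functions of H^1(y^alpha, C) that vanish on the lateral boundary of C *)
Definition H1L : set ('rV[R]_(d + 1) -> R) :=
  H1_vanishing weight cylinder full_cylinder.

Definition gradC_norm (w : 'rV[R]_(d + 1) -> R) : R :=
  grad_norm weight cylinder w.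

Variable A : 'rV[R]_d -> 'M[R]_d.

Definition a_C (w v : 'rV[R]_(d + 1) -> R) (q : 'rV[R]_d -> R) : R :=
  energy_form weight cylinder
    (fun x => block_mx (A (base_pt x)) 0 0 1%:M) (q \o base_pt) w v.

Variable qbar : R.

(* tr is the bounded trace operator H1L -> H^s(Omega) onto Omega x {0}: the
   linear extension of eta |-> eta(., 0) that is bounded for the norms of
   H^s(Omega) given by the potentials q in Q, these norms being equivalent
   uniformly in q. *)
Definition trace_operator (tr : ('rV[R]_(d + 1) -> R) -> 'rV[R]_d -> R) :=
  [/\ forall a v w, H1L v -> H1L w ->
        tr (fun x => a * v x + w x) = (fun x' => a * tr v x' + tr w x')
          %[ae lebesgue_rV in Omega],
      forall eta, test_function full_cylinder eta ->
        tr eta = (fun x' => eta (row_mx x' 0)) %[ae lebesgue_rV in Omega] &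
      exists M : R, forall q lam phi, potential Omega qbar q ->
        eigenpairs Omega A q lam phi -> forall w, H1L w ->
        Hr Omega s lam phi (tr w) /\
        Hr_norm Omega s lam phi (tr w) <= M * gradC_norm w].

Variables (tr : ('rV[R]_(d + 1) -> R) -> 'rV[R]_d -> R).

(* u = E(q) *)
Definition extension_solution (f : ('rV[R]_d -> R) -> R) (q : 'rV[R]_d -> R)
    (u : 'rV[R]_(d + 1) -> R) :=
  H1L u /\ forall phi, H1L phi -> a_C u phi q = d_s * f (tr phi).

Definition linearized_solution (u : 'rV[R]_(d + 1) -> R)
    (q h : 'rV[R]_d -> R) (psi : 'rV[R]_(d + 1) -> R) :=
  H1L psi /\ forall phi, H1L phi -> a_C psi phi q =
    - \int[lebesgue_rV]_(x in cylinder)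
        (weight x * h (base_pt x) * u x * phi x).

(* D = E'(q), differentiability being tested by the increments h for which
   q + h stays in Q *)
Definition frechet_derivative (E : ('rV[R]_d -> R) -> 'rV[R]_(d + 1) -> R)
    (q : 'rV[R]_d -> R) (D : ('rV[R]_d -> R) -> 'rV[R]_(d + 1) -> R) :=
  [/\ forall h, Linfty Omega h -> H1L (D h),
      forall a h k, Linfty Omega h -> Linfty Omega k ->
        D (fun x' => a * h x' + k x') = (fun x => a * D h x + D k x)
          %[ae lebesgue_rV in cylinder],
      exists M : R, forall h, Linfty Omega h ->
        gradC_norm (D h) <= M * Linfty_norm Omega h &
      forall e : R, 0 < e -> exists2 delta : R, 0 < delta &
        forall h, Linfty Omega h -> potential Omega qbar (q \+ h) ->
          Linfty_norm Omega h <= delta ->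
          gradC_norm (fun x => E (q \+ h) x - E q x - D h x) <=
            e * Linfty_norm Omega h].

End extension.

(* Main.v *)
(** By a Poincare inequality in the direction of Omega (for a test function eta,
    the integral of d_i (x_i eta^2) against the weight vanishes, as the weight
    depends on y only), the gradient norm is a Hilbert norm and a_C(., .)(q) is
    coercive with a constant independent of q, whence a bound for E(q).
    Subtracting the equations of E(q + h), E(q) and psi gives
      a_C(E(q + h) - E(q), v)(q) = - int y^alpha h E(q + h) v,
      a_C(E(q + h) - E(q) - psi, v)(q) = - int y^alpha h (E(q + h) - E(q)) v,
    so that the first difference is O(|h|) and the second one O(|h|^2).

    0 need not be an interior point of the set of increments h that keep q + h
    in Q, so the derivative is only determined because they span L^oo: with g = 1 where
    q < qbar / 2 and g = - 1 elsewhere, h = g (g h)^+ - g (g h)^-, and q + t k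
    lies in Q for both k = g (g h)^+- and all small t > 0. *)

(* Elements of the spaces are functions, not classes, so every inner product is only semi-definite,
   and linearity of the gradient and uniqueness hold up to null sets; the Poincare inequality turns
   norm zero into zero almost everywhere. The weight y^alpha may blow up or degenerate at y = 0,
   where the test functions of the full cylinder do not vanish. Two of its properties carry the
   analysis: a positive lower bound on compact subsets of the open cylinder, which makes weak
   derivatives unique, and integrability over cubes up to y = 0 (alpha > -1), which puts test
   functions in the weighted space. Uniformity in q comes from coercivity, where q >= 0 is dropped,
   and from the variation of the form in q, which does not depend on q. The dual norm of f is
   computed with the eigenpairs of any fixed potential q0, and the trace bound is uniform in that
   choice, so the final constant depends on neither q0 nor q. Once these bounds are collected in a
   [coercive_family], differentiation is pure functional analysis. *)
Require Import Defs.
From HB Require Import structures.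
From mathcomp Require Import all_boot all_order all_algebra.
From mathcomp Require Import all_classical all_reals all_analysis.
From mathcomp Require Import measurable_realfun ess_sup_inf ring lra.

Set Implicit Arguments.
Unset Strict Implicit.
Unset Printing Implicit Defensive.

Import Order.TTheory GRing.Theory Num.Theory.
Import numFieldNormedType.Exports.

Local Open Scope classical_set_scope.
Local Open Scope ring_scope.

(** * Lebesgue measure on row vectors *)

Section lebesgue_rV_theory.
Variable R : realType.
Local Notation lam := (@lebesgue_measure R).

Lemma rV_rcons_low n (p : 'rV[R]_n * measurableTypeR R) (j : 'I_n) :
  rV_rcons p ord0 (widen_ord (leqnSn n) j) = p.1 ord0 j.
Proof.
rewrite /rV_rcons castmxE/= cast_ord_id.
have -> : cast_ord (esym (addn1 n)) (widen_ord (leqnSn n) j) = lshift 1 j by exact: val_inj.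
by rewrite row_mxEl.
Qed.

Lemma rV_rcons_last n (p : 'rV[R]_n * measurableTypeR R) :
  rV_rcons p ord0 ord_max = p.2.
Proof.
rewrite /rV_rcons castmxE/= cast_ord_id.
have -> : cast_ord (esym (addn1 n)) ord_max = rshift n ord0.
  by apply: val_inj; rewrite /= addn0.
by rewrite row_mxEr mxE.
Qed.

Lemma ord_lastP n (i : 'I_n.+1) : {j : 'I_n | i = widen_ord (leqnSn n) j} + {i = ord_max}.
Proof.
have [->|im] := eqVneq i ord_max; [by right|left].
have ltin : (i < n)%N by rewrite ltn_neqAle -ltnS ltn_ord andbT.
by exists (Ordinal ltin); apply: val_inj.
Qed.

Definition rV_box n (k : nat) : set 'rV[R]_n := [set x | forall i, `|x ord0 i| <= k%:R].

Lemma measurable_rV_box n k : measurable (@rV_box n k).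
Proof.
rewrite (_ : rV_box _ = \bigcap_(i in [set: 'I_n]) ((fun v : 'rV[R]_n => v ord0 i) @^-1` `[- k%:R, k%:R])).
  apply: fin_bigcap_measurable => // i _; rewrite -[X in measurable X]setTI.
  exact: measurable_rV_coord.
apply/seteqP; split => [x xk i _/=|x xk i].
  by rewrite in_itv/= -ler_norml; exact: xk.
by have := xk i I; rewrite /= in_itv/= -ler_norml.
Qed.

Lemma lebesgue_rV_box n k : (lebesgue_rV (@rV_box n k) < +oo)%E.
Proof.
elim: n => [|n IH].
  rewrite /= /dirac indicE ltry//.
pose J : set (measurableTypeR R) := `[- k%:R, k%:R]%classic.
rewrite [X in (X < _)%E](_ : _ = (lebesgue_rV (@rV_box n k) * lam J)%E); last first.
  have mJ : measurable J by exact: measurable_itv.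
  rewrite -(product_measure1E (lebesgue_rV) (@lebesgue_measure R) (@measurable_rV_box n k) mJ).
  congr ((_ \x _)%E _); apply/seteqP; split => -[v t] /=.
    move=> xk; split.
      by move=> i; have := xk (widen_ord (leqnSn n) i); rewrite rV_rcons_low.
    by have := xk ord_max; rewrite rV_rcons_last/= ler_norml => tk; rewrite /J/= in_itv.
  move=> [vk tk] i; have [[j ->]|->] := ord_lastP i.
    by rewrite rV_rcons_low; exact: vk.
  by rewrite rV_rcons_last/= ler_norml; move: tk; rewrite /J/= in_itv.
rewrite lte_mul_pinfty//; first by rewrite ge0_fin_numE.
by rewrite lebesgue_measure_itv/=; case: ifP; rewrite ?ltry// -EFinD ltry.
Qed.

Lemma bigcup_rV_box n : \bigcup_k (@rV_box n k) = [set: 'rV[R]_n].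
Proof.
apply/seteqP; split => // x _; exists (Num.truncn (\sum_i `|x ord0 i|)).+1 => // i.
apply: le_trans (ltW (truncnS_gt _)).
by rewrite (bigD1 i)//= lerDl sumr_ge0.
Qed.

Lemma lebesgue_rV_sigma_finite n : sigma_finite setT (@lebesgue_rV R n).
Proof.
exists (@rV_box n); first by rewrite bigcup_rV_box.
by move=> k; split; [exact: measurable_rV_box|exact: lebesgue_rV_box].
Qed.

(** A fresh constant on which the sigma-finite structure required by Fubini can be declared,
    [lebesgue_rV] being a recursive function into bundled measures. *)
Definition leb_fun n : set 'rV[R]_n -> \bar R := lebesgue_rV.
HB.instance Definition _ n := Measure.on (@leb_fun n).
HB.instance Definition _ n := Measure_isSigmaFinite.Build _ _ _ (@leb_fun n) (@lebesgue_rV_sigma_finite n).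
Definition leb n : {sigma_finite_measure set 'rV[R]_n -> \bar R} := @leb_fun n.

Lemma ge0_integral_rcons n (f : 'rV[R]_n.+1 -> \bar R) :
  measurable_fun [set: 'rV[R]_n.+1] f -> (forall x, (0 <= f x)%E) ->
  (\int[lebesgue_rV]_x f x = \int[lebesgue_rV]_v \int[lam]_t f (rV_rcons (v, t)))%E.
Proof.
move=> mf f0.
have mr := @measurable_rV_rcons R n.
rewrite [LHS](ge0_integral_pushforward mr (leb n \x lam)%E)//.
rewrite preimage_setT (fubini_tonelli1 (m1 := leb n) (f \o _))//=.
exact: measurableT_comp.
Qed.

Lemma ge0_integral_rcons2 n (f : 'rV[R]_n.+1 -> \bar R) :
  measurable_fun [set: 'rV[R]_n.+1] f -> (forall x, (0 <= f x)%E) ->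
  (\int[lebesgue_rV]_x f x = \int[lam]_t \int[lebesgue_rV]_v f (rV_rcons (v, t)))%E.
Proof.
move=> mf f0.
have mr := @measurable_rV_rcons R n.
rewrite [LHS](ge0_integral_pushforward mr (leb n \x lam)%E)//.
rewrite preimage_setT (fubini_tonelli2 (m1 := leb n) (f \o _))//=.
exact: measurableT_comp.
Qed.

Definition upd n (x : 'rV[R]_n) i t : 'rV[R]_n := \row_j (if j == i then t else x ord0 j).

(** Fubini along an arbitrary coordinate, although the measure only splits off the last one. If [i]
    is last, its integral is the inner one. Otherwise the last coordinate is integrated outermost;
    almost every section is integrable, and the induction hypothesis applies to it. *)
Lemma integral_slice0 n (i : 'I_n) (f : 'rV[R]_n -> \bar R) :
  lebesgue_rV.-integrable [set: 'rV[R]_n] f ->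
  (forall x, \int[lam]_t f (upd x i t) = 0)%E ->
  (\int[lebesgue_rV]_x f x = 0)%E.
Proof.
elim: n => [|n IH] in i f *; first by case: i.
move=> fi f0.
have mr := @measurable_rV_rcons R n.
have mf := measurable_int _ fi.
have fri : (leb n \x lam)%E.-integrable setT (f \o @rV_rcons R n).
  apply/integrableP; split; first exact: measurableT_comp.
  case/integrableP : fi => _; rewrite [X in (X < _)%E -> _](ge0_integral_pushforward mr (leb n \x lam)%E)//.
  exact: measurableT_comp.
rewrite [LHS](integral_pushforward mr (mu := (leb n \x lam)%E))//.
rewrite preimage_setT.
have [[j ij]|im] := ord_lastP i.
  rewrite -(integral21_prod_meas1 fri)/=.
  have aei := ae_integrable2 fri.
  rewrite (ae_eq_integral (cst 0%E))//.
  - by rewrite integral0.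
  - exact: (measurable_fubini_G fri).
  - apply: filterS aei => t ti _; apply: (IH j) => // v.
    rewrite -[RHS](f0 (rV_rcons (v, t))); apply: eq_integral => u _ /=.
    congr (f _); apply/rowP => k; rewrite mxE ij.
    have [[l kl]|km] := ord_lastP k.
      rewrite kl !rV_rcons_low/= mxE.
      by rewrite -!val_eqE/=.
    by rewrite km !rV_rcons_last/= -val_eqE/= gtn_eqF.
rewrite -(integral12_prod_meas1 fri)/=.
rewrite integral0_eq// => v _.
rewrite -[RHS](f0 (rV_rcons (v, 0))); apply: eq_integral => u _ /=.
congr (f _); apply/rowP => k; rewrite mxE im.
have [[l kl]|km] := ord_lastP k.
  rewrite kl !rV_rcons_low/=.
  by rewrite -val_eqE/= ltn_eqF.
by rewrite km !rV_rcons_last/= eqxx.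
Qed.

(** Tonelli, one coordinate at a time. It provides the integrable majorant of the power weight on
    cubes. *)
Lemma integral_prod_coord n (g : 'I_n -> R -> R) (r : 'I_n -> R) :
  (forall i, measurable_fun setT (g i)) -> (forall i t, 0 <= g i t) ->
  (forall i, \int[lam]_t (g i t)%:E = (r i)%:E)%E ->
  (\int[lebesgue_rV]_(x in [set: 'rV[R]_n]) (\prod_i g i (x ord0 i))%:E = (\prod_i r i)%:E)%E.
Proof.
elim: n => [|n IH] in g r *.
  move=> _ _ _; rewrite big_ord0.
  under eq_integral do rewrite big_ord0.
  by rewrite integral_cst// /= /dirac indicE in_setT mul1e.
move=> mg g0 gr.
rewrite ge0_integral_rcons//; last 2 first.
- apply/measurable_EFinP; apply: measurable_prod => i _.
  exact: (measurableT_comp (mg i) (measurable_rV_coord i)).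
- by move=> x; rewrite lee_fin prodr_ge0.
under eq_integral => v _.
  under eq_integral => t _.
    rewrite big_ord_recr/= rV_rcons_last/= EFinM.
    under eq_bigr do rewrite rV_rcons_low/=.
    over.
  rewrite ge0_integralZl//; last 3 first.
  - by apply/measurable_EFinP; exact: mg.
  - by move=> t _; rewrite lee_fin.
  - by rewrite lee_fin prodr_ge0.
  rewrite gr.
  over.
rewrite ge0_integralZr//; last 3 first.
- apply/measurable_EFinP; apply: measurable_prod => i _.
  exact: (measurableT_comp (mg _) (measurable_rV_coord i)).
- by move=> x _; rewrite lee_fin prodr_ge0.
- by rewrite -gr integral_ge0// => t _; rewrite lee_fin.
rewrite (IH (fun i => g (widen_ord (leqnSn n) i)) (fun i => r (widen_ord (leqnSn n) i)))//.
by rewrite big_ord_recr/= EFinM.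
Qed.

(** The sigma-algebra is generated by the coordinates and not by the topology; the link is that an
    open set is the countable union of the rational cubes that it contains. *)
Lemma open_rV_measurable n (U : set 'rV[R]_n) : open U -> measurable U.
Proof.
move=> oU.
pose B (p : 'rV[rat]_n * rat) : set 'rV[R]_n :=
  \bigcap_(i in [set: 'I_n]) ((fun v : 'rV[R]_n => v ord0 i) @^-1`
     (ball (ratr (p.1 ord0 i) : R) (ratr p.2))).
have mB p : measurable (B p).
  apply: fin_bigcap_measurable => // i _; rewrite -[X in measurable X]setTI.
  by apply: measurable_rV_coord => //; rewrite -ball_normE; exact: measurable_ball.
rewrite (_ : U = \bigcup_p (if `[< B p `<=` U >] then B p else set0)).
  apply: countable_bigcupT_measurable => // p.
  by case: ifP.
apply/seteqP; split => [x Ux|x [p _]]; last by case: ifP => // /asboolP; exact.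
have /nbhs_ballP[e /= e0 eU] := open_nbhs_nbhs (conj oU Ux).
(* The cube has radius e'/2 and a centre within e'/2 of [x], so its points are within e' < e of
   [x]. *)
have [e' /= /[!in_itv]/= /andP[e'0 e'e]] := rat_in_itvoo e0.
have [q qP] : exists q : 'rV[rat]_n, forall i, ball (ratr (q ord0 i) : R) (ratr e' / 2) (x ord0 i).
  have h i : exists q : rat, ball (ratr q : R) (ratr e' / 2) (x ord0 i).
    have : x ord0 i - ratr e' / 2 < x ord0 i + ratr e' / 2 by rewrite ltrBlDr -addrA -splitr ltrDl.
    move=> /rat_in_itvoo[q]; rewrite in_itv/= => /andP[q1 q2]; exists q.
    by rewrite /ball/= ltr_distl; apply/andP; split; lra.
  by exists (\row_i projT1 (cid (h i))) => i; rewrite mxE; case: cid.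
exists (q, e' / 2) => //; rewrite ifT.
  move=> i _ /=; rewrite rmorphM/= fmorphV/= ratr_nat; exact: qP.
apply/asboolP.
  move=> y yB; apply: eU; rewrite /ball/=; split=> // i j; rewrite !ord1.
  have e2 : (ratr (e' / 2) : R) = ratr e' / 2 by rewrite rmorphM/= fmorphV/= ratr_nat.
  have := yB j I; rewrite /= e2 => yj.
  apply: (@le_ball _ _ _ (ratr e')); first exact: ltW.
  rewrite [ratr e']splitr; apply: ball_triangle yj; exact: ball_sym.
Qed.

Lemma open_continuous_rV_measurable n (U : set 'rV[R]_n) (f : 'rV[R]_n -> R) :
  open U -> {in U, continuous f} -> measurable_fun U f.
Proof.
move=> oU cf; apply: (measurability _ (RGenOpens.measurableE R)) => _ [_ [a [b ->] <-]].
apply: open_rV_measurable; rewrite openE => x [Ux fx].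
apply: filterI; first exact: (open_nbhs_nbhs (conj oU Ux)).
by apply: cf; [rewrite inE|exact: (open_nbhs_nbhs (conj (interval_open _ _) fx))].
Qed.

Lemma continuous_rV_measurable n (f : 'rV[R]_n -> R) :
  continuous f -> measurable_fun [set: 'rV[R]_n] f.
Proof. by move=> cf; apply: open_continuous_rV_measurable => //; exact: openT. Qed.

End lebesgue_rV_theory.

(** * Smooth test functions *)

(** A directional derivative sees only the restriction to a line, so it can be computed on any
    function with the same restriction, even on another space. This reduces partial derivatives to
    one variable. *)
Lemma is_derive_along (R : numFieldType) (V V' W : normedModType R) (f : V -> W) (g : V' -> W)
    (x v : V) (y w : V') (df : W) :
  (forall h : R, f (h *: v + x) = g (h *: w + y)) ->
  is_derive y w g df -> is_derive x v f df.
Proof.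
move=> fg [dg <-].
have fg0 : f x = g y by have := fg 0; rewrite !scale0r !add0r.
have qE : (fun h : R => h^-1 *: ((f \o shift x) (h *: v) - f x)) =
          (fun h : R => h^-1 *: ((g \o shift y) (h *: w) - g y)).
  by apply/funext => h; rewrite /= fg fg0.
by split; rewrite /derivable /derive qE.
Qed.

Section exp_bump.
Variable R : realType.

(* [t^-k exp(-1/t)], extended by 0 to [t <= 0]. *)
Definition ebump (k : nat) (t : R) : R :=
  if 0 < t then t^-1 ^+ k * expR (- t^-1) else 0.

Lemma ebump_ge0 k t : 0 <= ebump k t.
Proof.
rewrite /ebump; case: ifPn => // t0.
by rewrite mulr_ge0 ?expR_ge0// exprn_ge0// invr_ge0 ltW.
Qed.

(** From exp u >= u^(k+2) / (k+2)! at u = 1/t. A quadratic bound is what makes the difference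
    quotient at 0 tend to 0. *)
Lemma ebump_le k t : ebump k t <= (k.+2)`!%:R * t ^+ 2.
Proof.
rewrite /ebump; case: ifPn => [t0|_]; last by rewrite mulr_ge0// sqr_ge0.
have u0 : 0 < t^-1 by rewrite invr_gt0.
have := expR_ge1Dxn k.+1 (ltW u0); set u := t^-1 in u0 *.
rewrite expRN => le1.
have le2 : u ^+ k.+2 / k.+2`!%:R <= expR u by apply: le_trans le1; rewrite lerDr.
have f0 : 0 < (k.+2)`!%:R :> R by rewrite ltr0n fact_gt0.
rewrite ler_pdivrMr// in le2.
rewrite ler_pdivrMr ?expR_gt0// -mulrA.
have -> : u ^+ k = t ^+ 2 * u ^+ k.+2.
  have tu : t * u = 1 by rewrite divff ?gt_eqF.
  by rewrite !exprS expr0 mulr1 -mulrA [t * (u * _)]mulrA tu mul1r mulrA tu mul1r.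
by rewrite [leRHS]mulrCA; apply: ler_wpM2l; rewrite ?sqr_ge0// mulrC.
Qed.

(** The derivative stays in the span of the family [ebump k], which is why a whole family is defined
    and why smoothness follows by induction. Away from 0 the function agrees locally with an
    elementary formula; at 0 the quotient is squeezed by [ebump_le]. *)
Lemma is_derive_ebump (k : nat) (t : R) :
  is_derive t (1 : R) (ebump k) (ebump k.+2 t - k%:R * ebump k.+1 t).
Proof.
have [t0|t0|->] := ltgtP t 0.
- have -> : ebump k.+2 t - k%:R * ebump k.+1 t = 0.
    by rewrite /ebump ltNge ltW//= mulr0 subr0.
  apply: (near_eq_is_derive (f := cst 0)) => //.
  near=> x; rewrite /ebump ifF//; apply/negbTE; rewrite -leNgt ltW//.
  by near: x; exact: lt_nbhsl.
- have tn : t != 0 by rewrite gt_eqF.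
  have dV : is_derive t (1 : R) (fun x : R => x^-1) (- t ^- 2).
    by apply: is_derive_eq; [exact: is_deriveV|rewrite /= [_ *: _]mulr1].
  have dE : is_derive t (1 : R) (fun x : R => expR (- x^-1)) (t ^- 2 * expR (- t^-1)).
    have := is_derive1_comp (f := expR) (g := fun x : R => - x^-1) (is_derive_expR _) (is_deriveN dV).
    by rewrite opprK mulrC.
  have dF := is_deriveM (is_deriveX k dV) dE.
  rewrite exprfctE in dF.
  have nF : \near t, t^-1 ^+ k * expR (- t^-1) = ebump k t.
    near=> x; rewrite /ebump ifT//.
    by near: x; exact: lt_nbhsr.
  have {}dF := near_eq_is_derive nF dF.
  apply: is_derive_eq.
  rewrite /ebump t0 /=.
  have sc (a b : R) : a *: b = a * b by [].
  rewrite !sc; case: (k) => [|m].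
    by rewrite expr0 mul1r !mul0r subr0 mulr0 addr0 exprVn.
  rewrite /= -!exprVn !exprS; ring.
- have -> : ebump k.+2 0 - k%:R * ebump k.+1 0 = 0 by rewrite /ebump ltxx mulr0 subr0.
  have e0 : ebump k 0 = 0 by rewrite /ebump ltxx.
  suff c0 : (fun h : R => h^-1 *: ((ebump k \o shift 0) (h *: (1 : R)) - ebump k 0)) @ 0^' --> (0 : R).
    by split; [apply/cvg_ex; exists 0|exact/cvg_lim].
  have gE : (fun h : R => h^-1 *: ((ebump k \o shift 0) (h *: (1 : R)) - ebump k 0)) =
            (fun h => h^-1 * ebump k h).
    by apply/funext => h; rewrite /= e0 subr0 addr0 [h *: _]mulr1.
  rewrite gE; apply: cvg_within_filter.
  have b1 h : h^-1 * ebump k h <= (k.+2)`!%:R * `|h|.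
    have [->|h0] := eqVneq h 0; first by rewrite e0 mulr0 normr0 mulr0.
    have [hn|hp] := leP h 0.
      by rewrite (le_trans _ (mulr_ge0 _ (normr_ge0 _)))// mulr_le0_ge0// ?invr_le0// ebump_ge0.
    rewrite gtr0_norm// mulrC ler_pdivrMr// -mulrA; exact: ebump_le.
  have b2 h : 0 <= h^-1 * ebump k h.
    have [hp|hn] := ltP 0 h; first by rewrite mulr_ge0 ?ebump_ge0// invr_ge0 ltW.
    by rewrite /ebump ltNge hn/= mulr0.
  apply: (@squeeze_cvgr _ _ _ _ (cst 0) (fun h => (k.+2)`!%:R * `|h|)).
  + by near=> h; rewrite b1 b2.
  + exact: cvg_cst.
  + rewrite -[X in _ --> X](mulr0 ((k.+2)`!%:R : R)) -[X in _ * X](normr0 R).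
    apply: cvgMl_tmp; apply: cvg_norm; exact: cvg_id.
Unshelve. all: by end_near. Qed.

End exp_bump.

Section smooth_functions.
Variables (R : realType) (n : nat).
Implicit Types (f g : 'rV[R]_n -> R).
Local Notation e_ i := (delta_mx ord0 i : 'rV[R]_n).

(** Iterated partial derivatives never leave a class closed under [partial], so only first-order
    facts have to be checked on it. *)
Lemma smooth_ind (P : ('rV[R]_n -> R) -> Prop) :
  (forall f, P f -> [/\ continuous f, forall i x, derivable f x (e_ i) &
     forall i, P (partial i f)]) ->
  forall f, P f -> smooth f.
Proof.
move=> HP f Pf l.
suff : P (foldr (@partial R n) f l) by move=> /HP[].
by elim: l => //= i l /HP[_ _]; apply.
Qed.

Lemma smooth_continuous f : smooth f -> continuous f.
Proof. by move=> /(_ [::]) []. Qed.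

Lemma smooth_derivable f : smooth f -> forall i x, derivable f x (e_ i).
Proof. by move=> /(_ [::]) []. Qed.

Arguments smooth_derivable {f} _ i x.

Lemma smooth_partial i f : smooth f -> smooth (partial i f).
Proof. by move=> sf l; rewrite -foldr_rcons; exact: sf. Qed.

(* The bumps generate a class stable under partial derivatives, as [smooth_ind] requires. *)
Inductive smooth_gen : ('rV[R]_n -> R) -> Prop :=
| smooth_gen_base f of smooth f : smooth_gen f
| smooth_gen_cst c : smooth_gen (cst c)
| smooth_gen_ebump k a b i : smooth_gen (fun x => ebump k (a * x ord0 i + b))
| smooth_gen_add f g of smooth_gen f & smooth_gen g : smooth_gen (fun x => f x + g x)
| smooth_gen_mul f g of smooth_gen f & smooth_gen g : smooth_gen (fun x => f x * g x).

Lemma derivable_ebump k t : derivable (@ebump R k) t 1.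
Proof. exact: (@ex_derive _ _ _ _ _ _ _ (is_derive_ebump k t)). Qed.

Lemma is_derive_ebump_coord k a b i j x :
  is_derive x (e_ j) (fun x : 'rV[R]_n => ebump k (a * x ord0 i + b))
    (a * (i == j)%:R * (ebump k.+2 (a * x ord0 i + b) - k%:R * ebump k.+1 (a * x ord0 i + b))).
Proof.
pose t := a * x ord0 i + b.
apply: (@is_derive_along _ _ _ _ _ (fun h : R => ebump k (a * (i == j)%:R * h + t)) _ _ (0 : R) (1 : R)).
  move=> h; congr ebump; rewrite /t !mxE/= addr0 [h *: 1]mulr1; ring.
have dl : is_derive (0 : R) (1 : R) (fun h : R => a * (i == j)%:R * h + t) (a * (i == j)%:R).
  apply: is_derive_eq; rewrite /= addr0 [_ *: _]mulr1; by [].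
have := @is_derive1_comp _ (ebump k) _ _ _ _ (is_derive_ebump k _) dl.
by rewrite mulr0 add0r [X in is_derive _ _ _ X -> _]mulrC; exact.
Qed.

Lemma smooth_genP f : smooth_gen f -> smooth f.
Proof.
apply: smooth_ind => {}f; elim => {f}.
- move=> f sf; split; [exact: smooth_continuous|exact: smooth_derivable|].
  by move=> i; apply: smooth_gen_base; exact: smooth_partial.
- move=> c; split; [exact: cst_continuous|by move=> i x; exact: derivable_cst|].
  move=> i; rewrite (_ : partial i _ = cst 0); first exact: smooth_gen_cst.
  by apply/funext => x; rewrite /partial derive_cst.
- move=> k a b i; split.
  + move=> x; apply: (@continuous_comp _ _ _ (fun x : 'rV[R]_n => a * x ord0 i + b)).
      apply: continuousD; [apply: continuousM|]; [exact: cst_continuous|exact: coord_continuous|exact: cst_continuous].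
    apply: differentiable_continuous; apply/derivable1_diffP.
    exact: derivable_ebump.
  + by move=> j x; apply: (@ex_derive _ _ _ _ _ _ _ (is_derive_ebump_coord k a b i j x)).
  + move=> j.
    rewrite (_ : partial j _ = fun x => a * (i == j)%:R * (ebump k.+2 (a * x ord0 i + b) + - k%:R * ebump k.+1 (a * x ord0 i + b))).
      apply: (smooth_gen_mul (smooth_gen_cst _)).
      apply: smooth_gen_add; first exact: smooth_gen_ebump.
      by apply: (smooth_gen_mul (smooth_gen_cst _)); exact: smooth_gen_ebump.
    apply/funext => x; rewrite mulNr.
    exact: (@derive_val _ _ _ _ _ _ _ (is_derive_ebump_coord k a b i j x)).
- move=> f g gf [cf df Pf] gg [cg dg Pg]; split.
  + by move=> x; apply: continuousD; [exact: cf|exact: cg].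
  + by move=> i x; apply: derivableD.
  + move=> i; rewrite (_ : partial i _ = fun x => partial i f x + partial i g x).
      exact: smooth_gen_add.
    by apply/funext => x; apply: deriveD.
- move=> f g gf [cf df Pf] gg [cg dg Pg]; split.
  + by move=> x; apply: continuousM; [exact: cf|exact: cg].
  + by move=> i x; apply: derivableM.
  + move=> i; rewrite (_ : partial i _ = fun x => f x * partial i g x + g x * partial i f x).
      by apply: smooth_gen_add; apply: smooth_gen_mul.
    by apply/funext => x; apply: deriveM.
Qed.

Lemma smooth_lin a f g : smooth f -> smooth g -> smooth (fun x => a * f x + g x).
Proof.
move=> sf sg; apply: smooth_genP; apply: smooth_gen_add; last exact: smooth_gen_base.
by apply: (smooth_gen_mul (smooth_gen_cst _)); exact: smooth_gen_base.
Qed.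

Lemma test_function_lin (V : set 'rV[R]_n) a f g : test_function V f -> test_function V g ->
  test_function V (fun x => a * f x + g x).
Proof.
move=> [sf [K [cK KV fK]]] [sg [L [cL LV gL]]]; split; first exact: smooth_lin.
exists (K `|` L); split; first exact: compactU.
  by move=> x [/KV|/LV].
by move=> x /not_orP[/fK -> /gL ->]; rewrite mulr0 addr0.
Qed.

Lemma test_function0 (V : set 'rV[R]_n) : test_function V (fun=> 0 : R).
Proof.
split; first by apply: smooth_genP; exact: smooth_gen_cst.
by exists set0; split => //; exact: compact0.
Qed.

Lemma test_function_partial (V : set 'rV[R]_n) i f : test_function V f -> test_function V (partial i f).
Proof.
move=> [sf [K [cK KV fK]]]; split; first exact: smooth_partial.
exists K; split => // x Kx.
rewrite /partial (@near_eq_derive _ _ _ _ (cst 0)) ?derive_cst//.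
have oK : open (~` K) by rewrite openC; apply: compact_closed => //; exact: norm_hausdorff.
near=> y; apply: fK; near: y; exact: (open_nbhs_nbhs (conj oK Kx)).
Unshelve. all: by end_near. Qed.

(** Each factor is a one-dimensional bump in x_i - a_i and b_i - x_i, both magnified by [k]. As [k]
    grows this gives smooth approximations of the indicator of the open box, with values in [0, 1]
    and support in the closed box. *)
Definition box_bump (a b : 'I_n -> R) (k : nat) : 'rV[R]_n -> R := fun x =>
  \prod_i (ebump 0 (k%:R * x ord0 i + - (k%:R * a i)) * ebump 0 (- k%:R * x ord0 i + k%:R * b i)).

Lemma smooth_box_bump a b k : smooth (box_bump a b k).
Proof.
apply: smooth_genP; rewrite /box_bump.
elim: (index_enum _) => [|i s IH].
  under eq_fun do rewrite big_nil. exact: smooth_gen_cst.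
under eq_fun do rewrite big_cons.
by apply: (smooth_gen_mul (smooth_gen_mul _ _) IH); exact: smooth_gen_ebump.
Qed.

Lemma ebump0_bound (t : R) : 0 <= ebump 0 t <= 1.
Proof.
rewrite ebump_ge0/= /ebump; case: ifPn => // t0.
by rewrite expr0 mul1r -expR0 ler_expR oppr_le0 invr_ge0 ltW.
Qed.

Lemma box_bump_bound a b k x : 0 <= box_bump a b k x <= 1.
Proof.
apply/andP; split; first by apply: prodr_ge0 => i _; rewrite mulr_ge0// ebump_ge0.
apply: prodr_ile1 => i _; rewrite mulr_ge0 ?ebump_ge0//=.
by rewrite mulr_ile1 ?ebump_ge0//; have /andP[] := ebump0_bound (k%:R * x ord0 i - k%:R * a i);
  have /andP[] := ebump0_bound (- k%:R * x ord0 i + k%:R * b i).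
Qed.

Definition open_box (a b : 'I_n -> R) : set 'rV[R]_n := [set x | forall i, a i < x ord0 i < b i].
Definition closed_box (a b : 'I_n -> R) : set 'rV[R]_n := [set x | forall i, a i <= x ord0 i <= b i].

Lemma box_bump_out a b k x : ~ open_box a b x -> box_bump a b k x = 0.
Proof.
move=> /existsNP[i /negP]; rewrite negb_and => abi.
apply/eqP; rewrite prodf_seq_eq0; apply/hasP; exists i; rewrite ?mem_index_enum//=.
rewrite mulf_eq0 /ebump; move: abi; rewrite -!leNgt => /orP[h|h].
  by rewrite ltNge -mulrBr mulr_ge0_le0 ?subr_le0//= eqxx.
have -> : - k%:R * x ord0 i + k%:R * b i = k%:R * (b i - x ord0 i) by ring.
have /negbTE -> : ~~ (0 < k%:R * (b i - x ord0 i)).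
  by rewrite -leNgt mulr_ge0_le0 ?subr_le0.
by rewrite eqxx orbT.
Qed.

Lemma ebump0_cvg (t : R) : 0 < t -> (fun k : nat => ebump 0 (k%:R * t)) @ \oo --> (1 : R).
Proof.
move=> t0.
have h : (fun k : nat => expR (- (k%:R * t)^-1)) @ \oo --> (1 : R).
  rewrite -[X in _ --> X]expR0 -[X in expR X]oppr0.
  apply: continuous_cvg; first exact: continuous_expR.
  apply: cvgN.
  have kp : \forall k \near \oo, 0 < (k%:R : R).
    by near=> k; rewrite ltr0n; near: k; exact: nbhs_infty_gt.
  have := cvgMr_tmp (b := t^-1) ((gtr0_cvgV0 kp).2 cvgr_idn).
  rewrite mul0r => /(_ _ _).
  by apply: cvg_trans; apply: near_eq_cvg; near=> k; rewrite invfM.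
apply: cvg_trans h; apply: near_eq_cvg; near=> k.
rewrite /ebump ifT ?expr0 ?mul1r// mulr_gt0// ltr0n; near: k; exact: nbhs_infty_gt.
Unshelve. all: by end_near. Qed.

Lemma box_bump_cvg a b x : box_bump a b k x @[k --> \oo] --> (\1_(open_box a b) x : R).
Proof.
rewrite indicE; have [xab|xab] := boolP (x \in open_box a b); last first.
  have h k : box_bump a b k x = 0 by apply: box_bump_out; move/negP: xab; rewrite inE.
  by under eq_fun do rewrite h; exact: cvg_cst.
rewrite inE in xab.
rewrite (_ : (true%:R : R) = \prod_(i : 'I_n) 1); last by rewrite big1.
rewrite /box_bump; elim: (index_enum _) => [|i s IH].
  under eq_fun do rewrite big_nil; rewrite big_nil; exact: cvg_cst.
under eq_fun do rewrite big_cons; rewrite big_cons; apply: cvgM => //.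
have /andP[ai bi] := xab i.
rewrite -[X in _ --> X](mulr1 1); apply: cvgM.
  under eq_fun do rewrite -mulrBr.
  by apply: ebump0_cvg; rewrite subr_gt0.
rewrite (_ : (fun _ => _) = (fun k => ebump 0 (k%:R * (b i - x ord0 i)))).
  by apply: ebump0_cvg; rewrite subr_gt0.
by apply/funext => k; congr ebump; ring.
Qed.

Lemma compact_closed_box a b : compact (closed_box a b).
Proof.
rewrite (_ : closed_box a b = [set v | forall i, `[a i, b i]%classic (v ord0 i)]).
  by apply: (rV_compact (A := fun i => `[a i, b i]%classic)) => i; exact: segment_compact.
by apply/seteqP; split => x /= h i; have := h i; rewrite /= in_itv.
Qed.

Lemma test_function_box_bump a b k (V : set 'rV[R]_n) : closed_box a b `<=` V ->
  test_function V (box_bump a b k).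
Proof.
move=> abV; split; first exact: smooth_box_bump.
exists (closed_box a b); split => //; first exact: compact_closed_box.
move=> x nx; apply: box_bump_out => ox; apply: nx => i.
by have /andP[/ltW -> /ltW ->] := ox i.
Qed.

End smooth_functions.

(** * Semi-inner products and the Riesz representation *)

Section semi_inner_product.
Variables (R : realType) (T : Type).
Implicit Types (V : set (T -> R)) (b : (T -> R) -> (T -> R) -> R) (u v w : T -> R).

(** Definiteness is not asked for, since functions equal almost everywhere are not identified. Sums
    and multiples are written as explicit functions, and the axioms are only required inside [V]. *)
Record semi_ip V b : Prop := SemiIp {
  sip0 : V (fun=> 0);
  sip_lin : forall a u v, V u -> V v -> V (fun x => a * u x + v x);
  sip_linear : forall a u v w, V u -> V v -> V w ->
    b (fun x => a * u x + v x) w = a * b u w + b v w;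
  sip_sym : forall u v, V u -> V v -> b u v = b v u;
  sip_ge0 : forall u, V u -> 0 <= b u u }.

Definition snorm b u : R := Num.sqrt (b u u).

Definition scomplete V b := forall u_ : nat -> T -> R, (forall k, V (u_ k)) ->
  (forall e, 0 < e -> exists N, forall j k, (N <= j)%N -> (N <= k)%N ->
     snorm b (u_ j \- u_ k) <= e) ->
  exists2 u, V u & forall e, 0 < e -> exists N, forall k, (N <= k)%N ->
     snorm b (u_ k \- u) <= e.

Variables (V : set (T -> R)) (b : (T -> R) -> (T -> R) -> R).
Hypothesis Vb : semi_ip V b.

Lemma sipB u v : V u -> V v -> V (u \- v).
Proof.
move=> Vu Vv; rewrite (_ : u \- v = fun x => - 1 * v x + u x); first exact: (sip_lin Vb).
by apply/funext => x /=; ring.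
Qed.

Lemma sipZ a u : V u -> V (fun x => a * u x).
Proof.
move=> Vu; rewrite (_ : (fun _ => _) = fun x => a * u x + 0).
  exact: (sip_lin Vb a Vu (sip0 Vb)).
by apply/funext => x; rewrite addr0.
Qed.

Lemma sip_zero w : V w -> b (fun=> 0) w = 0.
Proof.
move=> Vw; have := sip_linear Vb 1 (sip0 Vb) (sip0 Vb) Vw.
rewrite (_ : (fun _ => _) = fun=> 0); last by apply/funext => x; rewrite mulr0 addr0.
by lra.
Qed.

Lemma sip_linearZ a u w : V u -> V w -> b (fun x => a * u x) w = a * b u w.
Proof.
move=> Vu Vw; have := sip_linear Vb a Vu (sip0 Vb) Vw.
rewrite sip_zero// addr0 => <-; congr (b _ w); apply/funext => x; by rewrite addr0.
Qed.

Lemma sip_linearB u v w : V u -> V v -> V w -> b (u \- v) w = b u w - b v w.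
Proof.
move=> Vu Vv Vw; have := sip_linear Vb (- 1) Vv Vu Vw.
rewrite mulN1r addrC => <-; congr (b _ w); apply/funext => x /=; ring.
Qed.

Lemma sip_linear_r a u v w : V u -> V v -> V w ->
  b w (fun x => a * u x + v x) = a * b w u + b w v.
Proof.
move=> Vu Vv Vw; rewrite (sip_sym Vb)//; last exact: (sip_lin Vb).
by rewrite (sip_linear Vb)// !(sip_sym Vb Vw).
Qed.

Lemma sip_quad t u v : V u -> V v ->
  b (fun x => t * v x + u x) (fun x => t * v x + u x) = b u u + 2 * t * b u v + t ^+ 2 * b v v.
Proof.
move=> Vu Vv; have Vw := sip_lin Vb t Vv Vu.
rewrite (sip_linear Vb)// !sip_linear_r// (sip_sym Vb Vv Vu)//; ring.
Qed.

Lemma snorm_ge0 u : 0 <= snorm b u. Proof. exact: sqrtr_ge0. Qed.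

Lemma snorm_sqr u : V u -> snorm b u ^+ 2 = b u u.
Proof. by move=> Vu; rewrite sqr_sqrtr// (sip_ge0 Vb). Qed.

(** The discriminant inequality, phrased with square roots so as to give Cauchy-Schwarz at once;
    [riesz_representation] also uses it to bound the first variation at an approximate minimizer. *)
Lemma quadratic_bound (p q r : R) : 0 <= p -> 0 <= r ->
  (forall t, 0 <= p + 2 * t * q + t ^+ 2 * r) -> `|q| <= Num.sqrt p * Num.sqrt r.
Proof.
move=> p0 r0 H; rewrite -sqrtrM// -sqrtr_sqr ler_wsqrtr//.
have [r00|rn] := eqVneq r 0; last first.
  have rp : 0 < r by rewrite lt_def rn.
  have := H (- q / r).
  have -> : p + 2 * (- q / r) * q + (- q / r) ^+ 2 * r = (p * r - q ^+ 2) / r by field.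
  by rewrite pmulr_lge0 ?invr_gt0// subr_ge0.
rewrite r00 mulr0; have [->|qn] := eqVneq q 0; first by rewrite expr0n.
(* With r = 0 the polynomial is affine in t, and this t gives it the value -1. *)
exfalso; have := H (- (p + 1) / (2 * q)).
have -> : p + 2 * (- (p + 1) / (2 * q)) * q + (- (p + 1) / (2 * q)) ^+ 2 * r = - 1.
  by rewrite r00; field.
by rewrite lerNr oppr0 leNgt ltr01.
Qed.

Lemma snorm_CS u v : V u -> V v -> `|b u v| <= snorm b u * snorm b v.
Proof.
move=> Vu Vv; apply: quadratic_bound; rewrite ?(sip_ge0 Vb)// => t.
by rewrite -sip_quad// (sip_ge0 Vb)//; exact: (sip_lin Vb).
Qed.

Lemma snormD u v : V u -> V v -> snorm b (fun x => u x + v x) <= snorm b u + snorm b v.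
Proof.
move=> Vu Vv.
rewrite -(@ler_pXn2r _ 2)// ?nnegrE ?snorm_ge0 ?addr_ge0 ?snorm_ge0//.
have := sip_quad 1 Vv Vu; have := sip_lin Vb 1 Vu Vv.
rewrite (_ : (fun x => 1 * u x + v x) = fun x => u x + v x); last first.
  by apply/funext => x; rewrite mul1r.
move=> Vw E; rewrite snorm_sqr// E sqrrD !snorm_sqr//.
have := le_trans (ler_norm _) (snorm_CS Vv Vu); lra.
Qed.

Lemma snormZ a u : V u -> snorm b (fun x => a * u x) = `|a| * snorm b u.
Proof.
move=> Vu; rewrite /snorm sip_linearZ//; last exact: sipZ.
rewrite (sip_sym Vb)//; last exact: sipZ.
by rewrite sip_linearZ// mulrA -expr2 sqrtrM ?sqr_ge0// sqrtr_sqr.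
Qed.

Lemma snorm_sub u v : V u -> V v -> snorm b (u \- v) = snorm b (v \- u).
Proof.
move=> Vu Vv; rewrite -[RHS]mul1r -[1 in RHS](normrN1 R) -snormZ; last exact: sipB.
by congr snorm; apply/funext => x /=; rewrite mulN1r opprB.
Qed.

Lemma snormB u v : V u -> V v -> snorm b (u \- v) <= snorm b u + snorm b v.
Proof.
move=> Vu Vv; have := snormD Vu (sipZ (- 1) Vv).
rewrite snormZ// normrN1 mul1r; apply: le_trans.
by rewrite (_ : (fun _ => _) = u \- v)//; apply/funext => x /=; rewrite mulN1r.
Qed.

(* Minimizing sequences of [b v v - 2 l v] are Cauchy, and their limits solve the equation. *)
Lemma riesz_representation (l : (T -> R) -> R) (M : R) : scomplete V b ->
  (forall a u v, V u -> V v -> l (fun x => a * u x + v x) = a * l u + l v) ->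
  (forall v, V v -> `|l v| <= M * snorm b v) ->
  exists2 u, V u & forall v, V v -> b u v = l v.
Proof.
move=> cV llin lbd.
pose J v := b v v - 2 * l v.
pose S := [set J v | v in V].
have Jlb v : V v -> - M ^+ 2 <= J v.
  move=> Vv; have := lbd _ Vv; rewrite ler_norml /J -(snorm_sqr Vv) => /andP[_].
  have := sqr_ge0 (snorm b v - M); rewrite sqrrB; lra.
have S0 : S !=set0 by exists (J (fun=> 0)); exists (fun=> 0) => //; exact: sip0 Vb.
have hS : has_inf S.
  by split => //; exists (- M ^+ 2) => _ [v Vv <-]; exact: Jlb.
have ex k : exists v, V v /\ J v <= inf S + (k%:R + 1)^-1.
  have k0 : 0 < (k%:R + 1)^-1 :> R by rewrite invr_gt0 ltr_wpDl.
  by have [_ [v Vv <-] /ltW h] := inf_adherent k0 hS; exists v.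
pose v_ k := projT1 (cid (ex k)).
have Vv k : V (v_ k) by rewrite /v_; case: cid => v [].
have Jv k : J (v_ k) <= inf S + (k%:R + 1)^-1 by rewrite /v_; case: cid => v [].
(* As J (v_k + t w) >= inf S >= J v_k - 1/(k+1), the polynomial 1/(k+1) + 2 t (b v_k w - l w) + t^2
   b w w is nonnegative for all t. *)
have key k w : V w -> `|b (v_ k) w - l w| <= Num.sqrt ((k%:R + 1)^-1) * snorm b w.
  move=> Vw; apply: quadratic_bound; rewrite ?(sip_ge0 Vb)// ?invr_ge0 ?addr_ge0// => t.
  have : inf S <= J (fun x => t * w x + v_ k x).
    by apply: ge_inf; [case: hS|exists (fun x => t * w x + v_ k x) => //; exact: (sip_lin Vb t Vw (Vv k))].
  rewrite /J sip_quad// llin//; have := Jv k; rewrite /J; lra.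
have rk (e : R) : 0 < e -> exists N, forall k, (N <= k)%N -> Num.sqrt ((k%:R + 1)^-1) <= e.
  move=> e0; exists (Num.truncn (e ^- 2)).+1 => k Nk.
  rewrite -(ger0_norm (ltW e0)) -sqrtr_sqr ler_wsqrtr//.
  rewrite -[leRHS]invrK lef_pV2 ?posrE ?invr_gt0 ?exprn_gt0 ?ltr_wpDl//.
  apply: (le_trans (ltW (truncnS_gt _))).
  by rewrite (@le_trans _ _ k%:R)// ?ler_nat// lerDl.
have [u Vu ul] : exists2 u, V u & forall e, 0 < e -> exists N, forall k, (N <= k)%N ->
     snorm b (v_ k \- u) <= e.
  apply: cV => // e e0; have [N NP] := rk (e / 2) (divr_gt0 e0 (ltr0Sn _ 1)).
  exists N => j k /NP Nj /NP Nk.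
  (* Testing [key] at both indices with the difference itself and subtracting bounds its squared
     norm by e times its norm. *)
  set w := v_ j \- v_ k; have Vw : V w by exact: sipB.
  have h : snorm b w ^+ 2 <= e * snorm b w.
    rewrite snorm_sqr// {1}/w sip_linearB//.
    have := key j w Vw; have := key k w Vw; rewrite !ler_norml => /andP[k1 k2] /andP[j1 j2].
    have := ler_wpM2r (snorm_ge0 w) Nj; have := ler_wpM2r (snorm_ge0 w) Nk; lra.
  have [w0|wn] := eqVneq (snorm b w) 0; first by rewrite w0 ltW.
  have wp : 0 < snorm b w by rewrite lt_def wn snorm_ge0.
  by rewrite -(ler_pM2r wp) -expr2.
exists u => // v Vv'; apply/eqP; rewrite -subr_eq0 -normr_le0; apply/ler_addgt0Pl => e e0.
rewrite addr0.
pose d := e / 2 / (snorm b v + 1).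
have sp : 0 < snorm b v + 1 by rewrite ltr_wpDl ?snorm_ge0.
have d0 : 0 < d by rewrite !divr_gt0.
have [N1 N1P] := rk d d0; have [N2 N2P] := ul d d0.
pose k := maxn N1 N2.
have := N1P k (leq_maxl _ _); have := N2P k (leq_maxr _ _).
set s1 := snorm _ _; set s2 := Num.sqrt _ => h1 h2.
have h3 : `|b (v_ k) v - b u v| <= s1 * snorm b v.
  by rewrite -sip_linearB//; apply: snorm_CS => //; exact: sipB.
have h4 := key k v Vv'; rewrite -/s2 in h4.
have -> : b u v - l v = (b (v_ k) v - l v) - (b (v_ k) v - b u v) by ring.
apply: (le_trans (ler_normB _ _)); apply: (le_trans (lerD h4 h3)).
rewrite -mulrDl; apply: (@le_trans _ _ ((d + d) * (snorm b v + 1))).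
  by apply: ler_pM; rewrite ?snorm_ge0 ?addr_ge0 ?sqrtr_ge0 ?lerD// lerDl.
by rewrite /d -mulrDl -splitr divfK// gt_eqF.
Qed.

End semi_inner_product.

(** * Weighted L^2 spaces *)

Section geometric_sequence.
Variable R : realType.

Lemma half_expn_cvg (C : R) : (fun k : nat => C * 2^-1 ^+ k) @ \oo --> 0.
Proof.
have h : (fun k : nat => 2^-1 ^+ k) @ \oo --> (0 : R).
  by apply: cvg_expr; rewrite ger0_norm// invf_lt1// ltr1n.
by have := cvgMl_tmp (a := C) h; rewrite mulr0; apply.
Qed.

Lemma geometric_cvg (w : nat -> R) (C : R) : (forall i, `|w i.+1 - w i| <= C * 2^-1 ^+ i) ->
  cvgn w /\ forall k, `|limn w - w k| <= 2 * C * 2^-1 ^+ k.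
Proof.
move=> H.
have C0 : 0 <= C by have := le_trans (normr_ge0 _) (H 0%N); rewrite expr0 mulr1.
have B k j : `|w (k + j)%N - w k| <= 2 * C * 2^-1 ^+ k.
  suff : `|w (k + j)%N - w k| <= 2 * C * 2^-1 ^+ k - 2 * C * 2^-1 ^+ (k + j).
    by move=> /le_trans; apply; rewrite gerBl mulr_ge0 ?mulr_ge0// exprn_ge0.
  elim: j => [|j IH]; first by rewrite addn0 !subrr normr0.
  rewrite addnS; have -> : w (k + j).+1 - w k = (w (k + j).+1 - w (k + j)%N) + (w (k + j)%N - w k) by ring.
  apply: (le_trans (ler_normD _ _)); apply: (le_trans (lerD (H _) IH)).
  rewrite exprS; lra.
have cw : cvgn w.
  (* Adding the geometric tail bound makes the sequence nonincreasing, so monotone convergence gives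
     the limit. *)
  pose v k := w k + 2 * C * 2^-1 ^+ k.
  have cv : cvgn v.
    apply: nonincreasing_is_cvgn.
      apply/nonincreasing_seqP => k; rewrite /v exprS.
      have := H k; rewrite ler_norml => /andP[_]; lra.
    exists (w 0%N - 2 * C) => _ [k _ <-].
    have := B 0%N k; rewrite add0n expr0 mulr1 ler_norml => /andP[h _].
    have : 0 <= 2 * C * 2^-1 ^+ k by rewrite mulr_ge0 ?mulr_ge0// exprn_ge0.
    rewrite /v; lra.
  rewrite (_ : w = v \- (fun k => 2 * C * 2^-1 ^+ k)).
    by apply: is_cvgB => //; apply/cvg_ex; exists 0; exact: half_expn_cvg.
  by apply/funext => k; rewrite /v /=; ring.
split => // k.
have cwk : (fun j => `|w j - w k|) @ \oo --> `|limn w - w k|.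
  by apply: cvg_norm; apply: cvgB; [exact: cw|exact: cvg_cst].
rewrite -(cvg_lim _ cwk)//; apply: limr_le; first by apply/cvg_ex; eexists; exact: cwk.
near=> j; have kj : (k <= j)%N by near: j; exact: nbhs_infty_ge.
by rewrite -(subnKC kj); exact: B.
Unshelve. all: by end_near. Qed.

End geometric_sequence.

Section weighted_L2.
Variables (R : realType) (n : nat) (U : set 'rV[R]_n) (omega : 'rV[R]_n -> R).
Local Notation mu := (@lebesgue_rV R n).
Implicit Types u v w c : 'rV[R]_n -> R.
Hypotheses (mU : measurable U) (mom : measurable_fun U omega).
Hypothesis om0 : forall x, U x -> 0 < omega x.

Definition ip u v : R := \int[mu]_(x in U) (omega x * (u x * v x)).

Lemma ae_eq_Rintegral (f g : 'rV[R]_n -> R) : measurable_fun U f -> measurable_fun U g ->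
  (f = g %[ae mu in U]) -> \int[mu]_(x in U) f x = \int[mu]_(x in U) g x.
Proof.
move=> mf mg fg; congr fine; apply: ae_eq_integral => //.
- exact/measurable_EFinP.
- exact/measurable_EFinP.
- by apply: filterS fg => x /= fg Ux; rewrite fg.
Qed.

Lemma L2_meas u : L2 omega U u -> measurable_fun U u. Proof. by case. Qed.

Lemma L2_sqr_integrable u : L2 omega U u ->
  mu.-integrable U (EFin \o (fun x => omega x * u x ^+ 2)).
Proof.
move=> [mu_ fu]; apply/integrableP; split.
  by apply/measurable_EFinP; apply: measurable_funM => //; exact: measurable_funX.
rewrite (_ : (\int[_]_(_ in _) _)%E = (\int[mu]_(x in U) (omega x * u x ^+ 2)%:E)%E)//.
apply: eq_integral => x; rewrite inE => Ux /=.
by rewrite ger0_norm// mulr_ge0 ?sqr_ge0// ltW// om0.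
Qed.

Lemma L2_bound u (g : 'rV[R]_n -> R) : measurable_fun U u -> mu.-integrable U (EFin \o g) ->
  (forall x, U x -> omega x * u x ^+ 2 <= g x) -> L2 omega U u.
Proof.
move=> mu_ ig ug; split => //.
apply: (@le_lt_trans _ _ (\int[mu]_(x in U) `|(EFin \o g) x|)%E); last by case/integrableP : ig.
apply: ge0_le_integral => //.
- by move=> x Ux; rewrite lee_fin mulr_ge0 ?sqr_ge0// ltW// om0.
- by apply/measurable_EFinP; apply: measurable_funM => //; exact: measurable_funX.
- by apply: measurableT_comp => //; case/integrableP : ig.
- by move=> x Ux /=; rewrite lee_fin (le_trans (ug _ Ux))// ler_norm.
Qed.

Lemma L2_ip_integrable u v : L2 omega U u -> L2 omega U v ->
  mu.-integrable U (EFin \o (fun x => omega x * (u x * v x))).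
Proof.
move=> Lu Lv.
have h : mu.-integrable U ((EFin \o (fun x => omega x * u x ^+ 2)%R) \+ (EFin \o (fun x => omega x * v x ^+ 2)%R))%E.
  by apply: integrableD => //; exact: L2_sqr_integrable.
apply: le_integrable h => //.
  by apply/measurable_EFinP; apply: measurable_funM => //; apply: measurable_funM; apply: L2_meas.
move=> x Ux /=; have o0 := om0 Ux; rewrite lee_fin.
suff : `|omega x * (u x * v x)| <= omega x * u x ^+ 2 + omega x * v x ^+ 2.
  by move=> /le_trans; apply; exact: ler_norm.
rewrite normrM (gtr0_norm o0) -mulrDr ler_wpM2l ?(ltW o0)//.
rewrite normrM -(real_normK (num_real (u x))) -(real_normK (num_real (v x))).
have := sqr_ge0 (`|u x| - `|v x|); have := normr_ge0 (u x); have := normr_ge0 (v x).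
move: `|u x| `|v x| => a b b0 a0; nra.
Qed.

Lemma L2_lin a u v : L2 omega U u -> L2 omega U v -> L2 omega U (fun x => a * u x + v x).
Proof.
move=> Lu Lv.
apply: (@L2_bound _ (fun x => 2 * a ^+ 2 * (omega x * u x ^+ 2) + 2 * (omega x * v x ^+ 2))).
- apply: measurable_funD; last exact: L2_meas.
  by apply: measurable_funM => //; exact: L2_meas.
- apply: (@integrableD _ _ _ _ _ _ (fun x => (2 * a ^+ 2)%:E * (omega x * u x ^+ 2)%:E)%E (fun x => 2%:E * (omega x * v x ^+ 2)%:E)%E) => //;
    by apply: integrableZl => //; exact: L2_sqr_integrable.
- move=> x Ux; have o0 := om0 Ux; rewrite -!(mulrCA (omega x)) -mulrDr ler_wpM2l ?(ltW o0)//.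
  rewrite -subr_ge0 (_ : _ - _ = (a * u x - v x) ^+ 2) ?sqr_ge0//; ring.
Qed.

Lemma L2_0 : L2 omega U (fun=> 0).
Proof.
split => //; under eq_integral do rewrite expr0n mulr0.
by rewrite integral0.
Qed.

Lemma L2_semi_ip : semi_ip (L2 omega U) ip.
Proof.
split.
- exact: L2_0.
- exact: L2_lin.
- move=> a u v w Lu Lv Lw; rewrite /ip.
  rewrite -RintegralZl//; last exact: L2_ip_integrable.
  rewrite -RintegralD//; last 2 first.
  + have := integrableZl mU a (L2_ip_integrable Lu Lw); exact.
  + exact: L2_ip_integrable.
  by apply: eq_Rintegral => x _; ring.
- by move=> u v _ _; apply: eq_Rintegral => x _; ring.
- by move=> u _; apply: Rintegral_ge0 => x Ux; apply: mulr_ge0; [exact/ltW/om0|rewrite -expr2 sqr_ge0].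
Qed.

Lemma L2_normE u : L2_norm omega U u = snorm ip u.
Proof. by congr Num.sqrt; apply: eq_Rintegral => x _; rewrite expr2. Qed.

Lemma ip_EFin u : L2 omega U u -> (\int[mu]_(x in U) (omega x * u x ^+ 2)%:E)%E = (ip u u)%:E.
Proof.
move=> Lu; rewrite /ip /Rintegral fineK.
  by apply: eq_integral => x _; rewrite expr2.
by apply: integrable_fin_num => //; exact: L2_ip_integrable.
Qed.

Lemma snorm_eq0_ae u : L2 omega U u -> snorm ip u = 0 -> u = cst 0 %[ae mu in U].
Proof.
move=> Lu; move/eqP; rewrite sqrtr_eq0 => u0.
have {u0} u0 : ip u u = 0 by apply/eqP; rewrite eq_le u0 (sip_ge0 L2_semi_ip).
have m2 : measurable_fun U (fun x => (omega x * u x ^+ 2)%:E).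
  by apply/measurable_EFinP; apply: measurable_funM => //; apply: measurable_funX; exact: L2_meas.
have := (@ae_eq_integral_abs _ _ _ mu _ mU _ m2).1.
have -> : (\int[mu]_(x in U) `|(omega x * u x ^+ 2)%:E|)%E = 0%E.
  rewrite -[RHS]/(0%:E) -u0 -ip_EFin//; apply: eq_integral => x; rewrite inE => Ux.
  by rewrite gee0_abs// lee_fin mulr_ge0 ?sqr_ge0// ltW// om0.
move=> /(_ erefl); apply: filterS => x /= h Ux; have := h Ux.
by case=> /eqP; rewrite mulf_eq0 gt_eqF ?om0//= sqrf_eq0 => /eqP.
Qed.

Lemma ip_ae u u' v : L2 omega U u -> L2 omega U u' -> L2 omega U v ->
  u = u' %[ae mu in U] -> ip u v = ip u' v.
Proof.
move=> Lu Lu' Lv uu'; apply: ae_eq_Rintegral.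
- by apply: measurable_funM => //; apply: measurable_funM; exact: L2_meas.
- by apply: measurable_funM => //; apply: measurable_funM; exact: L2_meas.
- by apply: filterS uu' => x /= h Ux; rewrite h.
Qed.

(** The absolute value is taken because the almost everywhere bound does not force [K] to be
    nonnegative when [U] is null. *)
Lemma L2_mul_bounded c u K : measurable_fun U c -> {ae mu, forall x, U x -> `|c x| <= K} ->
  L2 omega U u -> L2 omega U (fun x => c x * u x) /\ snorm ip (fun x => c x * u x) <= `|K| * snorm ip u.
Proof.
move=> mc cK Lu.
have mcu : measurable_fun U (fun x => c x * u x) by apply: measurable_funM => //; exact: L2_meas.
have le1 : (\int[mu]_(x in U) (omega x * (c x * u x) ^+ 2)%:E <= (K ^+ 2 * ip u u)%:E)%E.
  rewrite EFinM -ip_EFin// -ge0_integralZl//; last 3 first.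
  - by apply/measurable_EFinP; apply: measurable_funM => //; apply: measurable_funX; exact: L2_meas.
  - by move=> x Ux; rewrite lee_fin mulr_ge0 ?sqr_ge0// ltW// om0.
  - by rewrite lee_fin sqr_ge0.
  apply: ae_ge0_le_integral => //.
  - by move=> x Ux; rewrite lee_fin mulr_ge0 ?sqr_ge0// ltW// om0.
  - by apply/measurable_EFinP; apply: measurable_funM => //; apply: measurable_funX.
  - by move=> x Ux; rewrite mule_ge0// lee_fin ?sqr_ge0// mulr_ge0 ?sqr_ge0// ltW// om0.
  - apply: measurable_funeM; apply/measurable_EFinP; apply: measurable_funM => //; apply: measurable_funX; exact: L2_meas.
  - apply: filterS cK => x h Ux; have o0 := om0 Ux.
    rewrite -EFinM lee_fin [leRHS]mulrCA ler_wpM2l ?(ltW o0)// exprMn ler_wpM2r ?sqr_ge0//.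
    rewrite -(real_normK (num_real (c x))) ler_pXn2r ?nnegrE ?h//.
    by rewrite (le_trans _ (h Ux)).
have Lcu : L2 omega U (fun x => c x * u x).
  by split => //; apply: (le_lt_trans le1); rewrite ltry.
split => //; rewrite ip_EFin// lee_fin in le1.
by rewrite -sqrtr_sqr -sqrtrM ?sqr_ge0// ler_wsqrtr.
Qed.

End weighted_L2.

(** * Completeness of the weighted L^2 spaces *)

Section fast_sequences.
Variables (R : realType) (T : Type) (V : set (T -> R)) (b : (T -> R) -> (T -> R) -> R).
Hypothesis Vb : semi_ip V b.

(** A Cauchy sequence converges as soon as a subsequence does, and a subsequence can be chosen with
    increments at most 4^-k. *)
Lemma scomplete_of_fast :
  (forall w : nat -> T -> R, (forall k, V (w k)) ->
    (forall k, snorm b (w k.+1 \- w k) <= 4^-1 ^+ k) ->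
    exists2 u, V u & exists C, forall k, snorm b (w k \- u) <= C * 2^-1 ^+ k) ->
  scomplete V b.
Proof.
move=> fast u Vu cu.
have e0 k : 0 < 4^-1 ^+ k :> R by rewrite exprn_gt0.
pose N k := projT1 (cid (cu _ (e0 k))).
have NP k i j : (N k <= i)%N -> (N k <= j)%N -> snorm b (u i \- u j) <= 4^-1 ^+ k.
  by rewrite /N; case: cid => M; exact.
(* Partial sums of the moduli [N] give an index that is at least [N k] and nondecreasing in [k]. *)
pose m k := (\sum_(i < k.+1) N i)%N.
have mN k : (N k <= m k)%N by rewrite /m big_ord_recr/= leq_addl.
have mS k : (m k <= m k.+1)%N by rewrite {2}/m big_ord_recr/= leq_addr.
have [|k|v Vv [C hC]] := fast (fun k => u (m k)); first by move=> k; exact: Vu.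
  by apply: NP => //; exact: leq_trans (mN k) (mS k).
exists v => // e ep.
have [k [k1 k2]] : exists k, `|C| * 2^-1 ^+ k <= e / 2 /\ 1 * 2^-1 ^+ k <= e / 2.
  have e2 : 0 < e / 2 by rewrite divr_gt0.
  have h (D : R) : \forall k \near \oo, D * 2^-1 ^+ k <= e / 2.
    have /cvgrPdist_le /(_ _ e2) := @half_expn_cvg R D.
    apply: filterS => k; rewrite sub0r normrN; apply: le_trans; exact: ler_norm.
  by have [k []] := filter_ex (filterI (h `|C|) (h 1)); exists k.
exists (m k) => j mj.
have -> : u j \- v = fun x => (u j \- u (m k)) x + (u (m k) \- v) x.
  by apply/funext => x /=; ring.
apply: (le_trans (snormD Vb (sipB Vb _ _) (sipB Vb _ _))) => //.
rewrite [e]splitr lerD//.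
  apply: (le_trans (NP k j (m k) _ _)) => //; first exact: leq_trans mj.
  apply: le_trans k2; rewrite mul1r lerXn2r ?nnegrE ?invr_ge0// lef_pV2 ?posrE// ler_nat//.
apply: (le_trans (hC k)); apply: le_trans k1.
by rewrite ler_wpM2r ?exprn_ge0// ler_norm.
Qed.

End fast_sequences.

Section L2_completeness.
Variables (R : realType) (n : nat) (U : set 'rV[R]_n) (omega : 'rV[R]_n -> R).
Local Notation mu := (@lebesgue_rV R n).
Local Notation ip := (ip U omega).
Hypotheses (mU : measurable U) (mom : measurable_fun U omega).
Hypothesis om0 : forall x, U x -> 0 < omega x.

Let sipL2 := L2_semi_ip mU mom om0.

(** Riesz-Fischer. The series T of 4^k omega (w_(k+1) - w_k)^2 has finite integral, since the k-th
    squared norm is at most 16^-k. Where T is finite the increments are at most sqrt (T / omega)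
    2^-k, so the pointwise limit exists, and 4 T 4^-k bounds the weighted squared error, which
    yields the rate in norm directly. *)
Lemma L2_fast_limit (w : nat -> 'rV[R]_n -> R) : (forall k, L2 omega U (w k)) ->
  (forall k, snorm ip (w k.+1 \- w k) <= 4^-1 ^+ k) ->
  exists2 u, L2 omega U u & exists C, forall k, snorm ip (w k \- u) <= C * 2^-1 ^+ k.
Proof.
move=> Lw fw.
have e4 i : (2^-1 ^+ i) ^+ 2 = 4^-1 ^+ i :> R.
  by rewrite -exprM mulnC exprM expr2 -invfM -natrM.
pose g k x : \bar R := ((4 ^+ k) * (omega x * (w k.+1 x - w k x) ^+ 2))%:E.
have Ld k : L2 omega U (w k.+1 \- w k) by exact: (sipB sipL2).
have mg k : measurable_fun U (g k).
  apply/measurable_EFinP; apply: measurable_funM => //; apply: measurable_funM => //.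
  by apply: measurable_funX; apply: measurable_funB; apply: L2_meas.
have g0 k x : U x -> (0 <= g k x)%E.
  by move=> Ux; rewrite lee_fin mulr_ge0 ?exprn_ge0// mulr_ge0 ?sqr_ge0// ltW// om0.
pose T x := (\sum_(0 <= k <oo) g k x)%E.
have T0 x : U x -> (0 <= T x)%E by move=> Ux; apply: nneseries_ge0 => k _ _; exact: g0.
have mT : measurable_fun U T.
  by apply: ge0_emeasurable_sum => // k x Ux _; exact: g0.
have intg k : (\int[mu]_(x in U) g k x <= (4^-1 ^+ k)%:E)%E.
  rewrite /g; under eq_integral do rewrite EFinM.
  rewrite ge0_integralZl//; last 2 first.
  - by apply/measurable_EFinP; apply: measurable_funM => //; apply: measurable_funX; exact: L2_meas (Ld k).
  - by move=> x Ux; rewrite lee_fin mulr_ge0 ?sqr_ge0// ltW// om0.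
  rewrite (ip_EFin mU mom om0 (Ld k)) -EFinM lee_fin -(snorm_sqr sipL2)//.
  have h : snorm ip (w k.+1 \- w k) ^+ 2 <= (4^-1 ^+ k) ^+ 2.
    by rewrite ler_pXn2r ?nnegrE ?snorm_ge0 ?exprn_ge0// fw.
  apply: (le_trans (ler_wpM2l (exprn_ge0 _ _) h)) => //.
  by rewrite expr2 mulrA -exprMn divff// expr1n mul1r.
have intT : (\int[mu]_(x in U) T x <= 2%:E)%E.
  rewrite integral_nneseries//.
  apply: (@le_trans _ _ (\sum_(0 <= k <oo) (4^-1 ^+ k)%:E)%E).
    apply: lee_nneseries => // k _ _; first by apply: integral_ge0 => x Ux; exact: g0.
  apply: lime_le; first by apply: is_cvg_nneseries => k _ _; rewrite lee_fin exprn_ge0.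
  have S4 m : \sum_(0 <= i < m) 4^-1 ^+ i <= 2 - 2 * 4^-1 ^+ m :> R.
    elim: m => [|m IH]; first by rewrite big_nil expr0; lra.
    rewrite big_nat_recr//= exprS; have : 0 <= 4^-1 ^+ m :> R by rewrite exprn_ge0.
    by lra.
  near=> m; rewrite sumEFin lee_fin.
  by apply: (le_trans (S4 m)); rewrite gerBl mulr_ge0// exprn_ge0.
have iT : mu.-integrable U T.
  apply/integrableP; split => //.
  rewrite (le_lt_trans _ (ltry 2))//; apply: le_trans intT.
  by apply: ge0_le_integral => //; [apply: measurableT_comp|move=> x Ux; rewrite gee0_abs// T0].
pose G := U `&` [set x | (T x < +oo)%E].
have mG : measurable G by exact: measurable_lte.
have step x : G x -> let C := Num.sqrt (fine (T x) / omega x) in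
    forall i, `|w i.+1 x - w i x| <= C * 2^-1 ^+ i.
  move=> [Ux Tx] /= i; have o0 := om0 Ux.
  have Tfin : T x \is a fin_num by rewrite ge0_fin_numE// T0.
  have gT : (4 ^+ i) * (omega x * (w i.+1 x - w i x) ^+ 2) <= fine (T x).
    rewrite -lee_fin fineK// -[leLHS]/(g i x) /T (nneseriesD1 (n := i))//; last by move=> k _; exact: g0.
    by rewrite leeDl// nneseries_ge0// => k _ _; exact: g0.
  rewrite -ler_sqr ?nnegrE ?mulr_ge0 ?sqrtr_ge0 ?exprn_ge0//.
  rewrite real_normK ?num_real// exprMn sqr_sqrtr; last first.
    by rewrite divr_ge0 ?(ltW o0)// fine_ge0// T0.
  rewrite e4 mulrAC ler_pdivlMr// exprVn ler_pdivlMr ?exprn_gt0//.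
  by apply: le_trans gT; rewrite mulrC [X in _ * X]mulrC.
pose u x := if x \in G then limn (w ^~ x) else 0.
have mu_ : measurable_fun U u.
  apply: (@measurable_fun_cvg _ _ _ _ (fun k x => w k x * \1_G x)).
    move=> k; apply: measurable_funM; first exact: L2_meas.
    exact: measurable_indic.
  move=> x Ux; rewrite /u indicE; have [xG|xG] := boolP (x \in G); last first.
    by under eq_fun do rewrite mulr0; exact: cvg_cst.
  under eq_fun do rewrite mulr1.
  by have [] := geometric_cvg (step x (set_mem xG)).
(* Outside [G] the right-hand side is infinite, so the bound holds at every point of [U] and no null
   set has to be discarded. *)
have diff k x : U x -> ((omega x * (u x - w k x) ^+ 2)%:E <= (4 * (4^-1 ^+ k))%:E * T x)%E.
  move=> Ux; have o0 := om0 Ux; have [xG|xG] := boolP (x \in G); last first.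
    have -> : T x = +oo%E.
      apply/eqP; rewrite eq_le leey/= leNgt; apply: contra xG => h.
      by rewrite inE; split.
    by rewrite gt0_muley ?leey// lte_fin mulr_gt0 ?exprn_gt0.
  have [_ /(_ k)] := geometric_cvg (step x (set_mem xG)).
  rewrite /u xG; set D := limn _ - _ => hD.
  have [_ Tx] := set_mem xG.
  have Tfin : T x \is a fin_num by rewrite ge0_fin_numE// T0.
  rewrite -(fineK Tfin) -EFinM lee_fin.
  have ft : 0 <= fine (T x) by rewrite fine_ge0// T0.
  have : `|D| ^+ 2 <= (2 * Num.sqrt (fine (T x) / omega x) * 2^-1 ^+ k) ^+ 2.
    by rewrite ler_pXn2r// ?nnegrE// !mulr_ge0 ?sqrtr_ge0 ?exprn_ge0.
  rewrite real_normK ?num_real// !exprMn sqr_sqrtr ?divr_ge0 ?(ltW o0)//.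
  rewrite e4 => h.
  apply: (le_trans (ler_wpM2l (ltW o0) h)).
  rewrite le_eqVlt; apply/orP; left; apply/eqP; field; exact: lt0r_neq0.
have Luw k : L2 omega U (u \- w k) /\ snorm ip (u \- w k) <= Num.sqrt 8 * 2^-1 ^+ k.
  have mk : measurable_fun U (u \- w k) by apply: measurable_funB => //; exact: L2_meas.
  have ik : (\int[mu]_(x in U) (omega x * (u \- w k) x ^+ 2)%:E <= (8 * 4^-1 ^+ k)%:E)%E.
    apply: (@le_trans _ _ (\int[mu]_(x in U) ((4 * (4^-1 ^+ k))%:E * T x))%E).
      apply: ge0_le_integral => //.
      - by move=> x Ux; rewrite lee_fin mulr_ge0 ?sqr_ge0// ltW// om0.
      - by apply/measurable_EFinP; apply: measurable_funM => //; exact: measurable_funX.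
      - exact: measurable_funeM.
      - by move=> x Ux; exact: diff.
    rewrite ge0_integralZl//.
    apply: (@le_trans _ _ ((4 * 4^-1 ^+ k)%:E * 2%:E)%E).
      by apply: lee_wpmul2l => //; rewrite lee_fin mulr_ge0 ?exprn_ge0.
    by rewrite -EFinM lee_fin; lra.
  have Lk : L2 omega U (u \- w k) by split => //; apply: (le_lt_trans ik); rewrite ltry.
  split => //; move: ik; rewrite (ip_EFin mU mom om0 Lk) lee_fin => ik.
  have -> : Num.sqrt 8 * 2^-1 ^+ k = Num.sqrt (8 * 4^-1 ^+ k) :> R.
    rewrite sqrtrM//; congr (_ * _).
    by rewrite -e4 sqrtr_sqr ger0_norm ?exprn_ge0.
  by rewrite /snorm ler_wsqrtr.
have Lu : L2 omega U u.
  have := L2_lin mU mom om0 1 (Luw 0%N).1 (Lw 0%N); congr (L2 _ _ _).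
  by apply/funext => x /=; ring.
exists u => //; exists (Num.sqrt 8) => k.
by rewrite (snorm_sub sipL2)//; exact: (Luw k).2.
Unshelve. all: by end_near. Qed.

Lemma L2_complete : scomplete (L2 omega U) ip.
Proof. exact: (scomplete_of_fast sipL2 L2_fast_limit). Qed.

End L2_completeness.

(** * The fundamental lemma of the calculus of variations *)

Section compact_rV.
Variables (R : realType) (n : nat).
Implicit Types (K : set 'rV[R]_n).

Lemma compact_rV_bounded K : compact K -> exists k, K `<=` @rV_box R n k.
Proof.
move=> /compact_bounded[M [Mr MP]].
exists (Num.truncn (`|M| + 1)).+1 => x Kx i.
have M1 : M < `|M| + 1 by rewrite (le_lt_trans (ler_norm M))// ltrDl.
have : mx_norm x <= `|M| + 1 := MP _ M1 x Kx.
rewrite mx_normrE => h.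
apply: (@le_trans _ _ (`|M| + 1)); last exact: ltW (truncnS_gt _).
by apply: le_trans h; apply: (le_bigmax _ (fun ij => `|x ij.1 ij.2|) (ord0, i)).
Qed.

Lemma compact_rV_closed K : compact K -> closed K.
Proof. by apply: compact_closed; exact: norm_hausdorff. Qed.

Lemma compact_rV_measurable K : compact K -> measurable K.
Proof.
move=> cK; rewrite -(setCK K); apply: measurableC; apply: open_rV_measurable.
by rewrite openC; exact: compact_rV_closed.
Qed.

Lemma compact_rV_measure K : compact K -> (lebesgue_rV K < +oo)%E.
Proof.
move=> cK; have [k Kk] := compact_rV_bounded cK.
apply: le_lt_trans (@lebesgue_rV_box R n k); apply: le_measure => //.
- by rewrite inE; exact: compact_rV_measurable.
- by rewrite inE; exact: measurable_rV_box.
Qed.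

Lemma continuous_compact_bounded K (f : 'rV[R]_n -> R) : continuous f -> compact K ->
  exists2 B, 0 <= B & forall x, K x -> `|f x| <= B.
Proof.
move=> cf cK.
have : compact (f @` K).
  apply: continuous_compact => //; exact: continuous_subspaceT.
move=> /compact_bounded[M [Mr MP]]; exists (`|M| + 1); first by rewrite addr_ge0.
move=> x Kx; apply: (MP (`|M| + 1)); last by exists x.
by rewrite (le_lt_trans (ler_norm M))// ltrDl.
Qed.

Lemma measurable_open_box (a b : 'I_n -> R) : measurable (open_box a b).
Proof.
rewrite (_ : open_box _ _ = \bigcap_(i in [set: 'I_n]) ((fun v : 'rV[R]_n => v ord0 i) @^-1` `]a i, b i[)).
  apply: fin_bigcap_measurable => // i _; rewrite -[X in measurable X]setTI.
  exact: measurable_rV_coord.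
apply/seteqP; split => [x xk i _/=|x xk i].
  by rewrite in_itv/=; exact: xk.
by have := xk i I; rewrite /= in_itv/=.
Qed.

Definition boxes : set (set 'rV[R]_n) := [set B | exists a b, B = open_box a b].

Lemma boxes_setI : setI_closed boxes.
Proof.
move=> _ _ [a [b ->]] [a' [b' ->]].
exists (fun i => Num.max (a i) (a' i)), (fun i => Num.min (b i) (b' i)).
apply/seteqP; split => x.
  move=> [h h'] i; have /andP[? ?] := h i; have /andP[? ?] := h' i.
  by rewrite gt_max lt_min; apply/andP; split; apply/andP; split.
move=> h; split => i; have := h i; rewrite gt_max lt_min => /andP[/andP[? ?] /andP[? ?]];
  by apply/andP.
Qed.

(** The half-space x_i > p is the union over k of the boxes with side (p, k) in direction i and (-k,
    k) in the others. Together with [boxes_setI], this makes the boxes a generating pi-system. *)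
Lemma measurable_rV_boxes : @measurable _ 'rV[R]_n `<=` <<s boxes >>.
Proof.
apply: smallest_sub; first exact: smallest_sigma_algebra.
have mc i : measurable_fun [set: g_sigma_algebraType boxes] (fun x : g_sigma_algebraType boxes => (x : 'rV[R]_n) ord0 i).
  apply: (measurability _ (RGenOInfty.measurableE R)) => _ [_ [p ->] <-].
  rewrite setTI (_ : _ @^-1` _ = \bigcup_k open_box (fun j => if j == i then p else - k%:R) (fun=> k%:R)).
    apply: bigcupT_measurable => k; apply: sub_sigma_algebra.
    by exists (fun j => if j == i then p else - k%:R), (fun=> k%:R).
  apply/seteqP; split => x /=; rewrite in_itv/= andbT.
    move=> px; exists (Num.truncn (\sum_i `|x ord0 i|)).+1 => // j.
    have h : `|x ord0 j| < (Num.truncn (\sum_i `|x ord0 i|)).+1%:R.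
      by apply: le_lt_trans (truncnS_gt _); rewrite (bigD1 j)//= lerDl sumr_ge0.
    move: h; rewrite ltr_norml => /andP[h1 h2]; rewrite h2 andbT.
    by case: eqVneq => [->|].
  by move=> [k _ /(_ i)]; rewrite eqxx => /andP[].
rewrite -bigcup_seq; apply: bigcup_sub => i _ _ [Y mY <-].
exact: (mc i measurableT Y mY).
Qed.

End compact_rV.

Section zero_pairing.
Variables (R : realType) (n : nat) (U : set 'rV[R]_n).
Local Notation mu := (@lebesgue_rV R n).
Hypothesis mU : measurable U.

Lemma Rintegral_limit0 (f : 'rV[R]_n -> R) (c_ : nat -> 'rV[R]_n -> R) (c : 'rV[R]_n -> R) :
  mu.-integrable U (EFin \o f) -> (forall k, measurable_fun U (c_ k)) ->
  (forall k x, U x -> `|c_ k x| <= 1) -> (forall x, U x -> c_ k x @[k --> \oo] --> c x) ->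
  (forall k, \int[mu]_(x in U) (f x * c_ k x) = 0) ->
  \int[mu]_(x in U) (f x * c x) = 0.
Proof.
move=> fi mc c1 cc h0.
have mf : measurable_fun U f by apply/measurable_EFinP; case/integrableP : fi.
have mcl : measurable_fun U c by exact: measurable_fun_cvg mc cc.
have H1 : {ae mu, forall x, U x -> (fun k => (f x * c_ k x)%:E) @ \oo --> (f x * c x)%:E}.
  apply: aeW => x Ux; apply/cvg_EFin; first by near=> k.
  exact: cvgMl_tmp (cc x Ux).
have H2 : {ae mu, forall x, forall k, U x -> (`|(f x * c_ k x)%:E| <= `|(f x)%:E|)%E}.
  apply: aeW => x k Ux; rewrite !abse_EFin lee_fin normrM ler_piMr//; exact: c1.
have [_ _ h] := @dominated_convergence _ _ _ mu U mU (fun k x => (f x * c_ k x)%:E)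
   (fun x => (f x * c x)%:E) (fun x => `|(f x)%:E|%E)
   (fun k => (measurable_EFinP _ _).2 (measurable_funM mf (mc k)))
   ((measurable_EFinP _ _).2 (measurable_funM mf mcl)) H1 (integrable_abse fi) H2.
have : (fun k => (\int[mu]_(x in U) (f x * c_ k x)%:E)%E) @ \oo --> 0%E.
  suff -> : (fun k => (\int[mu]_(x in U) (f x * c_ k x)%:E)%E) = cst 0%E by exact: cvg_cst.
  apply/funext => k; rewrite -[RHS]/(0%:E) -(h0 k) /Rintegral fineK//.
  apply: integrable_fin_num => //; apply: le_integrable fi => //.
    by apply/measurable_EFinP; exact: measurable_funM.
  by move=> x Ux /=; rewrite lee_fin normrM ler_piMr//; exact: c1.
by move=> /(cvg_unique _ h); rewrite /Rintegral => ->.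
Unshelve. all: by end_near. Qed.

(** Dynkin's pi-lambda argument: the measurable sets on which [f] integrates to 0 form a
    lambda-system. Since [f] vanishes outside one box, any box may be cut down to a part of it, so
    testing boxes with sides inside that one puts all boxes, and the whole space, into the
    system. *)
Lemma ae_eq0_boxes (f : 'rV[R]_n -> R) (a b : 'I_n -> R) :
  mu.-integrable U (EFin \o f) ->
  (forall x, ~ open_box a b x -> f x = 0) ->
  (forall a' b', (forall i, a i <= a' i) -> (forall i, b' i <= b i) ->
     \int[mu]_(x in U) (f x * \1_(open_box a' b') x) = 0) ->
  f = cst 0 %[ae mu in U].
Proof.
move=> fi fout h0.
have mf : measurable_fun U f by apply/measurable_EFinP; case/integrableP : fi.
have i1 S : measurable S -> mu.-integrable U (EFin \o (fun x => f x * \1_S x)).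
  move=> mS; apply: le_integrable fi => //.
    by apply/measurable_EFinP; apply: measurable_funM => //; exact: measurable_indic.
  by move=> x Ux /=; rewrite lee_fin normrM ler_piMr// ger0_norm// indicE lern1 leq_b1.
pose H : set (set 'rV[R]_n) := [set S | measurable S /\ \int[mu]_(x in U) (f x * \1_S x) = 0].
have HT : \int[mu]_(x in U) (f x * \1_(open_box a b) x) = 0 by exact: h0.
have fE x : f x * \1_(open_box a b) x = f x.
  rewrite indicE; have [xB|xB] := boolP (x \in open_box a b); first by rewrite mulr1.
  by rewrite mulr0 fout//; move/negP: xB; rewrite inE.
have Hall S : measurable S -> \int[mu]_(x in U) (f x * \1_S x) = 0.
  move=> mS; suff: H S by case.
  have lH : lambda_system setT H.
    split => //.
    + split => //; rewrite -[RHS]HT; apply: eq_Rintegral => x _.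
      by rewrite fE indicE in_setT mulr1.
    + move=> X Y YX [mX X0] [mY Y0]; split; first exact: measurableD.
      rewrite -(subr0 0) -{1}X0 -{1}Y0 -RintegralB//; [|exact: i1|exact: i1].
      apply: eq_Rintegral => x _; rewrite -mulrBr; congr (_ * _).
      rewrite !indicE in_setD; case: (boolP (x \in Y)) => [/set_mem/YX/mem_set ->|_].
        by rewrite subrr.
      by rewrite andbT subr0.
    + move=> F ndF HF; split; first by apply: bigcupT_measurable => k; case: (HF k).
      apply: (@Rintegral_limit0 f (fun k => \1_(F k))) => //.
      * by move=> k; apply: measurable_indic; case: (HF k).
      * by move=> k x _; rewrite ger0_norm// indicE lern1 leq_b1.
      * move=> x _; apply: cvg_near_cst.
        have [[j _ Fj]|nF] := pselect ((\bigcup_k F k) x).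
          near=> k; rewrite !indicE; rewrite !mem_set//; first by exists j.
          have jk : (j <= k)%N by near: k; exact: nbhs_infty_ge.
          by move/subsetPset : (ndF _ _ jk); apply.
        near=> k; rewrite !indicE !memNset// => Fk; apply: nF; exists k => //.
      * by move=> k; case: (HF k).
  have bH : @boxes R n `<=` H.
    move=> _ [a' [b' ->]]; split; first exact: measurable_open_box.
    have := h0 (fun i => Num.max (a i) (a' i)) (fun i => Num.min (b i) (b' i)).
    move=> <-; [|by move=> i; rewrite le_max lexx|by move=> i; rewrite ge_min lexx].
    apply: eq_Rintegral => x _.
    rewrite -{1}fE -mulrA; congr (_ * _).
    rewrite !indicE -natrM mulnb -in_setI; congr (_%:R); congr (nat_of_bool (_ \in _)).
    apply/seteqP; split => y.
      move=> [h h'] i; have /andP[? ?] := h i; have /andP[? ?] := h' i.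
      by rewrite gt_max lt_min; apply/andP; split; apply/andP; split.
    move=> h; split => i; have := h i; rewrite gt_max lt_min => /andP[/andP[? ?] /andP[? ?]];
      by apply/andP.
  apply: (lambda_system_subset (@boxes_setI R n) lH bH) => //.
  exact: measurable_rV_boxes.
have := @integral_ae_eq _ _ _ mu U mU (cst 0%E) (EFin \o f) fi (measurable_cst _).
move=> H1; have {}H1 : ae_eq mu U (EFin \o f) (cst 0%E).
  apply: H1 => E EU mE; rewrite integral0.
  have iE : mu.-integrable E (EFin \o f) by exact: integrableS fi.
  rewrite -[RHS]/(0%:E) -(Hall E mE) /Rintegral fineK; last first.
    by apply: integrable_fin_num => //; exact: i1.
  rewrite -[in LHS](setIidr EU) integral_mkcondr; apply: eq_integral => x _.
  by rewrite patchE/= indicE; case: ifP; rewrite ?mulr1 ?mulr0.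
by apply: filterS H1 => x /= h /h [].
Unshelve. all: by end_near. Qed.

End zero_pairing.

Section weak_derivatives.
Variables (R : realType) (n : nat) (U : set 'rV[R]_n) (omega : 'rV[R]_n -> R).
Local Notation mu := (@lebesgue_rV R n).
Local Notation ip := (ip U omega).
Local Notation L2 := (L2 omega U).
Hypotheses (oU : open U) (mom : measurable_fun U omega).
Hypothesis om0 : forall x, U x -> 0 < omega x.
Hypothesis om_loc : forall K, compact K -> K `<=` U ->
  exists2 c, 0 < c & forall x, K x -> c <= omega x.

Let mU : measurable U := open_rV_measurable oU.
Let sipL2 := L2_semi_ip mU mom om0.

(** The pairings that define weak derivatives carry no weight. Dividing the test function by [omega]
    turns them into weighted inner products ([Rintegral_mul_ip]), and the lower bound of the weight
    on the support keeps the quotient square integrable. *)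
Lemma L2_div_weight (f : 'rV[R]_n -> R) (K : set 'rV[R]_n) (B : R) :
  measurable_fun U f -> compact K -> K `<=` U ->
  (forall x, K x -> `|f x| <= B) -> (forall x, ~ K x -> f x = 0) ->
  L2 (fun x => f x / omega x).
Proof.
move=> mf cK KU fB f0.
have [c c0 cP] := om_loc cK KU.
have mK := compact_rV_measurable cK.
have mfw : measurable_fun U (fun x => f x / omega x).
  apply: measurable_funM => //.
  apply: (eq_measurable_fun (fun x => omega x `^ (- 1))).
    by move=> x; rewrite inE => /om0/ltW o0; rewrite powR_inv1.
  exact: (measurableT_comp (measurable_powR (- 1)) mom).
apply: (L2_bound mU mom om0 (g := fun x => (B ^+ 2 / c) * \1_K x)) => //.
  apply: (@integrableZl _ _ _ _ _ mU (B ^+ 2 / c) (fun x => (\1_K x)%:E)).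
  apply/integrableP; split; first by apply/measurable_EFinP; exact: measurable_indic.
  under eq_integral do rewrite gee0_abs ?lee_fin//.
  rewrite integral_indic//; apply: le_lt_trans (compact_rV_measure cK).
  by apply: le_measure; rewrite ?inE//; exact: measurableI.
move=> x Ux; have o0 := om0 Ux; rewrite indicE.
have [xK|xK] := boolP (x \in K); last first.
  by rewrite f0 ?mul0r ?expr0n ?mulr0//; move/negP: xK; rewrite inE.
have Kx := set_mem xK; rewrite mulr1.
have -> : omega x * (f x / omega x) ^+ 2 = f x ^+ 2 / omega x by field; exact: lt0r_neq0.
have fb : f x ^+ 2 <= B ^+ 2.
  have := fB _ Kx; rewrite -(real_normK (num_real (f x))) => h.
  by rewrite ler_pXn2r ?nnegrE// (le_trans _ h).
apply: ler_pM => //; rewrite ?sqr_ge0 ?invr_ge0 ?(ltW o0)//.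
by rewrite lef_pV2 ?posrE//; exact: cP.
Qed.

Lemma Rintegral_mul_ip (w f : 'rV[R]_n -> R) :
  \int[mu]_(x in U) (w x * f x) = ip w (fun x => f x / omega x).
Proof.
apply: eq_Rintegral => x; rewrite inE => /om0 o0.
by field; exact: lt0r_neq0.
Qed.

Lemma test_div_weight eta : test_function U eta -> L2 (fun x => eta x / omega x).
Proof.
move=> [se [K [cK KU e0]]].
have [B _ BP] := continuous_compact_bounded (smooth_continuous se) cK.
apply: (L2_div_weight (K := K) (B := B)) => //.
apply: measurable_funS (continuous_rV_measurable (smooth_continuous se)) => //.
Qed.

(** On a box whose closure lies in [U], bumps approximate the indicators of all smaller boxes, so
    [ae_eq0_boxes] applies to [g] cut off to the box; countably many rational boxes cover [U]. *)
Lemma L2_test_eq0 g : L2 g ->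
  (forall eta, test_function U eta -> \int[mu]_(x in U) (g x * eta x) = 0) ->
  g = cst 0 %[ae mu in U].
Proof.
move=> Lg g0.
have boxP (a b : 'I_n -> R) : closed_box a b `<=` U ->
    {ae mu, forall x, open_box a b x -> g x = 0}.
  move=> abU; pose f x := g x * \1_(open_box a b) x.
  have Lind a' b' : closed_box a' b' `<=` U -> L2 (fun x => \1_(open_box a' b') x / omega x).
    move=> abU'; apply: (L2_div_weight (K := closed_box a' b') (B := 1)) => //.
    - by apply: measurable_indic; exact: measurable_open_box.
    - exact: compact_closed_box.
    - by move=> x _; rewrite ger0_norm// indicE lern1 leq_b1.
    - move=> x nx; rewrite indicE memNset// => ox; apply: nx => i.
      by have /andP[/ltW -> /ltW ->] := ox i.
  have Lab := Lind _ _ abU.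
  have fi : mu.-integrable U (EFin \o f).
    apply: eq_integrable (L2_ip_integrable mU mom om0 Lg Lab) => // x; rewrite inE => /om0 o0 /=.
    by congr EFin; rewrite /f; field; exact: lt0r_neq0.
  have fae : f = cst 0 %[ae mu in U].
    apply: (@ae_eq0_boxes R n U mU f a b) => //.
      by move=> x nx; rewrite /f indicE memNset ?mulr0.
    move=> a' b' aa' bb'.
    have sub : closed_box a' b' `<=` closed_box a b.
      move=> x hx i; have /andP[h1 h2] := hx i.
      by rewrite (le_trans (aa' i) h1) (le_trans h2 (bb' i)).
    have mc k : measurable_fun U (box_bump a' b' k).
      apply: measurable_funS (continuous_rV_measurable (smooth_continuous (smooth_box_bump a' b' k))) => //.
    apply: (@Rintegral_limit0 R n U mU f (box_bump a' b')) => //.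
    - by move=> k x _; have /andP[h0 h1] := box_bump_bound a' b' k x; rewrite ger0_norm.
    - by move=> x _; exact: box_bump_cvg.
    - move=> k; rewrite -[RHS](g0 (box_bump a' b' k)); last first.
        by apply: test_function_box_bump => x /sub; exact: abU.
      apply: eq_Rintegral => x _; rewrite /f indicE.
      have [_|xB] := boolP (x \in _); first by rewrite mulr1.
      rewrite mulr0 mul0r box_bump_out ?mulr0// => ox; move/negP: xB; apply.
      rewrite inE => i; have /andP[h1 h2] := ox i.
      by rewrite (le_lt_trans (aa' i) h1) (lt_le_trans h2 (bb' i)).
  apply: filterS fae => x /= h ox.
  have Ux : U x by apply: abU => i; have /andP[/ltW -> /ltW ->] := ox i.
  by have := h Ux; rewrite /f indicE mem_set// mulr1.
pose bx (p : 'rV[rat]_n * 'rV[rat]_n) : set 'rV[R]_n :=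
  open_box (fun i => ratr (p.1 ord0 i)) (fun i => ratr (p.2 ord0 i)).
pose cbx (p : 'rV[rat]_n * 'rV[rat]_n) : set 'rV[R]_n :=
  closed_box (fun i => ratr (p.1 ord0 i)) (fun i => ratr (p.2 ord0 i)).
(* The exceptional sets of the rational boxes with closure in [U], enumerated through [unpickle];
   their union is null. *)
pose F k : set 'rV[R]_n := if unpickle k is Some p then
  (if `[< cbx p `<=` U >] then ~` [set x | bx p x -> g x = 0] else set0) else set0.
have nF : mu.-negligible (\bigcup_k F k).
  apply: negligible_bigcup => k; rewrite /F; case: unpickle => [p|]; last exact: negligible_set0.
  by case: ifPn => [/asboolP/boxP //|_]; exact: negligible_set0.
apply: negligibleS nF => x /= /not_implyP[Ux gx].
have /nbhs_ballP[e /= e0 eU] := open_nbhs_nbhs (conj oU Ux).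
have hq i : exists p : rat * rat, x ord0 i - e < ratr p.1 < x ord0 i /\ x ord0 i < ratr p.2 < x ord0 i + e.
  have : x ord0 i - e < x ord0 i by rewrite ltrBlDr ltrDl.
  move=> /rat_in_itvoo[q1]; rewrite in_itv/= => q1P.
  have : x ord0 i < x ord0 i + e by rewrite ltrDl.
  by move=> /rat_in_itvoo[q2]; rewrite in_itv/= => q2P; exists (q1, q2).
pose p : 'rV[rat]_n * 'rV[rat]_n :=
  (\row_i (projT1 (cid (hq i))).1, \row_i (projT1 (cid (hq i))).2).
have pP i : x ord0 i - e < ratr (p.1 ord0 i) < x ord0 i /\ x ord0 i < ratr (p.2 ord0 i) < x ord0 i + e.
  by rewrite !mxE; case: cid.
exists (pickle p) => //; rewrite /F pickleK ifT.
  move=> /= h; apply: gx; apply: h => i.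
  by have [/andP[_ ->] /andP[-> _]] := pP i.
apply/asboolP => y yp; apply: eU; split => // i j; rewrite !ord1.
have [/andP[h1 _] /andP[_ h2]] := pP j; have /andP[h3 h4] := yp j.
by rewrite /ball/= ltr_distlC; apply/andP; split; [exact: lt_le_trans h1 h3|exact: le_lt_trans h4 h2].
Qed.

End weak_derivatives.

(** * Weighted Sobolev spaces *)

Section weighted_H1.
Variables (R : realType) (n : nat) (U : set 'rV[R]_n) (omega : 'rV[R]_n -> R).
Local Notation mu := (@lebesgue_rV R n).
Local Notation ip := (ip U omega).
Local Notation L2 := (L2 omega U).
Local Notation H1 := (H1 omega U).
Hypotheses (oU : open U) (mom : measurable_fun U omega).
Hypothesis om0 : forall x, U x -> 0 < omega x.
Hypothesis om_loc : forall K, compact K -> K `<=` U ->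
  exists2 c, 0 < c & forall x, K x -> c <= omega x.

Let mU : measurable U := open_rV_measurable oU.
Let sipL2 := L2_semi_ip mU mom om0.
Let tdw := test_div_weight oU mom om0 om_loc.
Let RE := @Rintegral_mul_ip R n U omega om0.

Definition pd (i : 'I_n) (w : 'rV[R]_n -> R) : 'rV[R]_n -> R :=
  xget (cst 0) [set g | L2 g /\ weak_partial U i w g].

Lemma gradE w x i : grad omega U w x ord0 i = pd i w x.
Proof. by rewrite /grad mxE. Qed.

Lemma pdP i w : H1 w -> L2 (pd i w) /\ weak_partial U i w (pd i w).
Proof. by move=> [_ /(_ i)[g Lg wg]]; exact: (@xgetPex _ (cst 0) [set g | L2 g /\ weak_partial U i w g] (ex_intro _ g (conj Lg wg))). Qed.

Lemma L2_pd i w : H1 w -> L2 (pd i w).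
Proof. by move=> /(pdP i)[]. Qed.

Lemma weak_partial_uniq i w g1 g2 : L2 g1 -> L2 g2 -> weak_partial U i w g1 ->
  weak_partial U i w g2 -> g1 = g2 %[ae mu in U].
Proof.
move=> L1 L2g w1 w2.
have L12 : L2 (g1 \- g2) by exact: (sipB sipL2).
have := @L2_test_eq0 R n U omega oU mom om0 om_loc _ L12.
move=> h; have : g1 \- g2 = cst 0 %[ae mu in U].
  apply: h => eta te; rewrite RE (sip_linearB sipL2)//; last exact: tdw.
  by rewrite -!RE; apply/eqP; rewrite subr_eq0 -eqr_opp -w1// -w2.
by apply: filterS => x /= {}h /h /eqP; rewrite subr_eq0 => /eqP.
Qed.

Lemma weak_partial_lin i a u v gu gv : L2 u -> L2 v -> L2 gu -> L2 gv ->
  weak_partial U i u gu -> weak_partial U i v gv ->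
  weak_partial U i (fun x => a * u x + v x) (fun x => a * gu x + gv x).
Proof.
move=> Lu Lv Lgu Lgv wu wv eta te.
have Lp := tdw (test_function_partial i te); have Le := tdw te.
have := wu _ te; have := wv _ te.
rewrite !RE !(sip_linear sipL2)// => -> ->; ring.
Qed.

Lemma H1_lin a u v : H1 u -> H1 v -> H1 (fun x => a * u x + v x).
Proof.
move=> Hu Hv; split; first by apply: (L2_lin mU mom om0); [case: Hu|case: Hv].
move=> i; have [Lu wu] := pdP i Hu; have [Lv wv] := pdP i Hv.
exists (fun x => a * pd i u x + pd i v x); first exact: (L2_lin mU mom om0).
by apply: weak_partial_lin => //; [case: Hu|case: Hv].
Qed.

Lemma pd_lin i a u v : H1 u -> H1 v ->
  pd i (fun x => a * u x + v x) = (fun x => a * pd i u x + pd i v x) %[ae mu in U].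
Proof.
move=> Hu Hv; have [Lu wu] := pdP i Hu; have [Lv wv] := pdP i Hv.
have [Luv wuv] := pdP i (H1_lin a Hu Hv).
apply: weak_partial_uniq wuv _ => //; first exact: (L2_lin mU mom om0).
by apply: weak_partial_lin => //; [case: Hu|case: Hv].
Qed.

Lemma H1_0 : H1 (fun=> 0).
Proof.
split; first exact: L2_0.
move=> i; exists (fun=> 0); first exact: L2_0.
move=> eta te; rewrite !RE (sip_zero sipL2 (tdw te)) oppr0.
exact: (sip_zero sipL2 (tdw (test_function_partial i te))).
Qed.

Definition gip u v : R := \sum_i ip (pd i u) (pd i v).

Lemma H1_gip : semi_ip H1 gip.
Proof.
split.
- exact: H1_0.
- exact: H1_lin.
- move=> a u v w Hu Hv Hw; rewrite /gip mulr_sumr -big_split/=; apply: eq_bigr => i _.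
  have Lu := L2_pd i Hu; have Lv := L2_pd i Hv; have Lw := L2_pd i Hw.
  rewrite -(sip_linear sipL2)//.
  exact: (ip_ae mU mom (L2_pd i (H1_lin a Hu Hv)) (L2_lin mU mom om0 a Lu Lv) Lw (pd_lin i a Hu Hv)).
- by move=> u v Hu Hv; apply: eq_bigr => i _; apply: (sip_sym sipL2); exact: L2_pd.
- by move=> u Hu; apply: sumr_ge0 => i _; apply: (sip_ge0 sipL2); exact: L2_pd.
Qed.

Lemma dot_sum (a b : 'rV[R]_n) : dot a b = \sum_i a ord0 i * b ord0 i.
Proof. by rewrite /dot mxE; apply: eq_bigr => i _; rewrite mxE. Qed.

Lemma Rintegral_sum (I : Type) (s : seq I) (f : I -> 'rV[R]_n -> R) :
  (forall i, mu.-integrable U (EFin \o f i)) ->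
  mu.-integrable U (EFin \o (fun x => \sum_(i <- s) f i x)) /\
  \int[mu]_(x in U) (\sum_(i <- s) f i x) = \sum_(i <- s) \int[mu]_(x in U) f i x.
Proof.
move=> fi; elim: s => [|i s [IH1 IH2]].
  rewrite big_nil; under eq_Rintegral do rewrite big_nil.
  split; last by rewrite /Rintegral integral0.
  by apply: eq_integrable (integrable0 _ U) => // x _; rewrite /= big_nil.
split.
  apply: eq_integrable (integrableD mU (fi i) IH1) => // x _.
  by rewrite /= big_cons.
rewrite big_cons -IH2 -RintegralD//.
by apply: eq_Rintegral => x _; rewrite big_cons.
Qed.

Lemma grad_normE w : H1 w -> grad_norm omega U w = snorm gip w.
Proof.
move=> Hw; congr Num.sqrt.
have := (Rintegral_sum (index_enum _) (fun i => L2_ip_integrable mU mom om0 (L2_pd i Hw) (L2_pd i Hw))).2.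
rewrite /gip => <-; apply: eq_Rintegral => x _; rewrite dot_sum mulr_sumr.
by apply: eq_bigr => i _; rewrite !gradE.
Qed.

Lemma pd_snorm_le i w : H1 w -> snorm ip (pd i w) <= snorm gip w.
Proof.
move=> Hw; apply: ler_wsqrtr; rewrite /gip (bigD1 i)//= lerDl.
by apply: sumr_ge0 => j _; apply: (sip_ge0 sipL2); exact: L2_pd.
Qed.

Lemma pdB_ae i u v : H1 u -> H1 v -> pd i (u \- v) = pd i u \- pd i v %[ae mu in U].
Proof.
move=> Hu Hv; have := pd_lin i (- 1) Hv Hu.
rewrite (_ : (fun _ => _) = u \- v); last by apply/funext => x /=; ring.
by apply: filterS => x /= h Ux; rewrite h//; ring.
Qed.

Lemma snorm_ae u v : L2 u -> L2 v -> u = v %[ae mu in U] -> snorm ip u = snorm ip v.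
Proof.
move=> Lu Lv uv; rewrite /snorm (ip_ae mU mom Lu Lv Lu uv) (sip_sym sipL2)//.
by rewrite (ip_ae mU mom Lu Lv Lv uv).
Qed.

Lemma snorm_gipB u v : H1 u -> H1 v ->
  snorm gip (u \- v) ^+ 2 = \sum_i snorm ip (pd i u \- pd i v) ^+ 2.
Proof.
move=> Hu Hv; have Huv := sipB H1_gip Hu Hv.
rewrite (snorm_sqr H1_gip)//; apply: eq_bigr => i _.
have Lp : L2 (pd i u \- pd i v) by apply: (sipB sipL2); exact: L2_pd.
rewrite -(snorm_sqr sipL2); last exact: L2_pd.
by rewrite (snorm_ae (L2_pd i Huv) Lp)//; exact: pdB_ae.
Qed.

Lemma sum_sqr_le (I : Type) (s : seq I) (a : I -> R) : (forall i, 0 <= a i) ->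
  \sum_(i <- s) a i ^+ 2 <= (\sum_(i <- s) a i) ^+ 2.
Proof.
move=> a0; elim: s => [|i s IH]; first by rewrite !big_nil expr0n.
have s0 : 0 <= \sum_(j <- s) a j by exact: sumr_ge0.
rewrite !big_cons; have := mulr_ge0 (a0 i) s0.
by move: IH; set x := \sum_(_ <- _) _ ^+ 2; set y := \sum_(_ <- _) _; move=> IH h; nra.
Qed.

Lemma snorm_gipB_le u v : H1 u -> H1 v ->
  snorm gip (u \- v) <= \sum_i snorm ip (pd i u \- pd i v).
Proof.
move=> Hu Hv; pose a i := snorm ip (pd i u \- pd i v).
have a0 i : 0 <= a i by exact: snorm_ge0.
have h := sum_sqr_le (index_enum _) a0.
rewrite -(snorm_gipB Hu Hv) in h.
have s0 : 0 <= \sum_i a i by exact: sumr_ge0.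
have g0 : 0 <= snorm gip (u \- v) by exact: snorm_ge0.
by rewrite -ler_sqr ?nnegrE.
Qed.

(** Both sides of the defining identity are inner products against a fixed square integrable
    function, hence continuous in norm: weak differentiation is a closed operator. *)
Lemma weak_partial_closed i (w_ : nat -> 'rV[R]_n -> R) w g :
  (forall k, H1 (w_ k)) -> L2 w -> L2 g ->
  (forall e, 0 < e -> exists N, forall k, (N <= k)%N -> snorm ip (w_ k \- w) <= e) ->
  (forall e, 0 < e -> exists N, forall k, (N <= k)%N -> snorm ip (pd i (w_ k) \- g) <= e) ->
  weak_partial U i w g.
Proof.
move=> Hw Lw Lg cw cg eta te.
have Lp := tdw (test_function_partial i te); have Le := tdw te.
rewrite !RE; set pe := (fun x => partial i eta x / omega x) in Lp *; set ee := (fun x => eta x / omega x) in Le *.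
apply/eqP; rewrite -subr_eq0 -normr_le0; apply/ler_addgt0Pl => e e0; rewrite addr0.
pose d := e / (snorm ip pe + snorm ip ee + 1).
have s0 : 0 < snorm ip pe + snorm ip ee + 1 by rewrite ltr_wpDl ?addr_ge0 ?snorm_ge0.
have d0 : 0 < d by rewrite divr_gt0.
have [N1 N1P] := cw d d0; have [N2 N2P] := cg d d0.
pose k := maxn N1 N2; have h1 := N1P k (leq_maxl _ _); have h2 := N2P k (leq_maxr _ _).
have Lwk : L2 (w_ k) by case: (Hw k).
have [Lpk wpk] := pdP i (Hw k).
have := wpk _ te; rewrite !RE -/pe -/ee => wE.
have -> : ip w pe - - ip g ee = - (ip (w_ k \- w) pe + ip (pd i (w_ k) \- g) ee).
  by rewrite !(sip_linearB sipL2)// wE; ring.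
rewrite normrN; apply: (le_trans (ler_normD _ _)).
apply: (@le_trans _ _ (d * snorm ip pe + d * snorm ip ee)).
  apply: lerD.
    apply: (le_trans (snorm_CS sipL2 (sipB sipL2 Lwk Lw) Lp)).
    by rewrite ler_wpM2r ?snorm_ge0.
  apply: (le_trans (snorm_CS sipL2 (sipB sipL2 Lpk Lg) Le)).
  by rewrite ler_wpM2r ?snorm_ge0.
rewrite -mulrDr -[leRHS](divfK (lt0r_neq0 s0)) -/d ler_wpM2l ?(ltW d0)// lerDl //.
Qed.

End weighted_H1.

(** * Closures of test functions: Poincare inequality by density, and completeness *)

Section H1_vanishing_theory.
Variables (R : realType) (n : nat) (U V : set 'rV[R]_n) (omega : 'rV[R]_n -> R).
Local Notation mu := (@lebesgue_rV R n).
Local Notation ip := (ip U omega).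
Local Notation gip := (gip U omega).
Local Notation L2 := (L2 omega U).
Local Notation H1 := (H1 omega U).
Local Notation H1V := (H1_vanishing omega U V).
Hypotheses (oU : open U) (mom : measurable_fun U omega).
Hypothesis om0 : forall x, U x -> 0 < omega x.
Hypothesis om_loc : forall K, compact K -> K `<=` U ->
  exists2 c, 0 < c & forall x, K x -> c <= omega x.
Hypothesis testH1 : forall eta, test_function V eta -> H1 eta.
Variable P : R.
Hypothesis P0 : 0 <= P.
Hypothesis poincare_test : forall eta, test_function V eta -> snorm ip eta <= P * snorm gip eta.

Let mU : measurable U := open_rV_measurable oU.
Let sipL2 := L2_semi_ip mU mom om0.
Let sipH1 := H1_gip oU mom om0 om_loc.

Lemma H1V_H1 w : H1V w -> H1 w. Proof. by case. Qed.
Lemma H1V_L2 w : H1V w -> L2 w. Proof. by case=> -[]. Qed.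

Lemma H1V_approx w e : H1V w -> 0 < e -> exists2 eta, test_function V eta &
  snorm ip (w \- eta) + snorm gip (w \- eta) < e.
Proof.
move=> [Hw h] /h[eta te]; rewrite L2_normE grad_normE//; first by exists eta.
by apply: (sipB sipH1) => //; exact: testH1.
Qed.

Lemma H1V_intro w : H1 w -> (forall e, 0 < e -> exists2 eta, test_function V eta &
  snorm ip (w \- eta) + snorm gip (w \- eta) < e) -> H1V w.
Proof.
move=> Hw h; split => // e /h[eta te he]; exists eta => //.
rewrite L2_normE grad_normE//; by apply: (sipB sipH1) => //; exact: testH1.
Qed.

Lemma H1V_lin a u v : H1V u -> H1V v -> H1V (fun x => a * u x + v x).
Proof.
move=> Vu Vv; have Hu := H1V_H1 Vu; have Hv := H1V_H1 Vv.
apply: H1V_intro; first exact: (sip_lin sipH1).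
move=> e e0; pose d := e / (`|a| + 1).
have a1 : 0 < `|a| + 1 by rewrite ltr_wpDl.
have d0 : 0 < d by rewrite divr_gt0.
have [eta te he] := H1V_approx Vu d0; have [zeta tz hz] := H1V_approx Vv d0.
exists (fun x => a * eta x + zeta x); first exact: test_function_lin.
have Hue := sipB sipH1 Hu (testH1 te); have Hvz := sipB sipH1 Hv (testH1 tz).
have Lue : L2 (u \- eta) by case: Hue. have Lvz : L2 (v \- zeta) by case: Hvz.
have -> : (fun x => a * u x + v x) \- (fun x => a * eta x + zeta x) =
    (fun x => a * (u \- eta) x + (v \- zeta) x).
  by apply/funext => x /=; ring.
have := snormD sipL2 (sipZ sipL2 a Lue) Lvz; have := snormD sipH1 (sipZ sipH1 a Hue) Hvz.
rewrite (snormZ sipL2)// (snormZ sipH1)//.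
set A := snorm ip _ in he *; set B := snorm gip _ in he *.
set A' := snorm ip (v \- zeta) in hz *; set B' := snorm gip (v \- zeta) in hz *.
move: (snorm ip _) (snorm gip _) => C D h1 h2; apply: (le_lt_trans (lerD h2 h1)).
move: A B A' B' he hz {h1 h2} => A B A' B' he hz.
have -> : e = `|a| * d + d by rewrite /d; field; exact: lt0r_neq0.
have := ler_wpM2l (normr_ge0 a) (ltW he); lra.
Qed.

Lemma H1V_0 : H1V (fun=> 0).
Proof.
apply: H1V_intro; first exact: (sip0 sipH1).
move=> e e0; exists (fun=> 0); first exact: test_function0.
rewrite (_ : (fun=> 0) \- (fun=> 0) = fun=> 0); last by apply/funext => x; rewrite /= subr0.
by rewrite /snorm (sip_zero sipL2 (sip0 sipL2)) (sip_zero sipH1 (sip0 sipH1)) sqrtr0 addr0.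
Qed.

Lemma sub_semi_ip (W : set ('rV[R]_n -> R)) b : semi_ip W b -> (forall w, H1V w -> W w) -> semi_ip H1V b.
Proof.
move=> Wb VW; split.
- exact: H1V_0.
- exact: H1V_lin.
- by move=> a u v w /VW ? /VW ? /VW ?; exact: (sip_linear Wb).
- by move=> u v /VW ? /VW ?; exact: (sip_sym Wb).
- by move=> u /VW ?; exact: (sip_ge0 Wb).
Qed.

Lemma H1V_gip : semi_ip H1V gip.
Proof. by apply: sub_semi_ip sipH1 _; exact: H1V_H1. Qed.

Lemma poincare w : H1V w -> snorm ip w <= P * snorm gip w.
Proof.
move=> Vw; have Hw := H1V_H1 Vw; have Lw := H1V_L2 Vw.
(* The approximation error enters once through the L^2 norm and [P] times through the gradient
   norm. *)
apply/ler_addgt0Pl => e e0; pose d := e / (P + 1).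
have p1 : 0 < P + 1 by rewrite ltr_wpDl.
have d0 : 0 < d by rewrite divr_gt0.
have [eta te he] := H1V_approx Vw d0; have He := testH1 te.
have Le : L2 eta by case: He.
have h1 : snorm ip w <= snorm ip (w \- eta) + snorm ip eta.
  have := snormD sipL2 (sipB sipL2 Lw Le) Le.
  by rewrite (_ : (fun _ => _) = w)//; apply/funext => x /=; rewrite subrK.
have h2 : snorm gip eta <= snorm gip w + snorm gip (w \- eta).
  have := snormB sipH1 Hw (sipB sipH1 Hw He).
  by rewrite (_ : w \- (w \- eta) = eta)//; apply/funext => x /=; rewrite subKr.
have h3 := poincare_test te; have h4 := ler_wpM2l P0 h2.
have -> : e = (P + 1) * d by rewrite /d; field; exact: lt0r_neq0.
have h5 : 0 <= snorm ip (w \- eta) := snorm_ge0 _ _.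
have h6 : 0 <= snorm gip (w \- eta) := snorm_ge0 _ _.
set A := snorm ip (w \- eta) in he h1 h5 *; set B := snorm gip (w \- eta) in he h2 h4 h6 *.
move: (snorm ip w) (snorm gip w) (snorm ip eta) (snorm gip eta) A B he h1 h2 h3 h4 h5 h6 => a b a' b' A B.
rewrite mulrDr mulrDl mul1r => he h1 h2 h3 h4 h5 h6.
have h7 : P * B <= P * d by apply: ler_wpM2l => //; lra.
lra.
Qed.

Lemma H1V_ae0 w : H1V w -> snorm gip w = 0 -> w = cst 0 %[ae mu in U].
Proof.
move=> Vw w0; apply: (snorm_eq0_ae mU mom om0); first exact: H1V_L2.
by apply/eqP; rewrite eq_le snorm_ge0 andbT; have := poincare Vw; rewrite w0 mulr0.
Qed.

(** By Poincare, a sequence that is Cauchy for the gradient norm is Cauchy in L^2 as well. The L^2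
    limits of the functions and of their partial derivatives fit together by [weak_partial_closed],
    and the limit inherits approximability by test functions from a late term. *)
Lemma H1V_complete : scomplete H1V gip.
Proof.
move=> w Vw cw; have Hw k := H1V_H1 (Vw k); have Lw k := H1V_L2 (Vw k).
have [u Lu uP] : exists2 u, L2 u & forall e, 0 < e -> exists N, forall k, (N <= k)%N -> snorm ip (w k \- u) <= e.
  apply: (L2_complete mU mom om0) => // e e0.
  have d0 : 0 < e / (P + 1) by rewrite divr_gt0// ltr_wpDl.
  have [N NP] := cw _ d0; exists N => j k Nj Nk.
  have := poincare (sipB H1V_gip (Vw j) (Vw k)); move/le_trans; apply.
  apply: le_trans (ler_wpM2l P0 (NP j k Nj Nk)) _.
  rewrite mulrCA ger_pMr// ler_pdivrMr ?mul1r ?lerDl// ltr_wpDl//.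
have /choice[g gP] i : exists g, L2 g /\ forall e, 0 < e -> exists N, forall k, (N <= k)%N -> snorm ip (pd U omega i (w k) \- g) <= e.
  suff cg : forall e, 0 < e -> exists N, forall j k, (N <= j)%N -> (N <= k)%N ->
      snorm ip (pd U omega i (w j) \- pd U omega i (w k)) <= e.
    by have [g Lg gP] := L2_complete mU mom om0 (fun k => L2_pd i (Hw k)) cg; exists g.
  move=> e e0; have [N NP] := cw _ e0; exists N => j k Nj Nk.
  apply: le_trans (NP j k Nj Nk).
  have Hjk := sipB sipH1 (Hw j) (Hw k).
  rewrite -(snorm_ae oU mom om0 (L2_pd i Hjk) _ (pdB_ae oU mom om0 om_loc i (Hw j) (Hw k))).
    exact: pd_snorm_le.
  by apply: (sipB sipL2); exact: L2_pd.
have wpu i : weak_partial U i u (g i).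
  have [Lg hg] := gP i.
  exact: (weak_partial_closed oU mom om0 om_loc Hw Lu Lg uP hg).
have Hu : H1 u by split => // i; exists (g i) => //; case: (gP i).
have pdu i : pd U omega i u = g i %[ae mu in U].
  have [Lp wp] := pdP i Hu.
  by apply: (weak_partial_uniq oU mom om0 om_loc Lp _ wp (wpu i)); case: (gP i).
have gu e : 0 < e -> exists N, forall k, (N <= k)%N -> snorm gip (w k \- u) <= e.
  (* The gradient norm is at most the sum of [n] component norms; the extra 1 keeps the divisor
     positive when n = 0. *)
  move=> e0; pose d := e / (n%:R + 1).
  have n1 : 0 < n%:R + 1 :> R by rewrite ltr_wpDl.
  have d0 : 0 < d by rewrite divr_gt0.
  have /choice[N NP] i : exists N, forall k, (N <= k)%N -> snorm ip (pd U omega i (w k) \- g i) <= d.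
    by have [_] := gP i; apply.
  exists (\sum_i N i)%N => k Nk.
  apply: (le_trans (snorm_gipB_le oU mom om0 om_loc (Hw k) Hu)).
  apply: (@le_trans _ _ (\sum_(i < n) d)).
    apply: ler_sum => i _.
    have Lp := L2_pd i (Hw k); have [Lg _] := gP i.
    rewrite (snorm_ae oU mom om0 (sipB sipL2 Lp (L2_pd i Hu)) (sipB sipL2 Lp Lg)).
      by apply: NP; apply: leq_trans Nk; rewrite (bigD1 i)//= leq_addr.
    by apply: filterS (pdu i) => x /= h Ux; rewrite h.
  rewrite sumr_const card_ord -mulr_natl /d mulrCA ger_pMr// ler_pdivrMr// mul1r lerDl//.
exists u => //; apply: H1V_intro => // e e0.
have e4 : 0 < e / 4 by rewrite divr_gt0.
have [N1 N1P] := uP _ e4; have [N2 N2P] := gu _ e4.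
pose k := maxn N1 N2; have h1 := N1P k (leq_maxl _ _); have h2 := N2P k (leq_maxr _ _).
have [eta te he] := H1V_approx (Vw k) e4; have He := testH1 te; have Le : L2 eta by case: He.
exists eta => //.
have uE : u \- eta = (w k \- eta) \- (w k \- u) by apply/funext => x /=; ring.
have := snormB sipL2 (sipB sipL2 (Lw k) Le) (sipB sipL2 (Lw k) Lu).
have := snormB sipH1 (sipB sipH1 (Hw k) He) (sipB sipH1 (Hw k) Hu).
rewrite -uE => h3 h4; apply: (le_lt_trans (lerD h4 h3)); rewrite addrACA.
apply: (lt_le_trans (ltr_leD he (lerD h1 h2))).
have e3 : e / 4 + (e / 4 + e / 4) = e - e / 4 by field.
by rewrite e3 gerBl ltW.
Qed.

End H1_vanishing_theory.

(** * Integration by parts and the Poincare inequality *)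

Section integral_partial.
Variables (R : realType) (n : nat).
Local Notation mu := (@lebesgue_rV R n).
Local Notation lam := (@lebesgue_measure R).
Local Notation e_ i := (delta_mx ord0 i : 'rV[R]_n).

(** The fundamental theorem of calculus on an interval [-b, b] at whose ends [F] vanishes and
    outside which [f] does. Taking b = |L| + 1 gives a nonempty interval for every sign of [L]. *)
Lemma integral_derive_compact0 (F f : R -> R) (L : R) :
  (forall t : R, is_derive t (1 : R) F (f t)) -> continuous f -> (forall t, L < `|t| -> F t = 0) ->
  lam.-integrable setT (EFin \o f) /\ (\int[lam]_t (f t)%:E = 0)%E.
Proof.
move=> dF cf F0.
pose a := - (`|L| + 1); pose b := `|L| + 1.
have b0 : 0 < b by rewrite ltr_wpDl.
have ab : a < b by rewrite /a -/b gtrN.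
have Lb : L < b by rewrite (le_lt_trans (ler_norm L))// ltrDl.
have f0 t : ~ `[a, b]%classic t -> f t = 0.
  move=> tab; have bt : b < `|t|.
    rewrite ltNge; apply/negP => tb; apply: tab.
    by rewrite /= in_itv/= -ler_norml.
  rewrite -(@derive_val _ _ _ _ _ _ _ (dF t)).
  rewrite (@near_eq_derive _ _ _ F (cst 0)) ?derive_cst//.
  have h : \forall x \near t, b < `|x|.
    have : (fun x : R => `|x|) @ t --> `|t| by apply: cvg_norm; exact: cvg_id.
    by move/cvgr_gt; apply.
  by apply: filterS h => x bx; apply: F0; exact: lt_trans Lb bx.
have FE t : b <= `|t| -> F t = 0 by move=> bt; apply: F0; exact: lt_le_trans Lb bt.
have ftc : (\int[lam]_(x in `[a, b]) (f x)%:E = (F b)%:E - (F a)%:E)%E.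
  apply: continuous_FTC2 => //.
  - exact: continuous_subspaceT.
  - have cF : continuous F.
      move=> t; apply: differentiable_continuous; apply/derivable1_diffP.
      exact: (@ex_derive _ _ _ _ _ _ _ (dF t)).
    split.
    + by move=> t _; exact: (@ex_derive _ _ _ _ _ _ _ (dF t)).
    + exact: cvg_at_right_filter (cF a).
    + exact: cvg_at_left_filter (cF b).
  - by move=> t _; rewrite derive1E; exact: (@derive_val _ _ _ _ _ _ _ (dF t)).
have fE : EFin \o f = (EFin \o f) \_ `[a, b].
  apply/funext => t; rewrite patchE; case: ifPn => // /negP; rewrite inE => /f0 h.
  by rewrite /= h.
split.
  rewrite fE; apply/(integrable_mkcond _ _).1 => //.
  by apply: continuous_compact_integrable; [exact: segment_compact|exact: continuous_subspaceT].
rewrite -[LHS]/(\int[lam]_t (EFin \o f) t)%E fE -integral_mkcond [LHS]ftc.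
by rewrite !FE ?subee// ?(ger0_norm (ltW b0))// /a normrN ger0_norm ?(ltW b0).
Qed.

Definition compactly_supported (F : 'rV[R]_n -> R) :=
  exists2 K, compact K & forall x, ~ K x -> F x = 0.

Lemma updE i (x : 'rV[R]_n) t h : upd x i (h * 1 + t) = h *: e_ i + upd x i t.
Proof.
by apply/rowP => j; rewrite !mxE eqxx/=; case: (j == i); rewrite /= ?mulr0 ?add0r.
Qed.

Lemma continuous_upd (f : 'rV[R]_n -> R) i x : continuous f -> continuous (fun t => f (upd x i t)).
Proof.
move=> cf t; apply: (@continuous_comp _ _ _ (upd x i)); last exact: cf.
move=> A /= /nbhs_ballP[e /= e0 eA]; apply/nbhs_ballP; exists e => //= s hs.
apply: eA; split => // i' j; rewrite !mxE; case: ifP => _; last exact: ballxx.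
exact: hs.
Qed.

Lemma integral_slice_partial0 (F : 'rV[R]_n -> R) i x : compactly_supported F ->
  (forall x, derivable F x (e_ i)) -> continuous (partial i F) ->
  lam.-integrable setT (EFin \o (fun t => partial i F (upd x i t))) /\
  (\int[lam]_t (partial i F (upd x i t))%:E = 0)%E.
Proof.
move=> [K cK F0] dF cp; have [k Kk] := compact_rV_bounded cK.
apply: (@integral_derive_compact0 (fun t => F (upd x i t)) _ k%:R).
- move=> t.
  apply: (@is_derive_along R R 'rV[R]_n R (fun t => F (upd x i t)) F t 1 (upd x i t) (e_ i)).
    by move=> h; rewrite -updE.
  exact: derivableP.
- exact: continuous_upd.
- move=> t kt; apply: F0 => /Kk/(_ i); rewrite mxE eqxx.
  by rewrite leNgt kt.
Qed.

(** Along lines in direction [i] the factor [psi] is constant and leaves the slice integral, so it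
    is never differentiated. This is what admits a singular or degenerate power of y as weight. *)
Lemma integral_partial0 (psi F : 'rV[R]_n -> R) i : compactly_supported F ->
  (forall x, derivable F x (e_ i)) -> continuous (partial i F) ->
  (forall x t, psi (upd x i t) = psi x) ->
  mu.-integrable setT (EFin \o (fun x => psi x * partial i F x)) ->
  \int[mu]_x (psi x * partial i F x) = 0.
Proof.
move=> cF dF cp hpsi ip; rewrite /Rintegral (integral_slice0 (i := i) ip)// => x.
have [i1 i2] := integral_slice_partial0 x cF dF cp.
under eq_integral do rewrite /= hpsi EFinM.
by rewrite integralZl// i2 mule0.
Qed.

Lemma integrable_bounded_support (rho f : 'rV[R]_n -> R) (K : set 'rV[R]_n) (B : R) (U : set 'rV[R]_n) :
  measurable U -> measurable_fun U rho -> measurable_fun U f -> (forall x, U x -> 0 <= rho x) ->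
  (forall x, K x -> `|f x| <= B) -> (forall x, ~ K x -> f x = 0) ->
  mu.-integrable U (EFin \o (fun x => rho x * \1_K x)) ->
  mu.-integrable U (EFin \o (fun x => rho x * f x)).
Proof.
move=> mU mr mf r0 fB f0 iK.
apply: (le_integrable mU _ _ (integrableZl mU B iK)).
  by apply/measurable_EFinP; exact: measurable_funM.
move=> x Ux /=; rewrite lee_fin.
suff h : `|rho x * f x| <= B * (rho x * \1_K x) by apply: (le_trans h); exact: ler_norm.
rewrite normrM (ger0_norm (r0 _ Ux)) mulrCA ler_wpM2l ?r0// indicE.
have [xK|xK] := boolP (x \in K); first by rewrite mulr1 fB//; exact: set_mem.
by rewrite mulr0 f0 ?normr0//; move/negP: xK; rewrite inE.
Qed.

End integral_partial.

(** * Test functions as elements of the weighted Sobolev space *)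

Section test_functions_H1.
Variables (R : realType) (n : nat) (U V : set 'rV[R]_n) (omega : 'rV[R]_n -> R).
Local Notation mu := (@lebesgue_rV R n).
Local Notation e_ i := (delta_mx ord0 i : 'rV[R]_n).

Lemma partial_support (K : set 'rV[R]_n) (f : 'rV[R]_n -> R) i : compact K ->
  (forall x, ~ K x -> f x = 0) -> forall x, ~ K x -> partial i f x = 0.
Proof.
move=> cK f0 x Kx; rewrite /partial (@near_eq_derive _ _ _ _ (cst 0)) ?derive_cst//.
have oK : open (~` K) by rewrite openC; exact: compact_rV_closed.
by near=> y; apply: f0; near: y; exact: (open_nbhs_nbhs (conj oK Kx)).
Unshelve. all: by end_near. Qed.

Lemma continuous_compact_support_integrable (W K : set 'rV[R]_n) (f : 'rV[R]_n -> R) :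
  measurable W -> continuous f -> compact K -> (forall x, ~ K x -> f x = 0) ->
  mu.-integrable W (EFin \o f).
Proof.
move=> mW cf cK f0; have [B _ fB] := continuous_compact_bounded cf cK.
have mK := compact_rV_measurable cK.
have := @integrable_bounded_support R n (fun=> 1) f K B W mW (measurable_cst _)
  (measurable_funS measurableT (@subsetT _ W) (continuous_rV_measurable cf)) (fun _ _ => ler01) fB f0.
rewrite (_ : (fun x => 1 * f x) = f); last by apply/funext => x; rewrite mul1r.
apply; apply/integrableP; split.
  by apply/measurable_EFinP; apply: measurable_funM => //; exact: measurable_indic.
under eq_integral do rewrite /= mul1r ger0_norm//.
rewrite integral_indic//; apply: le_lt_trans (compact_rV_measure cK).
by apply: le_measure; rewrite ?inE//; exact: measurableI.
Qed.

Hypotheses (oU : open U) (mom : measurable_fun U omega).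
Hypothesis om0 : forall x, U x -> 0 < omega x.
Hypothesis om_int : forall k, mu.-integrable U (EFin \o (fun x => omega x * \1_(@rV_box R n k) x)).
Let mU : measurable U := open_rV_measurable oU.

(** The support of [eta] is compact in [V] and may reach the boundary of [U], so a cube containing
    it is used together with the integrability of the weight over cubes. *)
Lemma test_L2 eta : test_function V eta -> L2 omega U eta.
Proof.
move=> [se [K [cK KV e0]]].
have [B _ fB] := continuous_compact_bounded (smooth_continuous se) cK.
have [k Kk] := compact_rV_bounded cK.
have me : measurable_fun U eta.
  exact: measurable_funS measurableT (@subsetT _ U) (continuous_rV_measurable (smooth_continuous se)).
have i1 := integrableZl mU (B ^+ 2) (om_int k).
apply: (L2_bound mU mom om0 me i1) => x Ux /=.
rewrite [leRHS]mulrCA ler_wpM2l ?(ltW (om0 Ux))// indicE.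
have [xK|xK] := pselect (K x).
  rewrite mem_set ?mulr1//; last exact: Kk.
  by rewrite -(real_normK (num_real (eta x))) ler_pXn2r ?nnegrE ?fB// (le_trans _ (fB _ xK)).
by rewrite e0// expr0n/= mulr_ge0// sqr_ge0.
Qed.

(** The product [eta * phi] has compact support inside [U] thanks to [phi], whatever [eta] does at
    the boundary; the integral over the whole space of its partial derivative vanishes. *)
Lemma test_weak_partial eta i : test_function V eta -> weak_partial U i eta (partial i eta).
Proof.
move=> [se _] phi [sp [K [cK KU p0]]].
have dp0 := @partial_support K phi i cK p0.
have de := @smooth_derivable R n eta se i; have dp := @smooth_derivable R n phi sp i.
have ce := smooth_continuous se; have cp := smooth_continuous sp.
have cde := smooth_continuous (smooth_partial i se); have cdp := smooth_continuous (smooth_partial i sp).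
have pE : partial i (fun x => eta x * phi x) = fun x => eta x * partial i phi x + partial i eta x * phi x.
  by apply/funext => x; rewrite [RHS]addrC [partial i eta x * _]mulrC addrC; apply: deriveM.
have i1 W : measurable W -> mu.-integrable W (EFin \o (fun x => eta x * partial i phi x)).
  move=> mW; apply: (continuous_compact_support_integrable (K := K)) => //.
    by move=> x; apply: continuousM; [exact: ce|exact: cdp].
  by move=> x /dp0 ->; rewrite mulr0.
have i2 W : measurable W -> mu.-integrable W (EFin \o (fun x => partial i eta x * phi x)).
  move=> mW; apply: (continuous_compact_support_integrable (K := K)) => //.
    by move=> x; apply: continuousM; [exact: cde|exact: cp].
  by move=> x /p0 ->; rewrite mulr0.
have cpE : continuous (partial i (fun x => eta x * phi x)).
  rewrite pE => x.
  have c1 : {for x, continuous (fun x => eta x * partial i phi x)}.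
    by apply: continuousM; [exact: ce|exact: cdp].
  have c2 : {for x, continuous (fun x => partial i eta x * phi x)}.
    by apply: continuousM; [exact: cde|exact: cp].
  exact: (continuousD c1 c2).
have h : \int[mu]_x (1 * partial i (fun x => eta x * phi x) x) = 0.
  apply: (@integral_partial0 R n (fun=> 1) (fun x => eta x * phi x) i).
  - by exists K => // x /p0 ->; rewrite mulr0.
  - by move=> x; apply: derivableM.
  - exact: cpE.
  - by [].
  - have := integrableD measurableT (i1 _ measurableT) (i2 _ measurableT).
    apply: eq_integrable => // x _; by rewrite pE /= mul1r.
apply/eqP; rewrite -addr_eq0 -RintegralD//; [|exact: i1|exact: i2].
rewrite -[X in _ == X]h -[X in X == _]/(\int[mu]_(x in U) _) Rintegral_mkcond; apply/eqP.
apply: eq_Rintegral => x _; rewrite patchE pE mul1r; case: ifPn => // /negP xU.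
have Kx : ~ K x by move=> /KU Ux; apply: xU; rewrite inE.
by rewrite p0// dp0// !mulr0 addr0.
Qed.

Lemma test_H1 eta : test_function V eta -> H1 omega U eta.
Proof.
move=> te; split; first exact: test_L2.
move=> i; exists (partial i eta); last exact: test_weak_partial.
by apply: test_L2; exact: test_function_partial.
Qed.

End test_functions_H1.

(** * Integrability of powers of the height *)

Section power_weight.
Variable R : realType.
Local Notation lam := (@lebesgue_measure R).

(** For negative [al] the integrand is singular at 0. The primitive t^(al+1) / (al+1) bounds the
    integrals over [1/(k+1), b] uniformly in k, and these intervals increase to ]0, b]; b > 1 keeps
    them nondegenerate. *)
Lemma integral_powR_lty (al b : R) : -1 < al -> 1 < b ->
  (\int[lam]_(t in `]0%R, b]) (t `^ al)%:E < +oo)%E.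
Proof.
move=> al1 b1.
have a10 : 0 < al + 1 by lra.
pose F (k : nat) : set (measurableTypeR R) := `[k.+1%:R^-1, b]%classic.
have FE : \bigcup_k F k = `]0, b]%classic.
  apply/seteqP; split => t /=.
    move=> [k _]; rewrite /F /= !in_itv/= => /andP[kt ->]; rewrite andbT.
    by apply: lt_le_trans kt; rewrite invr_gt0.
  rewrite in_itv/= => /andP[t0 tb]; exists (Num.truncn t^-1) => //.
  rewrite /F/= in_itv/= tb andbT -[leRHS]invrK lef_pV2 ?posrE ?invr_gt0//.
  exact/ltW/truncnS_gt.
have nF : nondecreasing_seq F.
  move=> i j ij; apply/subsetPset => t; rewrite /F /= !in_itv/= => /andP[h ->]; rewrite andbT.
  by apply: le_trans h; rewrite lef_pV2 ?posrE// ler_nat.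
have := @ge0_nondecreasing_set_cvg_integral _ _ R F (fun t : measurableTypeR R => (t `^ al)%:E) lam nF (fun i => measurable_itv _).
rewrite FE => h.
have {}h : (\int[lam]_(t in F k) (t `^ al)%:E)%E @[k --> \oo] --> (\int[lam]_(t in `]0%R, b]) (t `^ al)%:E)%E.
  apply: h.
    move=> i; apply/measurable_EFinP; apply: measurable_funS measurableT _ (measurable_powR al) => //.
  by move=> i x _; rewrite lee_fin powR_ge0.
rewrite -(cvg_lim _ h)//; apply: (@le_lt_trans _ _ ((al + 1)^-1 * b `^ (al + 1))%:E); last exact: ltry.
apply: lime_le; first by apply/cvg_ex; eexists; exact: h.
apply: nearW => k; rewrite /F.
have kb : k.+1%:R^-1 < b by rewrite (le_lt_trans _ b1)// invf_le1// ler1n.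
have k0 : 0 < k.+1%:R^-1 :> R by rewrite invr_gt0.
have dF (t : R) : 0 < t -> is_derive t (1 : R) ((al + 1)^-1 \*: (fun t => t `^ (al + 1))) (t `^ al).
  move=> t0; apply: (is_derive_eq (is_deriveZ (al + 1)^-1 (is_derive1_powR (al + 1) t0))).
  by rewrite addrK [_ *: _]mulrA mulVf ?mul1r// gt_eqF.
have cF (t : R) : 0 < t -> {for t, continuous ((al + 1)^-1 \*: (fun t => t `^ (al + 1)))}.
  move=> /dF dt; apply: differentiable_continuous; apply/derivable1_diffP.
  exact: (@ex_derive _ _ _ _ _ _ _ dt).
rewrite (@continuous_FTC2 _ _ ((al + 1)^-1 \*: (fun t => t `^ (al + 1)))) //.
- rewrite -EFinB lee_fin /= gerBl [_ *: _]/(_ * _) mulr_ge0 ?powR_ge0// invr_ge0 ltW//.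
- apply: continuous_in_subspaceT => t; rewrite inE/= in_itv/= => /andP[kt _].
  have t0 : 0 < t by exact: lt_le_trans kt.
  apply: differentiable_continuous; apply/derivable1_diffP.
  by apply: derivable_powR; rewrite in_itv/= t0.
- split.
  + move=> t; rewrite in_itv/= => /andP[kt _]; have t0 : 0 < t by exact: lt_trans kt.
    exact: (@ex_derive _ _ _ _ _ _ _ (dF t t0)).
  + apply: cvg_at_right_filter; exact: cF.
  + apply: cvg_at_left_filter; apply: cF; exact: lt_trans kb.
- move=> t; rewrite in_itv/= => /andP[kt _]; have t0 : 0 < t by exact: lt_trans kt.
  by rewrite derive1E; exact: (@derive_val _ _ _ _ _ _ _ (dF t t0)).
Qed.

(** Cut off at 0 because [powR] need not vanish there or at negative arguments. *)
Definition half_power (al t : R) : R := if 0 < t then t `^ al else 0.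

Lemma measurable_half_power al : measurable_fun setT (half_power al).
Proof.
apply: measurable_fun_ifT => //; first exact: measurable_fun_ltr.
Qed.

Lemma half_power_ge0 al t : 0 <= half_power al t.
Proof. by rewrite /half_power; case: ifP => // _; exact: powR_ge0. Qed.

(** On a cube the weight is dominated by a product of functions of one coordinate each: a truncated
    power in direction [i], indicators of intervals in the others. *)
Lemma half_power_box_integrable n (i : 'I_n) (al : R) (k : nat) : - 1 < al ->
  (@lebesgue_rV R n).-integrable setT
    (EFin \o (fun x : 'rV[R]_n => half_power al (x ord0 i) * \1_(@rV_box R n k) x)).
Proof.
move=> al1.
(* At least [k], to contain the cube, and greater than 1, as [integral_powR_lty] demands. *)
pose b : R := k%:R + 2.
have b1 : 1 < b by rewrite /b; have : 0 <= k%:R :> R by []; lra.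
pose I0 : set R := `]0, b]%classic.
pose Ik : set R := `[- k%:R, k%:R]%classic.
pose g j : R -> R := if j == i then (fun t => t `^ al * \1_I0 t) else \1_Ik.
have mg j : measurable_fun setT (g j).
  rewrite /g; case: ifP => _; last by apply: measurable_indic; exact: measurable_itv.
  apply: measurable_funM; first exact: (measurable_powR al).
  by apply: measurable_indic; exact: measurable_itv.
have g0 j t : 0 <= g j t.
  by rewrite /g; case: ifP => _; rewrite ?mulr_ge0 ?powR_ge0// indicE.
have gfin j : (\int[lam]_t (g j t)%:E < +oo)%E.
  rewrite /g; case: ifP => _.
    have := integral_powR_lty al1 b1; rewrite integral_mkcond.
    congr (_ < _)%E; apply: eq_integral => t _; rewrite patchE indicE.
    by case: ifP => _; rewrite ?mulr1 ?mulr0.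
  pose J : set (measurableTypeR R) := `[- k%:R, k%:R]%classic.
  have mJ : measurable J by exact: measurable_itv.
  rewrite (integral_indic lam measurableT mJ) setIT.
  have -> : (lebesgue_measure J < +oo)%E; last by [].
  by rewrite lebesgue_measure_itv/=; case: ifP; rewrite ?ltry// -EFinD ltry.
have gr j : (\int[lam]_t (g j t)%:E = (fine (\int[lam]_t (g j t)%:E))%:E)%E.
  rewrite fineK// ge0_fin_numE//; apply: integral_ge0 => t _; rewrite lee_fin; exact: g0.
have hp := integral_prod_coord mg g0 gr.
have ig : (@lebesgue_rV R n).-integrable setT (EFin \o (fun x : 'rV[R]_n => \prod_j g j (x ord0 j))).
  apply/integrableP; split.
    apply/measurable_EFinP; apply: measurable_prod => j _.
    exact: (measurableT_comp (mg j) (measurable_rV_coord j)).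
  under eq_integral => x _ do rewrite /= ger0_norm ?prodr_ge0//.
  by rewrite hp ltry.
apply: le_integrable ig => //.
  apply/measurable_EFinP; apply: measurable_funM.
    exact: (measurableT_comp (measurable_half_power al) (measurable_rV_coord i)).
  by apply: measurable_indic; exact: measurable_rV_box.
move=> x _ /=; rewrite lee_fin.
suff h : half_power al (x ord0 i) * \1_(@rV_box R n k) x <= \prod_j g j (x ord0 j).
  rewrite !ger0_norm ?prodr_ge0// mulr_ge0 ?half_power_ge0// indicE.
rewrite indicE; have [xk|_] := boolP (x \in _); last by rewrite mulr0 prodr_ge0.
rewrite mulr1 /half_power; case: ifPn => [x0|_]; last by rewrite prodr_ge0.
have xk' j := (set_mem xk) j.
rewrite (bigD1 i)//= {1}/g eqxx big1.
  rewrite mulr1 indicE mem_set ?mulr1// /I0/= in_itv/= x0/=.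
  by have := xk' i; rewrite /b ler_norml => /andP[_]; lra.
move=> j ji; rewrite /g (negbTE ji) indicE mem_set// /Ik/= in_itv/=.
by rewrite -ler_norml; exact: xk'.
Qed.

End power_weight.

(** * The Poincare inequality for test functions *)

Section poincare_test.
Variables (R : realType) (n : nat) (U V : set 'rV[R]_n) (omega psi : 'rV[R]_n -> R).
Variables (i : 'I_n) (L : R).
Local Notation mu := (@lebesgue_rV R n).
Local Notation e_ i := (delta_mx ord0 i : 'rV[R]_n).
Hypotheses (oU : open U) (mom : measurable_fun U omega).
Hypothesis om0 : forall x, U x -> 0 < omega x.
Hypothesis om_loc : forall K, compact K -> K `<=` U ->
  exists2 c, 0 < c & forall x, K x -> c <= omega x.
Hypotheses (mpsi : measurable_fun setT psi) (psi0 : forall x, 0 <= psi x).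
Hypothesis psi_upd : forall x t, psi (upd x i t) = psi x.
Hypothesis psiU : forall x, U x -> psi x = omega x.
Hypothesis psiV : forall x, V x -> ~ U x -> psi x = 0.
Hypothesis psi_int : forall k, mu.-integrable setT (EFin \o (fun x => psi x * \1_(@rV_box R n k) x)).
Hypothesis UL : forall x, U x -> `|x ord0 i| <= L.
Let mU : measurable U := open_rV_measurable oU.

Lemma om_int k : mu.-integrable U (EFin \o (fun x => omega x * \1_(@rV_box R n k) x)).
Proof.
have h : mu.-integrable U (EFin \o (fun x => psi x * \1_(@rV_box R n k) x)).
  by apply: integrableS (psi_int k).
by apply: eq_integrable h => // x; rewrite inE => Ux /=; rewrite psiU.
Qed.

Lemma pd_test eta j : test_function V eta -> pd U omega j eta = partial j eta %[ae mu in U].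
Proof.
move=> te; have He := test_H1 oU mom om0 om_int te.
have [Lp wp] := pdP j He.
apply: (weak_partial_uniq oU mom om0 om_loc Lp _ wp).
  exact: (test_L2 oU mom om0 om_int (test_function_partial j te)).
exact: (test_weak_partial oU j te).
Qed.

(* This is the vanishing of the integral of [psi * d_i (x_i * eta ^ 2)] over R^n. *)
Lemma test_identity eta : test_function V eta ->
  ip U omega eta eta = - 2 * ip U omega (fun x => x ord0 i * eta x) (partial i eta).
Proof.
move=> te; have [se [K [cK KV e0]]] := te.
have tp := test_function_partial i te.
have p0 := @partial_support R n K eta i cK e0.
have ce := smooth_continuous se; have cp := smooth_continuous (smooth_partial i se).
have [k Kk] := compact_rV_bounded cK.
have dcoord (x : 'rV[R]_n) : is_derive x (e_ i) (fun x : 'rV[R]_n => x ord0 i) (1 : R).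
  apply: (@is_derive_along R 'rV[R]_n R R _ id x (e_ i) (x ord0 i) (1 : R)).
  by move=> h; rewrite !mxE !eqxx.
have de (x : 'rV[R]_n) : derivable eta x (e_ i) by exact: (@smooth_derivable R n eta se i x).
pose F (x : 'rV[R]_n) := x ord0 i * (eta x * eta x).
have dF (x : 'rV[R]_n) : is_derive x (e_ i) F (eta x * eta x + 2 * (x ord0 i * eta x * partial i eta x)).
  have d1 := derivableP (de x).
  have := is_deriveM (dcoord x) (is_deriveM d1 d1).
  have sc (a b : R) : a *: b = a * b by [].
  rewrite !sc mulr1 => h.
  rewrite (_ : _ + _ = x ord0 i * (eta x * 'D_(e_ i) eta x + eta x * 'D_(e_ i) eta x) + (eta * eta) x).
    exact: h.
  rewrite /partial -[(eta * eta) x]/(eta x * eta x); ring.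
have pF : partial i F = fun x => eta x * eta x + 2 * (x ord0 i * eta x * partial i eta x).
  by apply/funext => x; exact: (@derive_val _ _ _ _ _ _ _ (dF x)).
have cc : continuous (fun x : 'rV[R]_n => x ord0 i) by move=> x; exact: coord_continuous.
have c1 : continuous (fun x => eta x * eta x) by move=> x; apply: continuousM; exact: ce.
have c2 : continuous (fun x : 'rV[R]_n => x ord0 i * eta x * partial i eta x).
  move=> x; have h1 : {for x, continuous (fun x : 'rV[R]_n => x ord0 i * eta x)}.
    by apply: continuousM; [exact: cc|exact: ce].
  by apply: (continuousM h1); exact: cp.
have psi_cc (f : 'rV[R]_n -> R) : continuous f -> (forall x, ~ K x -> f x = 0) ->
    mu.-integrable setT (EFin \o (fun x => psi x * f x)).
  move=> cf f0; have [B _ fB] := continuous_compact_bounded cf cK.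
  have [B' _ fB'] : exists2 B', 0 <= B' & forall x, @rV_box R n k x -> `|f x| <= B'.
    exists (Num.max B 0); first by rewrite le_max lexx orbT.
    move=> x _; have [xK|xK] := pselect (K x); first by rewrite le_max fB.
    by rewrite f0// normr0 le_max lexx orbT.
  apply: (@integrable_bounded_support R n psi f (@rV_box R n k) B' setT) => //.
    exact: continuous_rV_measurable.
  by move=> x nx; apply: f0 => /Kk.
have i1 : mu.-integrable setT (EFin \o (fun x => psi x * (eta x * eta x))).
  by apply: psi_cc => // x /e0 ->; rewrite mulr0.
have i2 : mu.-integrable setT (EFin \o (fun x : 'rV[R]_n => psi x * (x ord0 i * eta x * partial i eta x))).
  by apply: psi_cc => // x /p0 ->; rewrite mulr0.
have i22 : mu.-integrable setT (EFin \o (fun x : 'rV[R]_n => 2 * (psi x * (x ord0 i * eta x * partial i eta x)))).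
  exact: (integrableZl measurableT 2 i2).
have h : \int[mu]_x (psi x * partial i F x) = 0.
  apply: (@integral_partial0 R n psi F i).
  - by exists K => // x /e0; rewrite /F => ->; rewrite !mulr0.
  - by move=> x; exact: (@ex_derive _ _ _ _ _ _ _ (dF x)).
  - rewrite pF => x.
    have h2 : {for x, continuous (fun x : 'rV[R]_n => 2 * (x ord0 i * eta x * partial i eta x))}.
      by apply: continuousM; [exact: cst_continuous|exact: c2].
    exact: (continuousD (c1 x) h2).
  - exact: psi_upd.
  - apply: eq_integrable (integrableD measurableT i1 i22) => // x _.
    by rewrite /= pF -EFinD; congr EFin; ring.
have hE : \int[mu]_x (psi x * partial i F x) = \int[mu]_x (psi x * (eta x * eta x)) +
    2 * \int[mu]_x (psi x * (x ord0 i * eta x * partial i eta x)).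
  rewrite -RintegralZl// -RintegralD//.
  by apply: eq_Rintegral => x _; rewrite pF; ring.
(* Outside [K] the integrand is 0, and at points of [K] outside [U] the weight [psi] is 0 since [K]
   lies in [V]; so integrals over the whole space reduce to [U]. *)
have toU (f g : 'rV[R]_n -> R) : (forall x, ~ K x -> f x * g x = 0) ->
    \int[mu]_x (psi x * (f x * g x)) = ip U omega f g.
  move=> f0; rewrite /ip [RHS]Rintegral_mkcond; apply: eq_Rintegral => x _.
  rewrite patchE; case: ifPn => [/set_mem/psiU -> //|/negP xU].
  have [Kx|/f0 ->] := pselect (K x); last by rewrite mulr0.
  by rewrite psiV ?mul0r//; [exact: KV|move=> Ux; apply: xU; rewrite inE].
move: hE; rewrite h toU; last by move=> x /e0 ->; rewrite mulr0.
rewrite (toU (fun x => x ord0 i * eta x)); last by move=> x /p0 ->; rewrite mulr0.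
by move=> hE; apply/eqP; rewrite mulNr -addr_eq0 -hE.
Qed.

(** Cauchy-Schwarz in [test_identity], with |x_i| <= L on [U], bounds the squared norm of [eta] by 2
    |L| times its norm times that of its i-th derivative; one factor then cancels. *)
Lemma poincare_test eta : test_function V eta ->
  snorm (ip U omega) eta <= 2 * `|L| * snorm (gip U omega) eta.
Proof.
move=> te; have He := test_H1 oU mom om0 om_int te.
have sipL2 := L2_semi_ip mU mom om0.
have Le : L2 omega U eta by case: He.
have Lp := test_L2 oU mom om0 om_int (test_function_partial i te).
have mc : measurable_fun U (fun x : 'rV[R]_n => x ord0 i).
  exact: measurable_funS measurableT (@subsetT _ U) (measurable_rV_coord i).
have [Lx xB] := L2_mul_bounded mU mom om0 mc (aeW _ UL) Le.
have E := test_identity te.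
have CS := snorm_CS sipL2 Lx Lp.
have h1 : snorm (ip U omega) eta ^+ 2 <= 2 * (`|L| * snorm (ip U omega) eta * snorm (ip U omega) (partial i eta)).
  rewrite (snorm_sqr sipL2)// E mulNr -mulrN ler_wpM2l//.
  apply: (le_trans (ler_norm _)); rewrite normrN; apply: (le_trans CS).
  by rewrite ler_wpM2r ?snorm_ge0.
have pe : snorm (ip U omega) (partial i eta) <= snorm (gip U omega) eta.
  rewrite -(snorm_ae oU mom om0 (L2_pd i He) Lp (pd_test i te)).
  exact: (pd_snorm_le oU mom om0).
have [->|e0] := eqVneq (snorm (ip U omega) eta) 0; first by rewrite !mulr_ge0 ?snorm_ge0.
have ep : 0 < snorm (ip U omega) eta by rewrite lt_def e0 snorm_ge0.
rewrite -(ler_pM2r ep) -expr2; apply: (le_trans h1).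
rewrite -!mulrA ler_wpM2l// ler_wpM2l// [leRHS]mulrC ler_wpM2l ?(ltW ep)//.
Qed.

End poincare_test.

(** * The cylinder *)

Section coordinates.
Variable R : realType.

Lemma norm_coord_le m n (M : 'M[R]_(m, n)) i j : `|M i j| <= `|M|.
Proof.
have -> : `|M| = mx_norm M by [].
by rewrite mx_normrE; apply: (le_bigmax _ (fun ij => `|M ij.1 ij.2|) (i, j)).
Qed.

Lemma open_convex_polytope_open d (Omega : set 'rV[R]_d) : open_convex_polytope Omega -> open Omega.
Proof.
move=> [_ _ [m [N [b ->]]]].
rewrite openE => x /= hx.
suff h i : \forall y \near x, (N *m y^T) i ord0 < b i ord0 by have := @filter_forall _ _ _ _ (nbhs_filter x) h; apply: filterS.
have cf : continuous (fun x : 'rV[R]_d => (N *m x^T) i ord0).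
  rewrite (_ : (fun x : 'rV[R]_d => _) = fun x => \sum_j N i j * x ord0 j); last first.
    by apply/funext => z; rewrite mxE; apply: eq_bigr => j _; rewrite mxE.
  elim: (index_enum _) => [|j s IH] y.
    by under eq_fun do rewrite big_nil; exact: cst_continuous.
  under eq_fun do rewrite big_cons.
  apply: (@continuousD _ _ _ (fun x : 'rV[R]_d => N i j * x ord0 j)); last exact: IH.
  by apply: continuousM; [exact: cst_continuous|exact: coord_continuous].
have := cf x; move/cvgr_lt; apply; exact: hx.
Qed.

Lemma bounded_coord d (Omega : set 'rV[R]_d) : bounded_set Omega ->
  exists2 L, 0 <= L & forall x, Omega x -> `|x| <= L.
Proof.
move=> [M [Mr MP]]; exists (`|M| + 1); first by rewrite addr_ge0.
by move=> x Ox; apply: (MP (`|M| + 1)) => //; rewrite (le_lt_trans (ler_norm M))// ltrDl.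
Qed.

(* [b] forgets the last coordinate. *)
Lemma negligible_proj_S d (b : 'rV[R]_d.+1 -> 'rV[R]_d) (P : set 'rV[R]_d) :
  (forall x j, b x ord0 j = x ord0 (widen_ord (leqnSn d) j)) ->
  {ae lebesgue_rV, forall v, P v} -> {ae lebesgue_rV, forall x, P (b x)}.
Proof.
move=> bE [N [mN N0 PN]].
have mb : measurable_fun [set: 'rV[R]_d.+1] b.
  apply: measurable_fun_rV => j; under eq_fun do rewrite bE.
  exact: measurable_rV_coord.
have mbN : measurable (b @^-1` N) by rewrite -[X in measurable X]setTI; exact: mb.
exists (b @^-1` N); split => //; last by move=> x /= h; apply: PN.
rewrite -[b @^-1` N]setIT -integral_indic//.
have m1 : measurable_fun [set: 'rV[R]_d.+1] (fun x => (\1_(b @^-1` N) x)%:E : \bar R).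
  by apply/measurable_EFinP; exact: measurable_indic.
(* With the last coordinate fixed, the slice of the preimage is [N] itself, so every inner integral
   is 0. *)
rewrite (ge0_integral_rcons2 m1); last by move=> x; rewrite lee_fin.
rewrite integral0_eq// => t _.
rewrite -[RHS]N0 -[N in RHS]setIT -integral_indic//; apply: eq_integral => v _.
congr (_%:E); rewrite !indicE -[in RHS](_ : b (rV_rcons (v, t)) = v)//.
by apply/rowP => j; rewrite bE rV_rcons_low.
Qed.

End coordinates.

Section cylinder_geometry.
Variables (R : realType) (d : nat) (Omega : set 'rV[R]_d) (s : R).
Hypotheses (hOmega : open_convex_polytope Omega) (hs : 0 < s < 1).
Local Notation U := (cylinder Omega).
Local Notation V := (full_cylinder Omega).
Local Notation weight := (@weight R d s).
Local Notation al := (alpha s).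

Let oOmega : open Omega := open_convex_polytope_open hOmega.

Lemma base_ptE (x : 'rV[R]_(d + 1)) i j : base_pt x i j = x i (lshift 1 j).
Proof. by rewrite mxE. Qed.

Lemma measurable_base_pt : measurable_fun [set: 'rV[R]_(d + 1)] (@base_pt R d).
Proof.
apply: measurable_fun_rV => i; under eq_fun do rewrite base_ptE.
exact: measurable_rV_coord.
Qed.

Lemma continuous_base_pt : continuous (@base_pt R d).
Proof.
move=> x A /nbhs_ballP[e /= e0 eA]; apply/nbhs_ballP; exists e => //= y [_ xy].
by apply: eA; split => // i j; rewrite !base_ptE; exact: xy.
Qed.

Lemma cylinder_open : open U.
Proof.
apply: openI; first by apply: open_comp oOmega => x _; exact: continuous_base_pt.
by apply: (@open_comp _ _ (@height R d) [set t | 0 < t]); [move=> x _; exact: coord_continuous|exact: open_gt].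
Qed.

Lemma weight_gt0 x : U x -> 0 < weight x.
Proof. by move=> [_ hx]; rewrite powR_gt0. Qed.

Lemma measurable_weight : measurable_fun U weight.
Proof.
apply: measurable_funS measurableT (@subsetT _ U) _.
exact: (measurableT_comp (measurable_powR al) (measurable_rV_coord _)).
Qed.

(** On a compact subset of the cylinder the height ranges between two positive numbers, and the
    power is increasing or decreasing according to the sign of [alpha], so its value at one of these
    two ends is a lower bound. *)
Lemma weight_loc K : compact K -> K `<=` U -> exists2 c, 0 < c & forall x, K x -> c <= weight x.
Proof.
move=> cK KU.
have [K0|K0] := pselect (K !=set0); last first.
  by exists 1 => // x Kx; exfalso; apply: K0; exists x.
have ch : continuous (fun x : 'rV[R]_(d + 1) => - height x).
  by move=> x; apply: continuousN; exact: coord_continuous.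
have [m mK hm] := EVT_max_rV K0 cK (continuous_subspaceT ch).
have [k Kk] := compact_rV_bounded cK.
have m0 : 0 < height m by have [] := KU _ (set_mem mK).
have k0 : height m <= k%:R by have := Kk _ (set_mem mK) (rshift d ord0); rewrite ler_norml => /andP[].
have kp : 0 < (k%:R : R) by exact: lt_le_trans k0.
exists (Num.min (height m `^ al) (k%:R `^ al)); first by rewrite lt_min !powR_gt0.
move=> x Kx; have hx : height m <= height x by have := hm x (mem_set Kx); rewrite lerN2.
have hk : height x <= k%:R by have := Kk _ Kx (rshift d ord0); rewrite ler_norml => /andP[].
have x0 : 0 < height x by exact: lt_le_trans hx.
rewrite /weight ge_min; have [a0|a0] := leP 0 al; apply/orP.
  by left; apply: ge0_ler_powR; rewrite ?nnegrE ?(ltW m0) ?(ltW x0).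
right; rewrite -[al]opprK !(powRN _ (- al)) lef_pV2 ?posrE ?powR_gt0//.
by apply: ge0_ler_powR; rewrite ?nnegrE ?(ltW kp) ?(ltW x0)// oppr_ge0 ltW.
Qed.

(* Extending the weight by 0 turns integrals over the cylinder into integrals over R^(d+1). *)
Definition zero_weight (x : 'rV[R]_(d + 1)) : R := half_power al (height x).

Lemma zero_weight_cylinder x : U x -> zero_weight x = weight x.
Proof. by move=> [_ hx]; rewrite /zero_weight /half_power hx. Qed.

Lemma alpha_gtN1 : - 1 < al.
Proof. by case/andP : hs => _ s1; rewrite /alpha; lra. Qed.

Lemma poincare_constant : exists2 L, 0 <= L & forall x, U x -> forall i, `|x ord0 (lshift 1 i)| <= L.
Proof.
have [L L0 LP] : exists2 L, 0 <= L & forall x, Omega x -> `|x| <= L.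
  by case: hOmega => _ /bounded_coord.
exists L => // x [Ox _] i; rewrite -base_ptE; apply: le_trans (LP _ Ox); exact: norm_coord_le.
Qed.

Lemma zero_weight_upd (i : 'I_d) x t : zero_weight (upd x (lshift 1 i) t) = zero_weight x.
Proof.
rewrite /zero_weight /height mxE ifF//; apply/negbTE; rewrite -val_eqE/= addn0.
by rewrite gtn_eqF// ltn_ord.
Qed.

Lemma zero_weight_out x : V x -> ~ U x -> zero_weight x = 0.
Proof.
move=> Vx Ux; rewrite /zero_weight /half_power ifF//; apply/negbTE/negP => hx.
by apply: Ux; split.
Qed.

Lemma measurable_zero_weight : measurable_fun setT zero_weight.
Proof. exact: (measurableT_comp (measurable_half_power al) (measurable_rV_coord _)). Qed.

Lemma zero_weight_int k : (@lebesgue_rV R (d + 1)).-integrable setT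
  (EFin \o (fun x => zero_weight x * \1_(@rV_box R (d + 1) k) x)).
Proof. exact: half_power_box_integrable alpha_gtN1. Qed.

Lemma cylinder_test_H1 eta : test_function V eta -> H1 weight U eta.
Proof.
apply: (test_H1 cylinder_open measurable_weight weight_gt0) => k.
exact: (om_int cylinder_open zero_weight_cylinder zero_weight_int).
Qed.

(** Uses the first coordinate of [Omega], in which the cylinder is bounded and along which the
    weight does not change. *)
Lemma cylinder_poincare_test : (0 < d)%N -> exists2 P, 0 <= P & forall eta, test_function V eta ->
  snorm (ip U weight) eta <= P * snorm (gip U weight) eta.
Proof.
move=> d0; have [L L0 LP] := poincare_constant.
pose i : 'I_d := Ordinal d0.
exists (2 * `|L|); first by rewrite mulr_ge0.
move=> eta te.
apply: (@poincare_test R (d + 1) U V weight zero_weight (lshift 1 i) L cylinder_open) te.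
- exact: measurable_weight.
- exact: weight_gt0.
- exact: weight_loc.
- exact: measurable_zero_weight.
- by move=> x; exact: half_power_ge0.
- exact: zero_weight_upd.
- exact: zero_weight_cylinder.
- exact: zero_weight_out.
- exact: zero_weight_int.
- by move=> x Ux; exact: LP.
Qed.

Lemma measurable_base (q : 'rV[R]_d -> R) : measurable_fun Omega q -> measurable_fun U (q \o (@base_pt R d)).
Proof.
move=> mq; apply: (@measurable_comp _ _ _ _ _ _ Omega) => //.
- exact: open_rV_measurable.
- by move=> _ [x [Ox _] <-].
- exact: measurable_funS measurableT (@subsetT _ U) measurable_base_pt.
Qed.

Lemma ae_base (P : set 'rV[R]_d) : {ae lebesgue_rV, forall x, Omega x -> P x} ->
  {ae lebesgue_rV, forall x, U x -> P (base_pt x)}.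
Proof.
(* [d + 1] and [d.+1] are not convertible, so the dimension is generalized to an [m] equal to
   [d.+1], then substituted. *)
suff H m (e : m = d.+1) (b : 'rV[R]_m -> 'rV[R]_d) (W : set 'rV[R]_d) :
    (forall x (i : 'I_d) (j : 'I_m), i = j :> nat -> b x ord0 i = x ord0 j) ->
    {ae lebesgue_rV, forall v, W v} -> {ae lebesgue_rV, forall x, W (b x)}.
  move=> /(H _ (addn1 d) (@base_pt R d) [set x | Omega x -> P x]) h.
  have {h} : {ae lebesgue_rV, forall x : 'rV[R]_(d + 1), [set x | Omega x -> P x] (base_pt x)}.
    by apply: h => x i j ij; rewrite base_ptE; congr (x _ _); exact: val_inj.
  by apply: filterS => x /= h [Ox _]; exact: h.
subst m => bE; apply: negligible_proj_S => x j; exact: bE.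
Qed.

End cylinder_geometry.

(** * Energy forms *)

Lemma dot_mul_sym (R : realType) n (a b : 'rV[R]_n) (N : 'M[R]_n) : N^T = N ->
  dot a (b *m N^T) = dot b (a *m N^T).
Proof.
move=> Ns; rewrite /dot Ns !trmx_mul Ns.
have tr (X : 'M[R]_1) : X ord0 ord0 = X^T ord0 ord0 by rewrite mxE.
by rewrite [LHS]tr !trmx_mul trmxK Ns mulmxA.
Qed.

Section energy.
Variables (R : realType) (n : nat) (U V : set 'rV[R]_n) (omega : 'rV[R]_n -> R).
Local Notation mu := (@lebesgue_rV R n).
Local Notation ip := (ip U omega).
Local Notation gip := (gip U omega).
Local Notation pd := (pd U omega).
Local Notation L2 := (L2 omega U).
Local Notation H1 := (H1 omega U).
Local Notation H1V := (H1_vanishing omega U V).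
Hypotheses (oU : open U) (mom : measurable_fun U omega).
Hypothesis om0 : forall x, U x -> 0 < omega x.
Hypothesis om_loc : forall K, compact K -> K `<=` U ->
  exists2 c, 0 < c & forall x, K x -> c <= omega x.
Variables (M : 'rV[R]_n -> 'M[R]_n) (B : R).
Hypothesis mM : forall i j, measurable_fun U (fun x => M x i j).
Hypothesis MB : forall x, U x -> forall i j, `|M x i j| <= B.

Let mU : measurable U := open_rV_measurable oU.
Let sipL2 := L2_semi_ip mU mom om0.
Let sipH1 := H1_gip oU mom om0 om_loc.

Lemma L2_sum (I : Type) (r : seq I) (f : I -> 'rV[R]_n -> R) :
  (forall i, L2 (f i)) -> L2 (fun x => \sum_(i <- r) f i x) /\
  snorm ip (fun x => \sum_(i <- r) f i x) <= \sum_(i <- r) snorm ip (f i).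
Proof.
move=> Lf; elim: r => [|i r [IH1 IH2]].
  under eq_fun do rewrite big_nil.
  by split; [exact: L2_0|rewrite big_nil /snorm (sip_zero sipL2 (sip0 sipL2)) sqrtr0].
under eq_fun do rewrite big_cons; rewrite big_cons; split.
  have := L2_lin mU mom om0 1 (Lf i) IH1; congr (Defs.L2 _ _ _).
  by apply/funext => x; rewrite mul1r.
by apply: (le_trans (snormD sipL2 (Lf i) IH1)); rewrite lerD2l.
Qed.

Definition flux i w : 'rV[R]_n -> R := fun x => \sum_j M x i j * pd j w x.

Lemma L2_flux i w : H1 w -> L2 (flux i w) /\ snorm ip (flux i w) <= n%:R * `|B| * snorm gip w.
Proof.
move=> Hw.
have h j := L2_mul_bounded mU mom om0 (mM i j) (aeW mu (fun x Ux => MB Ux i j)) (L2_pd j Hw).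
have [L1 L2'] := L2_sum (index_enum _) (fun j => (h j).1); split => //.
apply: (le_trans L2'); apply: (@le_trans _ _ (\sum_(j < n) `|B| * snorm gip w)).
  apply: ler_sum => j _; apply: (le_trans (h j).2).
  by rewrite ler_wpM2l//; exact: (pd_snorm_le oU mom om0).
by rewrite sumr_const card_ord -[leLHS]mulr_natl mulrA.
Qed.

Lemma flux_lin i a u v : H1 u -> H1 v ->
  flux i (fun x => a * u x + v x) = (fun x => a * flux i u x + flux i v x) %[ae mu in U].
Proof.
move=> Hu Hv.
have h : \forall x \ae mu, forall j : 'I_n, U x -> pd j (fun x => a * u x + v x) x = a * pd j u x + pd j v x.
  by apply: filter_forall => j; exact: (pd_lin oU mom om0 om_loc j a Hu Hv).
apply: filterS h => x h Ux; rewrite /flux mulr_sumr -big_split/=; apply: eq_bigr => j _.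
by rewrite h//; ring.
Qed.

Lemma dot_flux w v x : dot (grad omega U v x) (grad omega U w x *m (M x)^T) =
  \sum_i flux i w x * pd i v x.
Proof.
rewrite dot_sum; apply: eq_bigr => i _; rewrite gradE mulrC mxE; congr (_ * _).
by apply: eq_bigr => j _; rewrite gradE mxE mulrC.
Qed.

Lemma energy_flux w v : H1 w -> H1 v ->
  mu.-integrable U (EFin \o (fun x => omega x * dot (grad omega U v x) (grad omega U w x *m (M x)^T))) /\
  \int[mu]_(x in U) (omega x * dot (grad omega U v x) (grad omega U w x *m (M x)^T)) =
  \sum_i ip (flux i w) (pd i v).
Proof.
move=> Hw Hv.
have [i1 i2] := Rintegral_sum oU (index_enum _) (fun i => L2_ip_integrable mU mom om0 (L2_flux i Hw).1 (L2_pd i Hv)).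
have E x : omega x * dot (grad omega U v x) (grad omega U w x *m (M x)^T) =
    \sum_i omega x * (flux i w x * pd i v x).
  by rewrite dot_flux mulr_sumr.
by under eq_fun do rewrite E; split.
Qed.

Section potential_term.
Variables (c : 'rV[R]_n -> R) (K : R).
Hypotheses (mc : measurable_fun U c) (cK : {ae mu, forall x, U x -> `|c x| <= K}).
Local Notation en := (energy_form omega U M c).

Lemma energyE w v : H1 w -> H1 v ->
  en w v = \sum_i ip (flux i w) (pd i v) + ip (fun x => c x * w x) v.
Proof.
move=> Hw Hv; have [i1 i2] := energy_flux Hw Hv.
have Lw : L2 w by case: Hw. have Lv : L2 v by case: Hv.
have [Lc _] := L2_mul_bounded mU mom om0 mc cK Lw.
rewrite -i2 /ip -RintegralD//; last exact: L2_ip_integrable.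
by apply: eq_Rintegral => x _; rewrite mulrDr.
Qed.

Lemma energy_linear a u v w : H1 u -> H1 v -> H1 w ->
  en (fun x => a * u x + v x) w = a * en u w + en v w.
Proof.
move=> Hu Hv Hw; have Huv := H1_lin oU mom om0 om_loc a Hu Hv.
have Lu : L2 u by case: Hu. have Lv : L2 v by case: Hv. have Lw : L2 w by case: Hw.
have [Lcu _] := L2_mul_bounded mU mom om0 mc cK Lu.
have [Lcv _] := L2_mul_bounded mU mom om0 mc cK Lv.
rewrite !energyE// mulrDr addrACA; congr (_ + _).
  rewrite mulr_sumr -big_split/=; apply: eq_bigr => i _.
  have Lfu := (L2_flux i Hu).1; have Lfv := (L2_flux i Hv).1; have Lpw := L2_pd i Hw.
  rewrite -(sip_linear sipL2)//.
  exact: (ip_ae mU mom (L2_flux i Huv).1 (L2_lin mU mom om0 a Lfu Lfv) Lpw (flux_lin i a Hu Hv)).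
rewrite -(sip_linear sipL2)//; apply: eq_Rintegral => x _; ring.
Qed.

(** One factor [n] counts the components of the flux, the other the entries in a row of [M]. *)
Lemma energy_bounded w v : H1 w -> H1 v -> `|en w v| <=
  n%:R * (n%:R * `|B|) * (snorm gip w * snorm gip v) + `|K| * (snorm ip w * snorm ip v).
Proof.
move=> Hw Hv; have Lw : L2 w by case: Hw. have Lv : L2 v by case: Hv.
have [Lc hc] := L2_mul_bounded mU mom om0 mc cK Lw.
rewrite energyE//; apply: (le_trans (ler_normD _ _)); apply: lerD.
  apply: (le_trans (ler_norm_sum _ _ _)).
  apply: (@le_trans _ _ (\sum_(i < n) (n%:R * `|B|) * (snorm gip w * snorm gip v))).
    apply: ler_sum => i _; have [Lf hf] := L2_flux i Hw; have Lp := L2_pd i Hv.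
    apply: (le_trans (snorm_CS sipL2 Lf Lp)); rewrite mulrA.
    apply: ler_pM; rewrite ?snorm_ge0//.
    exact: (pd_snorm_le oU mom om0).
  by rewrite sumr_const card_ord -[leLHS]mulr_natl mulrA.
apply: (le_trans (snorm_CS sipL2 Lc Lv)); rewrite mulrA.
by rewrite ler_wpM2r ?snorm_ge0.
Qed.

Lemma energy_sym w v : (forall x, U x -> (M x)^T = M x) -> en w v = en v w.
Proof.
move=> Ms; apply: eq_Rintegral => x; rewrite inE => Ux.
by rewrite (dot_mul_sym _ _ (Ms x Ux)) [c x * w x * v x]mulrAC.
Qed.

(** The potential term is nonnegative and is dropped, so [kappa] depends on the matrix alone; this
    is the source of uniformity in q. *)
Lemma energy_coercive w kappa : H1 w ->
  (forall x, U x -> forall xi : 'rV[R]_n, kappa * dot xi xi <= dot xi (xi *m (M x)^T)) ->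
  {ae mu, forall x, U x -> 0 <= c x} -> kappa * gip w w <= en w w.
Proof.
move=> Hw hM c0; have Lw : L2 w by case: Hw.
have [Lc _] := L2_mul_bounded mU mom om0 mc cK Lw.
have [i1 i2] := energy_flux Hw Hw.
have cp : 0 <= ip (fun x => c x * w x) w.
  have mnc : measurable_fun U (fun x => `|c x|) by apply: measurableT_comp.
  have nK : {ae mu, forall x, U x -> `| `|c x| | <= K}.
    by apply: filterS cK => x h Ux; rewrite normr_id; exact: h.
  have [Lnc _] := L2_mul_bounded mU mom om0 mnc nK Lw.
  (* The sign of [c] is known only almost everywhere; replacing [c] by its absolute value gives a
     pointwise nonnegative integrand. *)
  have -> : ip (fun x => c x * w x) w = ip (fun x => `|c x| * w x) w.
    apply: (ip_ae mU mom Lc Lnc Lw); apply: filterS c0 => x h Ux.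
    by rewrite ger0_norm//; exact: h.
  apply: Rintegral_ge0 => x Ux; rewrite -mulrA -expr2.
  by rewrite mulr_ge0 ?(ltW (om0 Ux))// mulr_ge0// sqr_ge0.
rewrite energyE//; apply: (@le_trans _ _ (\sum_i ip (flux i w) (pd i w))); last by rewrite lerDl.
rewrite -i2.
have [j1 j2] := Rintegral_sum oU (index_enum _) (fun i => L2_ip_integrable mU mom om0 (L2_pd i Hw) (L2_pd i Hw)).
rewrite /gip -j2 -RintegralZl//; apply: le_Rintegral => //.
  exact: (integrableZl mU kappa j1).
move=> x Ux; rewrite -mulr_sumr mulrCA ler_wpM2l ?(ltW (om0 Ux))//.
by apply: le_trans (hM x Ux (grad omega U w x)); rewrite dot_sum; under [X in _ <= _ * X]eq_bigr do rewrite !gradE.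
Qed.

End potential_term.

End energy.

(** * Differentiation of the solution of a coercive problem *)

Section coercive_family.
Variables (R : realType) (T X : Type).

(* [a q] is the energy form of the potential [q], [beta h] its variation in the direction [h]. *)
Record coercive_family (V : set (T -> R)) (g : (T -> R) -> (T -> R) -> R)
    (a beta : (X -> R) -> (T -> R) -> (T -> R) -> R) (Q LI : set (X -> R))
    (ninf : (X -> R) -> R) (kappa Ca c : R) : Prop := CoerciveFamily {
  cf_sip : semi_ip V g;
  cf_complete : scomplete V g;
  cf_kappa : 0 < kappa;
  cf_c : 0 <= c;
  cf_a_sip : forall q, Q q -> semi_ip V (a q);
  cf_a_coercive : forall q w, Q q -> V w -> kappa * g w w <= a q w w;
  cf_a_bounded : forall q w v, Q q -> V w -> V v -> `|a q w v| <= Ca * (snorm g w * snorm g v);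
  cf_a_add : forall q h w v, Q q -> LI h -> Q (q \+ h) -> V w -> V v ->
    a (q \+ h) w v = a q w v + beta h w v;
  cf_beta_lin_h : forall t h k w v, LI h -> LI k -> V w -> V v ->
    beta (fun x => t * h x + k x) w v = t * beta h w v + beta k w v;
  cf_beta_lin_l : forall h w w' v, LI h -> V w -> V w' -> V v ->
    beta h (w \- w') v = beta h w v - beta h w' v;
  cf_beta_lin_r : forall t h w u v, LI h -> V w -> V u -> V v ->
    beta h w (fun x => t * u x + v x) = t * beta h w u + beta h w v;
  cf_beta_bounded : forall h w v, LI h -> V w -> V v ->
    `|beta h w v| <= c * ninf h * snorm g w * snorm g v;
  cf_ninf_ge0 : forall h, 0 <= ninf h;
  cf_LI0 : LI (fun=> 0);
  cf_LI_scale : forall t h, LI h -> LI (fun x => t * h x);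
  cf_ninf_scale : forall t h, 0 <= t -> LI h -> ninf (fun x => t * h x) <= t * ninf h }.

Variables (V : set (T -> R)) (g : (T -> R) -> (T -> R) -> R).
Variables (a beta : (X -> R) -> (T -> R) -> (T -> R) -> R) (Q LI : set (X -> R)).
Variables (ninf : (X -> R) -> R) (kappa Ca c : R).
Local Notation nm := (snorm g).
Hypothesis F : coercive_family V g a beta Q LI ninf kappa Ca c.
Let Vg := cf_sip F.
Let Vcomplete := cf_complete F.
Let kappa0 := cf_kappa F.
Let c0 := cf_c F.
Let a_sip := cf_a_sip F.
Let a_coercive := cf_a_coercive F.
Let a_bounded := cf_a_bounded F.
Let a_add := cf_a_add F.
Let beta_lin_h := cf_beta_lin_h F.
Let beta_lin_l := cf_beta_lin_l F.
Let beta_lin_r := cf_beta_lin_r F.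
Let beta_bounded := cf_beta_bounded F.
Let ninf_ge0 := cf_ninf_ge0 F.
Let LI0 := cf_LI0 F.
Let LI_scale := cf_LI_scale F.
Let ninf_scale := cf_ninf_scale F.

(** Testing the equation with [w] itself. The bounds for the solution, its increments, the
    linearized solution, the remainder and uniqueness are all instances, each with its own [l]. *)
Lemma energy_estimate q w (l : (T -> R) -> R) m : Q q -> V w -> 0 <= m ->
  (forall v, V v -> a q w v = l v) -> (forall v, V v -> `|l v| <= m * nm v) -> nm w <= m / kappa.
Proof.
move=> Qq Vw m0 hw hl.
have h : kappa * nm w ^+ 2 <= m * nm w.
  rewrite (snorm_sqr Vg)//; apply: (le_trans (a_coercive Qq Vw)).
  by rewrite hw//; apply: le_trans (hl _ Vw); exact: ler_norm.
rewrite ler_pdivlMr// mulrC; have [->|w0] := eqVneq (nm w) 0; first by rewrite mulr0.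
have wp : 0 < nm w by rewrite lt_def w0 snorm_ge0.
by rewrite -(ler_pM2r wp) -mulrA -expr2.
Qed.

(** The form [a q] is symmetric, so Riesz representation for [a q] is enough; completeness passes
    from [g] to [a q] because the two norms are equivalent. *)
Lemma lax_milgram q (l : (T -> R) -> R) m : Q q ->
  (forall t u v, V u -> V v -> l (fun x => t * u x + v x) = t * l u + l v) ->
  (forall v, V v -> `|l v| <= m * nm v) ->
  exists2 u, V u & forall v, V v -> a q u v = l v.
Proof.
move=> Qq llin lbd; have Va := a_sip Qq.
have sk0 : 0 < Num.sqrt kappa by rewrite sqrtr_gt0.
have lower v : V v -> Num.sqrt kappa * nm v <= snorm (a q) v.
  move=> Vv; rewrite /snorm -sqrtrM ?(ltW kappa0)// ler_wsqrtr//; exact: a_coercive.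
have upper v : V v -> snorm (a q) v <= Num.sqrt `|Ca| * nm v.
  move=> Vv; rewrite /snorm -sqrtrM// ler_wsqrtr//.
  apply: (le_trans (ler_norm _)); apply: (le_trans (a_bounded Qq Vv Vv)).
  by rewrite -expr2 (snorm_sqr Vg)// ler_wpM2r ?(sip_ge0 Vg)// ler_norm.
apply: (riesz_representation (M := `|m| / Num.sqrt kappa) Va _ llin).
- move=> u Vu cu; have [|v Vv hv] := Vcomplete Vu.
    move=> e e0; have [N NP] := cu _ (mulr_gt0 sk0 e0); exists N => j k Nj Nk.
    rewrite -(ler_pM2l sk0); apply: le_trans (NP j k Nj Nk).
    by apply: lower; exact: (sipB Vg).
  exists v => // e e0.
  (* The 1 avoids dividing by zero when [Ca] is 0. *)
  have s1 : 0 < Num.sqrt `|Ca| + 1 by rewrite ltr_wpDl ?sqrtr_ge0.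
  have [N NP] := hv _ (divr_gt0 e0 s1); exists N => k Nk.
  apply: (le_trans (upper _ (sipB Vg (Vu k) Vv))).
  apply: (@le_trans _ _ ((Num.sqrt `|Ca| + 1) * (e / (Num.sqrt `|Ca| + 1)))).
    apply: ler_pM; rewrite ?sqrtr_ge0 ?snorm_ge0 ?lerDl//; exact: NP.
  by rewrite mulrCA divff ?mulr1// gt_eqF.
- move=> v Vv; apply: (le_trans (lbd _ Vv)).
  rewrite -mulrA; apply: (@le_trans _ _ (`|m| * nm v)).
    by rewrite ler_wpM2r ?snorm_ge0// ler_norm.
  by rewrite ler_wpM2l// ler_pdivlMl//; exact: lower.
Qed.

Variables (E : (X -> R) -> T -> R) (lf : (T -> R) -> R) (m : R).
Record solution_map : Prop := SolutionMap {
  sm_m : 0 <= m;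
  sm_V : forall q, Q q -> V (E q);
  sm_eq : forall q v, Q q -> V v -> a q (E q) v = lf v;
  sm_bounded : forall v, V v -> `|lf v| <= m * nm v }.

Hypothesis S : solution_map.
Let m0 := sm_m S.
Let VE := sm_V S.
Let hE := sm_eq S.
Let lf_bounded := sm_bounded S.

Lemma solution_bound q : Q q -> nm (E q) <= m / kappa.
Proof.
by move=> Qq; apply: (energy_estimate Qq (VE Qq) m0 _ lf_bounded) => v Vv; exact: hE.
Qed.

Lemma solution_lipschitz q h : Q q -> LI h -> Q (q \+ h) ->
  nm (E (q \+ h) \- E q) <= c * ninf h * (m / kappa) / kappa.
Proof.
move=> Qq Lh Qqh.
apply: (energy_estimate (l := fun v => - beta h (E (q \+ h)) v) Qq).
- by apply: (sipB Vg); exact: VE.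
- by rewrite !mulr_ge0// ?invr_ge0 ltW.
- move=> v Vv; rewrite (sip_linearB (a_sip Qq) (VE Qqh) (VE Qq) Vv) (hE Qq Vv).
  by have := a_add Qq Lh Qqh (VE Qqh) Vv; rewrite (hE Qqh Vv) => ->; ring.
- move=> v Vv; rewrite normrN; apply: (le_trans (beta_bounded Lh (VE Qqh) Vv)).
  rewrite ler_wpM2r ?snorm_ge0// ler_wpM2l ?mulr_ge0//; exact: solution_bound.
Qed.

Definition lin_sol q h psi := V psi /\ forall v, V v -> a q psi v = - beta h (E q) v.

Lemma lin_sol_exists q h : Q q -> LI h -> exists psi, lin_sol q h psi.
Proof.
move=> Qq Lh; have [|v Vv|u Vu hu] := @lax_milgram q (fun v => - beta h (E q) v) (c * ninf h * nm (E q)) Qq.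
- by move=> t u v Vu Vv; rewrite (beta_lin_r t Lh (VE Qq) Vu Vv); ring.
- by rewrite normrN; exact: beta_bounded (VE Qq) Vv.
- by exists u.
Qed.

Lemma lin_sol_bound q h psi : Q q -> LI h -> lin_sol q h psi ->
  nm psi <= c * ninf h * (m / kappa) / kappa.
Proof.
move=> Qq Lh [Vp hp]; apply: (energy_estimate Qq Vp _ hp).
- by rewrite !mulr_ge0// ?invr_ge0 ltW.
- move=> v Vv; rewrite normrN; apply: (le_trans (beta_bounded Lh (VE Qq) Vv)).
  rewrite ler_wpM2r ?snorm_ge0// ler_wpM2l ?mulr_ge0//; exact: solution_bound.
Qed.

Lemma lin_sol_remainder q h psi : Q q -> LI h -> Q (q \+ h) -> lin_sol q h psi ->
  nm (fun x => E (q \+ h) x - E q x - psi x) <=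
    (c / kappa) ^+ 2 * (m / kappa) * ninf h * ninf h.
Proof.
move=> Qq Lh Qqh [Vp hp].
have Vd : V (E (q \+ h) \- E q) by apply: (sipB Vg); exact: VE.
have -> : (c / kappa) ^+ 2 * (m / kappa) * ninf h * ninf h =
    c * ninf h * (c * ninf h * (m / kappa) / kappa) / kappa by ring.
apply: (energy_estimate (l := fun v => - beta h (E (q \+ h) \- E q) v) Qq).
- exact: (sipB Vg Vd Vp).
- by rewrite !mulr_ge0// ?invr_ge0 ltW.
- move=> v Vv.
  rewrite (sip_linearB (a_sip Qq) Vd Vp Vv) (sip_linearB (a_sip Qq) (VE Qqh) (VE Qq) Vv) hp// (hE Qq Vv).
  have := a_add Qq Lh Qqh (VE Qqh) Vv; rewrite (hE Qqh Vv) => ->.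
  by rewrite (beta_lin_l Lh (VE Qqh) (VE Qq) Vv); ring.
- move=> v Vv; rewrite normrN; apply: (le_trans (beta_bounded Lh Vd Vv)).
  rewrite ler_wpM2r ?snorm_ge0// ler_wpM2l ?mulr_ge0//; exact: solution_lipschitz.
Qed.

Lemma lin_sol_lin q t h k psi chi : Q q -> LI h -> LI k -> lin_sol q h psi -> lin_sol q k chi ->
  lin_sol q (fun x => t * h x + k x) (fun x => t * psi x + chi x).
Proof.
move=> Qq Lh Lk [Vp hp] [Vc hc]; split; first exact: (sip_lin Vg).
by move=> v Vv; rewrite (sip_linear (a_sip Qq))// hp// hc// (beta_lin_h t Lh Lk (VE Qq) Vv); ring.
Qed.

Lemma lin_sol_uniq q h psi chi : Q q -> lin_sol q h psi -> lin_sol q h chi -> nm (psi \- chi) = 0.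
Proof.
move=> Qq [Vp hp] [Vc hc]; apply/eqP; rewrite eq_le snorm_ge0 andbT.
rewrite -(mul0r kappa^-1); apply: (energy_estimate (l := fun=> 0) Qq (sipB Vg Vp Vc)) => //.
- by move=> v Vv; rewrite (sip_linearB (a_sip Qq))// hp// hc// subrr.
- by move=> v Vv; rewrite normr0 mul0r.
Qed.

(** Boundedness of [a q] makes the equation insensitive to changes of norm zero, which is as
    precisely as a derivative can be identified. *)
Lemma lin_sol_eq0 q h psi chi : Q q -> lin_sol q h psi -> V chi -> nm (chi \- psi) = 0 -> lin_sol q h chi.
Proof.
move=> Qq [Vp hp] Vc h0; split => // v Vv; rewrite -hp//.
apply/eqP; rewrite -subr_eq0 -(sip_linearB (a_sip Qq))// -normr_le0.
by apply: (le_trans (a_bounded Qq (sipB Vg Vc Vp) Vv)); rewrite h0 mul0r mulr0.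
Qed.

(* Directions [h] along which [q + t h] stays admissible for small positive [t] determine
   the derivative, and they span all directions. *)
Hypothesis directions : forall q h, Q q -> LI h -> exists h1 h2, [/\ LI h1, LI h2,
  h = (fun x => - 1 * h2 x + h1 x),
  exists2 t0, 0 < t0 & forall t, 0 < t -> t <= t0 -> Q (q \+ (fun x => t * h1 x)) &
  exists2 t0, 0 < t0 & forall t, 0 < t -> t <= t0 -> Q (q \+ (fun x => t * h2 x))].

Variables (q : X -> R) (D : (X -> R) -> T -> R).
Hypothesis Qq : Q q.
Hypothesis VD : forall h, LI h -> V (D h).
Hypothesis D_lin : forall t h k, LI h -> LI k ->
  nm (D (fun x => t * h x + k x) \- (fun x => t * D h x + D k x)) = 0.
Hypothesis D_frechet : forall e, 0 < e -> exists2 delta, 0 < delta & forall h, LI h -> Q (q \+ h) ->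
  ninf h <= delta -> nm (fun x => E (q \+ h) x - E q x - D h x) <= e * ninf h.

Lemma snorm_eq0_trans u v w : V u -> V v -> V w -> nm (u \- v) = 0 -> nm (v \- w) = 0 -> nm (u \- w) = 0.
Proof.
move=> Vu Vv Vw h1 h2; apply/eqP; rewrite eq_le snorm_ge0 andbT.
have := snormD Vg (sipB Vg Vu Vv) (sipB Vg Vv Vw); rewrite h1 h2 addr0.
by rewrite (_ : (fun _ => _) = u \- w)//; apply/funext => x /=; ring.
Qed.

(** Linearity of [D] holds up to norm zero. Applied to 1 * 0 + 0 it leaves - D 0, so D 0 has norm
    zero, and homogeneity is linearity with second increment 0. *)
Lemma derivative_scale t h : LI h -> nm (D (fun x => t * h x) \- (fun x => t * D h x)) = 0.
Proof.
move=> Lh; have V0 : V (D (fun=> 0)) by exact: VD.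
have D0 : nm (D (fun=> 0)) = 0.
  have := D_lin 1 LI0 LI0.
  rewrite (_ : (fun x : X => 1 * 0 + 0) = fun=> 0); last by apply/funext => x; rewrite mulr0 addr0.
  rewrite (_ : _ \- _ = fun x => -1 * D (fun=> 0) x); last by apply/funext => x /=; ring.
  by rewrite (snormZ Vg)// normrN normr1 mul1r.
have := D_lin t Lh LI0.
rewrite (_ : (fun x : X => t * h x + 0) = fun x => t * h x); last by apply/funext => x; rewrite addr0.
move=> h1; have Vth : V (D (fun x => t * h x)) by apply: VD; exact: LI_scale.
apply: snorm_eq0_trans h1 _ => //.
- by apply: (sip_lin Vg) => //; exact: VD.
- by apply: (sipZ Vg); exact: VD.
- by rewrite (_ : _ \- _ = D (fun=> 0))//; apply/funext => x /=; ring.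
Qed.

(** Both t (D h) and t psi approximate E (q + t h) - E q with error o(t) along admissible t > 0, so
    t times the norm of their difference is o(t); dividing by t leaves an arbitrarily small
    bound. *)
Lemma derivative_admissible h psi t0 : LI h -> 0 < t0 ->
  (forall t, 0 < t -> t <= t0 -> Q (q \+ (fun x => t * h x))) ->
  lin_sol q h psi -> nm (D h \- psi) = 0.
Proof.
move=> Lh t00 ht0 sp; have [Vp _] := sp; have Vh := VD Lh.
apply/eqP; rewrite eq_le snorm_ge0 andbT; apply/ler_addgt0Pl => e e0; rewrite addr0.
(* Chosen so that the final bound 2 e' t (ninf h + 1) equals t e; using ninf h + 1 covers directions
   of norm 0. *)
pose e' := e / (2 * (ninf h + 1)).
have n1 : 0 < ninf h + 1 by rewrite ltr_wpDl.
have e'0 : 0 < e' by rewrite divr_gt0// mulr_gt0.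
have [delta d0 hd] := D_frechet e'0.
pose C := (c / kappa) ^+ 2 * (m / kappa).
have C0 : 0 <= C by rewrite !mulr_ge0 ?sqr_ge0 ?invr_ge0 ?(ltW kappa0).
(* The three terms keep q + t h admissible, the increment below [delta], and the quadratic remainder
   of the linearized solution below e' times t (ninf h + 1). *)
pose t := Num.min t0 (Num.min (delta / (ninf h + 1)) (e' / ((C + 1) * (ninf h + 1)))).
have C1 : 0 < C + 1 by rewrite ltr_wpDl.
have tp : 0 < t by rewrite !lt_min t00 !divr_gt0// mulr_gt0.
have tt0 : t <= t0 by rewrite ge_min lexx.
have td : t * (ninf h + 1) <= delta.
  by rewrite -ler_pdivlMr// !ge_min lexx !orbT.
have te : C * (t * (ninf h + 1)) <= e'.
  apply: (@le_trans _ _ ((C + 1) * (t * (ninf h + 1)))).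
    by rewrite ler_wpM2r ?mulr_ge0 ?(ltW tp) ?(ltW n1)// lerDl.
  rewrite mulrCA -ler_pdivlMr ?mulr_gt0// !ge_min lexx !orbT //.
have Lth := LI_scale t Lh; have Qth := ht0 t tp tt0.
have nth : ninf (fun x => t * h x) <= t * (ninf h + 1).
  by apply: (le_trans (ninf_scale (ltW tp) Lh)); rewrite ler_wpM2l ?(ltW tp)// lerDl.
have h1 := hd _ Lth Qth (le_trans nth td).
have sth : lin_sol q (fun x => t * h x) (fun x => t * psi x).
  split; first exact: (sipZ Vg).
  case: sp => _ hp v Vv; rewrite (sip_linearZ (a_sip Qq))// hp//.
  have b0 : beta (fun=> 0) (E q) v = 0.
    have := beta_lin_h 1 LI0 LI0 (VE Qq) Vv.
    rewrite (_ : (fun x : X => 1 * 0 + 0) = fun=> 0); last by apply/funext => x; rewrite mulr0 addr0.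
    by lra.
  have := beta_lin_h t Lh LI0 (VE Qq) Vv; rewrite b0 addr0.
  rewrite (_ : (fun x : X => t * h x + 0) = fun x => t * h x); last by apply/funext => x; rewrite addr0.
  by move=> ->; rewrite mulrN.
have h2 := lin_sol_remainder Qq Lth Qth sth; rewrite -/C in h2.
have Vd : V (E (q \+ (fun x => t * h x)) \- E q) by apply: (sipB Vg); exact: VE.
have VDth := VD Lth; have Vtp := sipZ Vg t Vp.
have h3 : nm (D (fun x => t * h x) \- (fun x => t * psi x)) <= 2 * e' * (t * (ninf h + 1)).
  have := snormB Vg (sipB Vg Vd Vtp) (sipB Vg Vd VDth).
  rewrite (_ : _ \- _ = D (fun x => t * h x) \- (fun x => t * psi x)); last by apply/funext => x /=; ring.
  move=> /le_trans; apply.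
  have -> : 2 * e' * (t * (ninf h + 1)) = e' * (t * (ninf h + 1)) + e' * (t * (ninf h + 1)) by ring.
  have X0 : 0 <= t * (ninf h + 1) by rewrite mulr_ge0 ?(ltW tp) ?(ltW n1).
  apply: lerD; last by apply: (le_trans h1); rewrite ler_wpM2l ?(ltW e'0).
  apply: (le_trans h2); apply: (@le_trans _ _ (C * (t * (ninf h + 1)) * (t * (ninf h + 1)))).
    by apply: ler_pM => //; [exact: mulr_ge0|apply: ler_wpM2l].
  by rewrite ler_wpM2r.
have h4 : nm (fun x => t * (D h \- psi) x) <= 2 * e' * (t * (ninf h + 1)).
  apply: le_trans h3.
  have VtD := sipZ Vg t Vh.
  have := snormD Vg (sipB Vg VDth Vtp) (sipB Vg VtD VDth).
  rewrite (snorm_sub Vg VtD VDth) derivative_scale// addr0; apply: le_trans.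
  by rewrite le_eqVlt; apply/orP; left; apply/eqP; congr snorm; apply/funext => x /=; ring.
move: h4; rewrite (snormZ Vg t (sipB Vg Vh Vp)) (gtr0_norm tp) => h4.
rewrite -(ler_pM2l tp); apply: (le_trans h4).
by rewrite /e' le_eqVlt; apply/orP; left; apply/eqP; field; rewrite gt_eqF.
Qed.

Lemma derivative_uniq h psi : LI h -> lin_sol q h psi -> nm (D h \- psi) = 0.
Proof.
move=> Lh sp; have [h1 [h2 [L1 L2 hE' [t1 t10 ht1] [t2 t20 ht2]]]] := directions Qq Lh.
have [p1 s1] := lin_sol_exists Qq L1; have [p2 s2] := lin_sol_exists Qq L2.
have d1 := derivative_admissible L1 t10 ht1 s1; have d2 := derivative_admissible L2 t20 ht2 s2.
have Vh := VD Lh; have V1 := VD L1; have V2 := VD L2.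
have [Vp _] := sp; have [Vp1 _] := s1; have [Vp2 _] := s2.
have s12 := lin_sol_lin (- 1) Qq L2 L1 s2 s1; rewrite -hE' in s12.
have Dl := D_lin (- 1) L2 L1; rewrite -hE' in Dl.
have VD12 := sip_lin Vg (- 1) V2 V1; have Vp12 := sip_lin Vg (- 1) Vp2 Vp1.
apply: (snorm_eq0_trans Vh VD12 Vp Dl); apply: (snorm_eq0_trans VD12 Vp12 Vp).
  apply/eqP; rewrite eq_le snorm_ge0 andbT.
  have := snormB Vg (sipB Vg V1 Vp1) (sipB Vg V2 Vp2); rewrite d1 d2 addr0.
  apply: le_trans; rewrite le_eqVlt; apply/orP; left; apply/eqP; congr snorm.
  by apply/funext => x /=; ring.
exact: (lin_sol_uniq Qq s12 sp).
Qed.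

End coercive_family.

(** * Coefficients, directions and dual norms *)

Section coefficient_matrix.
Variables (R : realType) (d : nat) (Omega : set 'rV[R]_d) (A : 'rV[R]_d -> 'M[R]_d).
Hypotheses (hOmega : open_convex_polytope Omega) (hA : coefficient Omega A).
Local Notation U := (cylinder Omega).

Definition ext_matrix (x : 'rV[R]_(d + 1)) : 'M[R]_(d + 1) := block_mx (A (base_pt x)) 0 0 1%:M.

Lemma coefficient_lipschitz : exists2 k, 0 < k &
  forall x y, Omega x -> Omega y -> `|A x - A y| <= k * `|x - y|.
Proof.
case: hA => -[M [Mr MP]] _ _ _; exists (`|M| + 1); first by rewrite ltr_wpDl.
move=> x y Ox Oy; apply: (MP (`|M| + 1) _ (x, y)) => //.
by rewrite (le_lt_trans (ler_norm M))// ltrDl.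
Qed.

Lemma coefficient_measurable i j : measurable_fun Omega (fun x => A x i j).
Proof.
have oO := open_convex_polytope_open hOmega.
have [k k0 kP] := coefficient_lipschitz.
apply: open_continuous_rV_measurable => // x; rewrite inE => Ox.
move=> W /nbhs_ballP[e /= e0 eW].
have ek : 0 < e / k by rewrite divr_gt0.
have hn : nbhs x [set y | Omega y /\ `|x - y| < e / k].
  apply: filterI; first exact: (open_nbhs_nbhs (conj oO Ox)).
  by apply/nbhs_ballP; exists (e / k) => //= y; rewrite mx_norm_ball.
apply: (@filterS _ _ (nbhs_filter x) _ _ _ hn) => y [Oy xy]; apply: eW.
rewrite /ball/=; have -> : A x i j - A y i j = (A x - A y) i j by rewrite !mxE.
apply: (le_lt_trans (norm_coord_le _ _ _)); apply: (le_lt_trans (kP _ _ Ox Oy)).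
by rewrite mulrC -ltr_pdivlMr.
Qed.

Lemma coefficient_bounded : exists2 B, 0 <= B & forall x, Omega x -> forall i j, `|A x i j| <= B.
Proof.
have [k k0 kP] := coefficient_lipschitz.
have [[x0 Ox0] /bounded_coord[L L0 LP] _] := hOmega.
exists (`|A x0| + k * (L + L)); first by rewrite addr_ge0// mulr_ge0 ?(ltW k0)// addr_ge0.
move=> x Ox i j; apply: (le_trans (norm_coord_le _ _ _)).
have -> : A x = A x0 + (A x - A x0) by rewrite addrC subrK.
apply: (le_trans (ler_normD _ _)); rewrite lerD2l.
apply: (le_trans (kP _ _ Ox Ox0)); rewrite ler_wpM2l ?(ltW k0)//.
by apply: (le_trans (ler_normB _ _)); rewrite lerD// LP.
Qed.

Lemma ext_matrix_measurable i j : measurable_fun U (fun x => ext_matrix x i j).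
Proof.
rewrite /ext_matrix; case: (split_ordP i) => i' ->; case: (split_ordP j) => j' ->.
- under eq_fun do rewrite block_mxEul.
  exact: (measurable_base hOmega (coefficient_measurable i' j')).
- by under eq_fun do rewrite block_mxEur mxE; exact: measurable_cst.
- by under eq_fun do rewrite block_mxEdl mxE; exact: measurable_cst.
- by under eq_fun do rewrite block_mxEdr; exact: measurable_cst.
Qed.

Lemma ext_matrix_bounded : exists B, forall x, U x -> forall i j, `|ext_matrix x i j| <= B.
Proof.
have [B B0 BP] := coefficient_bounded; exists (B + 1) => x [Ox _] i j.
have B1 : 0 <= B + 1 by rewrite addr_ge0.
rewrite /ext_matrix; case: (split_ordP i) => i' ->; case: (split_ordP j) => j' ->.
- by rewrite block_mxEul (le_trans (BP _ Ox _ _))// lerDl.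
- by rewrite block_mxEur mxE normr0.
- by rewrite block_mxEdl mxE normr0.
- by rewrite block_mxEdr mxE; case: (_ == _); rewrite ?normr1 ?normr0 ?lerDr.
Qed.

Lemma ext_matrix_sym x : U x -> (ext_matrix x)^T = ext_matrix x.
Proof.
move=> [Ox _]; case: hA => _ _ As _.
by rewrite /ext_matrix tr_block_mx As// !trmx0 trmx1.
Qed.

Lemma ext_matrix_coercive : exists2 kappa, 0 < kappa & forall x, U x -> forall xi : 'rV[R]_(d + 1),
  kappa * dot xi xi <= dot xi (xi *m (ext_matrix x)^T).
Proof.
(* The matrix is block diagonal: [c] is the constant of [A], and 1 that of the vertical
   direction. *)
case: hA => _ _ As [c c0 cP]; exists (Num.min c 1); first by rewrite lt_min c0 ltr01.
move=> x Ux xi; rewrite ext_matrix_sym//; case: Ux => Ox _.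
have dotE (a b : 'rV[R]_(d + 1)) : dot a b = dot (lsubmx a) (lsubmx b) + dot (rsubmx a) (rsubmx b).
  by rewrite /dot -{1}(hsubmxK a) -{1}(hsubmxK b) tr_row_mx mul_row_col mxE.
have -> : xi *m ext_matrix x = row_mx (lsubmx xi *m A (base_pt x)) (rsubmx xi).
  by rewrite /ext_matrix -{1}(hsubmxK xi) mul_row_block !mulmx0 add0r addr0 mulmx1.
rewrite !dotE row_mxKl row_mxKr.
rewrite mulrDr; apply: lerD.
  have := cP _ Ox (lsubmx xi); rewrite As//; apply: le_trans.
  rewrite ler_wpM2r ?ge_min ?lexx// dot_sum; apply: sumr_ge0 => i _.
  by rewrite -expr2 sqr_ge0.
rewrite ler_piMl ?ge_min ?lexx ?orbT// dot_sum; apply: sumr_ge0 => i _.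
by rewrite -expr2 sqr_ge0.
Qed.

End coefficient_matrix.

(** * Essentially bounded functions *)

Section Linfty_theory.
Variables (R : realType) (n : nat) (U : set 'rV[R]_n).
Hypothesis mU : measurable U.
Local Notation mu := (@lebesgue_rV R n).

Lemma Linfty_ae (h : 'rV[R]_n -> R) : Linfty U h -> {ae mu, forall x, U x -> `|h x| <= Linfty_norm U h}.
Proof.
move=> [mh]; rewrite /Linfty_norm unlock /=; case: ifPn => [m0|m0] hy.
  have hs : (0 <= ess_sup mu (abse \o (EFin \o h \_ U)) :> \bar R)%E.
    by apply: ess_sup_gee => //; apply: aeW => t; exact: abse_ge0.
  apply: filterS (ess_sup_ge mu (abse \o (EFin \o h \_ U))) => x + Ux.
  rewrite /= patchE mem_set//= => hx.
  by rewrite -lee_fin fineK// ge0_fin_numE.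
(* When the whole space is null the norm is 0 by convention, and any property holds almost
   everywhere. *)
have m00 : mu setT = 0%E by apply/eqP; rewrite eq_le measure_ge0 andbT leNgt.
exists setT; split => //.
Qed.

Lemma Linfty_of_bounded (h : 'rV[R]_n -> R) (C : R) : measurable_fun U h -> 0 <= C ->
  {ae mu, forall x, U x -> `|h x| <= C} -> Linfty U h /\ Linfty_norm U h <= C.
Proof.
move=> mh C0 hC.
have le : ('N[mu]_+oo [EFin \o (h \_ U)] <= C%:E)%E.
  rewrite unlock /=; case: ifPn => [m0|_]; last by rewrite lee_fin.
  apply/ess_supP; apply: filterS hC => x hx /=; rewrite lee_fin patchE.
  by case: ifPn => [/set_mem/hx //|_]; rewrite normr0.
split; first by split => //; rewrite (le_lt_trans le)// ltry.
have fn : ('N[mu]_+oo [EFin \o (h \_ U)])%E \is a fin_num.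
  by rewrite ge0_fin_numE ?Lnorm_ge0// (le_lt_trans le)// ltry.
by rewrite /Linfty_norm -lee_fin fineK.
Qed.

Lemma Linfty_norm_ge0 h : 0 <= Linfty_norm U h.
Proof. by rewrite /Linfty_norm fine_ge0// Lnorm_ge0. Qed.

Lemma Linfty0 : Linfty U (fun=> 0 : R).
Proof.
apply: (@Linfty_of_bounded _ 0 _ _ _).1 => //.
by apply: aeW => x _; rewrite normr0.
Qed.

Lemma Linfty_scale t (h : 'rV[R]_n -> R) : Linfty U h -> Linfty U (fun x => t * h x) /\
  (0 <= t -> Linfty_norm U (fun x => t * h x) <= t * Linfty_norm U h).
Proof.
move=> Lh; have mth : measurable_fun U (fun x => t * h x) by apply: measurable_funM => //; case: Lh.
have hae := Linfty_ae Lh.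
have [] := @Linfty_of_bounded (fun x => t * h x) (`|t| * Linfty_norm U h) mth.
- by rewrite mulr_ge0// Linfty_norm_ge0.
- by apply: filterS hae => x hx Ux; rewrite normrM ler_wpM2l// hx.
by move=> L1 L2'; split => // t0; rewrite -{2}(ger0_norm t0).
Qed.

Lemma Linfty_lin t (h k : 'rV[R]_n -> R) : Linfty U h -> Linfty U k ->
  Linfty U (fun x => t * h x + k x).
Proof.
move=> Lh Lk; have hae := Linfty_ae Lh; have kae := Linfty_ae Lk.
apply: (@Linfty_of_bounded _ (`|t| * Linfty_norm U h + Linfty_norm U k) _ _ _).1.
- by apply: measurable_funD; [apply: measurable_funM => //; case: Lh|case: Lk].
- by rewrite addr_ge0 ?mulr_ge0 ?Linfty_norm_ge0.
- apply: filterS2 hae kae => x hx kx Ux; apply: (le_trans (ler_normD _ _)).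
  by rewrite normrM lerD ?ler_wpM2l ?hx ?kx.
Qed.

End Linfty_theory.

(** * The dual norm on the spectral spaces *)

Section spectral_dual.
Variables (R : realType) (d : nat) (Omega : set 'rV[R]_d) (r : R).
Variables (A : 'rV[R]_d -> 'M[R]_d) (q : 'rV[R]_d -> R).
Variables (lam : nat -> R) (phi : nat -> 'rV[R]_d -> R).
Hypotheses (oOmega : open Omega) (hphi : eigenpairs Omega A q lam phi).
Local Notation Hr := (Hr Omega r lam phi).
Local Notation Hr_norm := (Hr_norm Omega r lam phi).

Let mOmega : measurable Omega := open_rV_measurable oOmega.
Let sipL2 : semi_ip (L2 (cst 1) Omega) (ip Omega (cst 1)).
Proof. by apply: L2_semi_ip => //; exact: measurable_cst. Qed.

Lemma L2_dot_ip v w : L2_dot Omega v w = ip Omega (cst 1) v w.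
Proof. by apply: eq_Rintegral => x _; rewrite /= mul1r. Qed.

Lemma Hr_scale a v : Hr v -> Hr (fun x => a * v x) /\ Hr_norm (fun x => a * v x) = `|a| * Hr_norm v.
Proof.
move=> [Lv fv].
have Lphi k : L2 (cst 1) Omega (phi k) by case: hphi => /(_ k)[[[]]].
have E : Hr_sqnorm Omega r lam phi (fun x => a * v x) = ((a ^+ 2)%:E * Hr_sqnorm Omega r lam phi v)%E.
  rewrite -nneseriesZl; last by move=> k _; rewrite lee_fin mulr_ge0 ?powR_ge0 ?sqr_ge0.
  apply: eq_eseriesr => k _; rewrite !L2_dot_ip (sip_linearZ sipL2)// -EFinM; congr (_%:E); ring.
have s0 : (0 <= Hr_sqnorm Omega r lam phi v)%E.
  by apply: nneseries_ge0 => k _ _; rewrite lee_fin mulr_ge0 ?powR_ge0 ?sqr_ge0.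
split.
  split; first exact: (sipZ sipL2).
  by rewrite E lte_mul_pinfty// lee_fin sqr_ge0.
have fn : Hr_sqnorm Omega r lam phi v \is a fin_num by rewrite ge0_fin_numE.
by rewrite /Defs.Hr_norm E fineM// [fine (EFin _)]/= sqrtrM ?sqr_ge0// sqrtr_sqr.
Qed.

Lemma Hr0 : Hr (fun=> 0).
Proof.
split; first exact: (sip0 sipL2).
have Lphi k : L2 (cst 1) Omega (phi k) by case: hphi => /(_ k)[[[]]].
rewrite /Hr_sqnorm eseries0 ?ltry// => k _ _.
by rewrite L2_dot_ip (sip_zero sipL2)// expr0n mulr0.
Qed.

Variable f : ('rV[R]_d -> R) -> R.
Hypothesis hf : Hr_dual Omega r lam phi f.
Local Notation dual_norm := (Hr_dual_norm Omega r lam phi f).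

Let f0 : f (fun=> 0) = 0.
Proof.
have [/(_ 1 _ _ Hr0 Hr0) + _] := hf.
rewrite (_ : (fun _ => _) = fun=> 0); last by apply/funext => x; rewrite mulr0 addr0.
by lra.
Qed.

Let fZ a v : Hr v -> f (fun x => a * v x) = a * f v.
Proof.
move=> Hv; have [/(_ a _ _ Hv Hr0) + _] := hf; rewrite f0 addr0 => <-.
by congr f; apply/funext => x; rewrite addr0.
Qed.

Let dual_ub w : Hr w -> Hr_norm w <= 1 -> `|f w| <= dual_norm.
Proof.
move=> Hw w1; apply: ub_le_sup; last by exists w.
have [_ [M MP]] := hf; exists `|M| => _ [v [Hv v1] <-]; apply: (le_trans (MP _ Hv)).
apply: (@le_trans _ _ (`|M| * Hr_norm v)); first by rewrite ler_wpM2r ?sqrtr_ge0// ler_norm.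
by rewrite ler_piMr.
Qed.

Lemma Hr_dual_norm_ge0 : 0 <= dual_norm.
Proof.
apply: (le_trans (normr_ge0 (f (fun x => 0 * (fun=> 0) x)))).
have [H0 N0] := Hr_scale 0 Hr0; apply: dual_ub => //.
by rewrite N0 normr0 mul0r.
Qed.

(** Scaling to the unit ball works when the norm of [w] is nonzero; otherwise the bound assumed in
    [Hr_dual] already forces f w = 0. *)
Lemma Hr_dual_norm_bound w : Hr w -> `|f w| <= dual_norm * Hr_norm w.
Proof.
move=> Hw; have [w0|w0] := eqVneq (Hr_norm w) 0.
  by have [_ [M MP]] := hf; apply: (le_trans (MP _ Hw)); rewrite w0 !mulr0.
have wp : 0 < Hr_norm w by rewrite lt_def w0 sqrtr_ge0.
have [H1 N1] := Hr_scale (Hr_norm w)^-1 Hw.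
have := dual_ub H1; rewrite N1 fZ// normrM gtr0_norm ?invr_gt0// mulVf// => /(_ (lexx _)).
by rewrite ler_pdivrMl// mulrC.
Qed.

End spectral_dual.

(** The zero function is a weak derivative of [w], so by uniqueness the chosen one vanishes almost
    everywhere. This converts the almost everywhere linearity of a derivative into equality in
    norm. *)
Lemma snorm_gip_of_ae0 (R : realType) n (U : set 'rV[R]_n) (omega w : 'rV[R]_n -> R) :
  open U -> measurable_fun U omega -> (forall x, U x -> 0 < omega x) ->
  (forall K, compact K -> K `<=` U -> exists2 c, 0 < c & forall x, K x -> c <= omega x) ->
  H1 omega U w -> w = cst 0 %[ae lebesgue_rV in U] -> snorm (gip U omega) w = 0.
Proof.
move=> oU mom om0 om_loc Hw w0; have mU := open_rV_measurable oU.
have L0 := L2_0 U omega; have Lw : L2 omega U w by case: Hw.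
have sipL2 := L2_semi_ip mU mom om0.
have h i : ip U omega (pd U omega i w) (pd U omega i w) = 0.
  have [Lp wp] := pdP i Hw.
  have e : pd U omega i w = cst 0 %[ae lebesgue_rV in U].
    apply: (weak_partial_uniq oU mom om0 om_loc Lp L0 wp) => eta te.
    have mp : measurable_fun U (partial i eta).
      apply: measurable_funS measurableT (@subsetT _ U) _.
      by apply: continuous_rV_measurable; case: (test_function_partial i te) => /(_ [::])[].
    rewrite [RHS](_ : _ = 0); last first.
      by under eq_Rintegral do rewrite mul0r; rewrite /Rintegral integral0 oppr0.
    rewrite (@ae_eq_Rintegral _ _ _ mU _ (fun=> 0)) ?/Rintegral ?integral0//.
    - by apply: measurable_funM => //; case: Lw.
    - by apply: filterS w0 => x h Ux; rewrite h// mul0r.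
  by rewrite (ip_ae mU mom Lp L0 Lp e) (sip_zero sipL2).
by rewrite /snorm /gip big1 ?sqrtr0.
Qed.

(** * Admissible directions at a potential *)

Section potentials.
Variables (R : realType) (d : nat) (Omega : set 'rV[R]_d) (qbar : R).
Hypotheses (mOmega : measurable Omega) (hqbar : 0 < qbar).
Local Notation Q := (potential Omega qbar).
Local Notation LI := (Linfty Omega).

Let sg (q : 'rV[R]_d -> R) x : R := if q x < qbar / 2 then 1 else - 1.

Let sg_meas q : measurable_fun Omega q -> measurable_fun Omega (sg q).
Proof.
move=> mq; apply: measurable_fun_if => //.
exact: measurable_fun_ltr.
Qed.

(* Moving [q] towards [qbar / 2] stays admissible. *)
Let toward q p : Q q -> LI p -> (forall x, 0 <= p x) ->
  LI (fun x => sg q x * p x) /\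
  exists2 t0, 0 < t0 & forall t, 0 < t -> t <= t0 -> Q (q \+ (fun x => t * (sg q x * p x))).
Proof.
move=> Qq Lp p0; have [mq bq] := Qq; have [mp _] := Lp.
have ae := Linfty_ae Lp; set C := Linfty_norm Omega p in ae.
have C0 : 0 <= C by exact: Linfty_norm_ge0.
have mg : measurable_fun Omega (fun x => sg q x * p x) by apply: measurable_funM => //; exact: sg_meas.
split.
  apply: (Linfty_of_bounded mg C0 _).1; apply: filterS ae => x h Ux; apply: le_trans (h Ux).
  by rewrite normrM /sg; case: ifP; rewrite ?normrN normr1 mul1r.
have C1 : 0 < C + 1 by rewrite ltr_wpDl.
(* The displacement is then at most qbar / 2: upwards from values below qbar / 2, downwards from the
   others, hence inside [0, qbar]. *)
exists (qbar / 2 / (C + 1)); first by rewrite !divr_gt0.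
move=> t t0; rewrite ler_pdivlMr// => tC.
split; first by apply: measurable_funD => //; exact: measurable_funM.
apply: filterS2 bq ae => x hq hp Ux; have := hq Ux; have := hp Ux; rewrite ger0_norm// => pC /andP[q0 q1].
have h : t * p x <= qbar / 2 by apply: le_trans tC; rewrite ler_wpM2l ?(ltW t0)// (le_trans pC)// lerDl.
have h0 : 0 <= t * p x by rewrite mulr_ge0// ltW.
by rewrite /sg /=; case: ltP => hx; apply/andP; split; lra.
Qed.

Lemma potential_directions q h : Q q -> LI h -> exists h1 h2, [/\ LI h1, LI h2,
  h = (fun x => - 1 * h2 x + h1 x),
  exists2 t0, 0 < t0 & forall t, 0 < t -> t <= t0 -> Q (q \+ (fun x => t * h1 x)) &
  exists2 t0, 0 < t0 & forall t, 0 < t -> t <= t0 -> Q (q \+ (fun x => t * h2 x))].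
Proof.
move=> Qq Lh; have [mq _] := Qq; have [mh _] := Lh.
have ae := Linfty_ae Lh; have C0 := Linfty_norm_ge0 Omega h.
(* The signs 1 and -1 select the positive and the negative part of [sg q * h]. *)
have part e : `|e| = 1 -> LI (fun x => Num.max (e * (sg q x * h x)) 0).
  move=> e1; apply: (Linfty_of_bounded _ C0 _).1.
    apply: measurable_maxr => //; apply: measurable_funM => //.
    by apply: measurable_funM => //; exact: sg_meas.
  apply: filterS ae => x hx Ux; apply: le_trans (hx Ux).
  have -> : `|h x| = `|e * (sg q x * h x)|.
    by rewrite !normrM e1 mul1r /sg; case: ifP; rewrite ?normrN normr1 mul1r.
  by rewrite /Num.max; case: ifP => // _; rewrite normr0.
have p0 e x : 0 <= Num.max (e * (sg q x * h x)) 0 by rewrite le_max lexx orbT.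
have [L1 T1] := toward Qq (part 1 (normr1 _)) (p0 1).
have [L2 T2] := toward Qq (part (- 1) (normrN1 _)) (p0 (- 1)).
exists (fun x => sg q x * Num.max (1 * (sg q x * h x)) 0), (fun x => sg q x * Num.max (- 1 * (sg q x * h x)) 0).
split => //; apply/funext => x; rewrite !mulN1r mul1r /sg.
by case: ifP => _; rewrite ?mul1r ?mulN1r ?opprK; rewrite /Num.max; do 2 case: ifP => //; lra.
Qed.

End potentials.

(** * The extension problem *)

Section extension_problem.
Variables (R : realType) (d : nat) (Omega : set 'rV[R]_d) (A : 'rV[R]_d -> 'M[R]_d).
Variables (qbar s : R).
Hypotheses (d0 : (0 < d)%N) (hOmega : open_convex_polytope Omega) (hA : coefficient Omega A).
Hypotheses (hqbar : 0 < qbar) (hs : 0 < s < 1).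
Local Notation U := (cylinder Omega).
Local Notation W := (weight s).
Local Notation V := (H1L Omega s).
Local Notation Q := (potential Omega qbar).
Local Notation LI := (Linfty Omega).
Local Notation ninf := (Linfty_norm Omega).
Local Notation ip := (ip U W).
Local Notation gip := (gip U W).
Local Notation nm := (snorm gip).
Local Notation mu := (@lebesgue_rV R (d + 1)).

Let oOmega : open Omega := open_convex_polytope_open hOmega.
Let mOmega : measurable Omega := open_rV_measurable oOmega.
Let oU : open U := cylinder_open hOmega.
Let mU : measurable U := open_rV_measurable oU.
Let mW : measurable_fun U W := measurable_weight s.
Let W0 : forall x, U x -> 0 < W x := weight_gt0 s.
Let W_loc : forall K, compact K -> K `<=` U -> exists2 c, 0 < c & forall x, K x -> c <= W x :=
  weight_loc s.
Let testH1 := cylinder_test_H1 hOmega hs.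
Let sipL2 := L2_semi_ip mU mW W0.
Let sipH1 := H1_gip oU mW W0 W_loc.
Let VH1 w : V w -> H1 W U w := @H1V_H1 _ _ _ _ _ w.
Let VL2 w : V w -> L2 W U w := @H1V_L2 _ _ _ _ _ w.

Lemma gradC_normE w : H1 W U w -> gradC_norm Omega s w = nm w.
Proof. exact: (grad_normE oU mW W0). Qed.

Lemma H1L_gip : semi_ip V gip.
Proof. exact: (H1V_gip oU mW W0 W_loc testH1). Qed.

Lemma H1L_poincare : exists2 P, 0 <= P & forall w, V w -> snorm ip w <= P * nm w.
Proof.
have [P P0 hP] := cylinder_poincare_test hOmega hs d0; exists P => // w.
exact: (poincare oU mW W0 W_loc testH1 P0 hP).
Qed.

Lemma H1L_complete : scomplete V gip.
Proof.
have [P P0 hP] := cylinder_poincare_test hOmega hs d0.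
exact: (H1V_complete oU mW W0 W_loc testH1 P0 hP).
Qed.

Lemma H1L_ae0 w : V w -> nm w = 0 -> w = cst 0 %[ae mu in U].
Proof.
have [P P0 hP] := cylinder_poincare_test hOmega hs d0.
exact: (H1V_ae0 oU mW W0 W_loc testH1 P0 hP).
Qed.

Lemma H1L_aeB u v : V u -> V v -> nm (u \- v) = 0 -> u = v %[ae mu in U].
Proof.
move=> Vu Vv /(H1L_ae0 (sipB H1L_gip Vu Vv)); apply: filterS => x h Ux.
by apply/eqP; rewrite -subr_eq0; apply/eqP; exact: h.
Qed.

Lemma H1L_snorm_aeB u v : V u -> V v -> u = v %[ae mu in U] -> nm (u \- v) = 0.
Proof.
move=> Vu Vv uv; apply: (snorm_gip_of_ae0 oU mW W0 W_loc); first exact: VH1 (sipB H1L_gip Vu Vv).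
by apply: filterS uv => x h Ux /=; rewrite h// subrr.
Qed.

Lemma potential_base q : Q q -> [/\ measurable_fun U (q \o (@base_pt R d)),
  {ae mu, forall x, U x -> `|(q \o (@base_pt R d)) x| <= qbar} &
  {ae mu, forall x, U x -> 0 <= (q \o (@base_pt R d)) x}].
Proof.
move=> [mq bq]; split; first exact: measurable_base.
- by apply: filterS (ae_base bq) => x h Ux; have /andP[q0 q1] := h Ux; rewrite /= ger0_norm.
- by apply: filterS (ae_base bq) => x h Ux; have /andP[] := h Ux.
Qed.

Lemma Linfty_base h : LI h -> measurable_fun U (h \o (@base_pt R d)) /\
  {ae mu, forall x, U x -> `|(h \o (@base_pt R d)) x| <= ninf h}.
Proof.
move=> Lh; split; first by apply: measurable_base => //; case: Lh.
by have := ae_base (P := [set x | `|h x| <= ninf h]) (Linfty_ae Lh).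
Qed.

Definition potential_form h w v : R := ip (fun x => h (base_pt x) * w x) v.

Let LI_L2 h w : LI h -> V w -> L2 W U (fun x => h (base_pt x) * w x) /\
  snorm ip (fun x => h (base_pt x) * w x) <= ninf h * snorm ip w.
Proof.
move=> Lh Vw; have [mh hb] := Linfty_base Lh.
by have := L2_mul_bounded mU mW W0 mh hb (VL2 Vw); rewrite ger0_norm// Linfty_norm_ge0.
Qed.

(** The constants are fixed before any potential is given: [kappa] comes from the matrix, [c] from
    the Poincare constant, and [Ca] sees the potential only through [qbar]. *)
Lemma extension_family : exists kappa Ca c, coercive_family V gip
  (fun q w v => a_C Omega s A w v q) potential_form Q LI ninf kappa Ca c.
Proof.
have [P P0 hP] := H1L_poincare.
have [B MB] := ext_matrix_bounded hOmega hA.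
have mM := ext_matrix_measurable hOmega hA.
have Ms := @ext_matrix_sym _ _ _ _ hA.
have [kappa kappa0 hk] := ext_matrix_coercive hA.
have aE q w v : a_C Omega s A w v q = energy_form W U (ext_matrix A) (q \o (@base_pt R d)) w v by [].
have Psnorm w v : V w -> V v -> snorm ip w * snorm ip v <= P ^+ 2 * (nm w * nm v).
  move=> Vw Vv; rewrite expr2 mulrACA; apply: ler_pM; rewrite ?snorm_ge0//; exact: hP.
(* Two uses of Poincare turn a product of L^2 norms into gradient norms, whence P^2 both next to
   [qbar] and in the bound of the variation. *)
exists kappa, ((d + 1)%:R * ((d + 1)%:R * `|B|) + `|qbar| * P ^+ 2), (P ^+ 2); split.
- exact: H1L_gip.
- exact: H1L_complete.
- exact: kappa0.
- exact: sqr_ge0.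
- move=> q Qq; have [mq bq q0] := potential_base Qq.
  apply: (sub_semi_ip oU mW W0 W_loc testH1 (W := V)); last by []; split.
  + exact: (sip0 H1L_gip).
  + exact: (sip_lin H1L_gip).
  + move=> t u v w Vu Vv Vw.
    exact: (energy_linear oU mW W0 W_loc mM MB mq bq t (VH1 Vu) (VH1 Vv) (VH1 Vw)).
  + by move=> u v _ _; apply: energy_sym.
  + move=> u Vu; apply: le_trans (energy_coercive oU mW W0 mM MB mq bq (VH1 Vu) hk q0).
    by rewrite mulr_ge0 ?(ltW kappa0)// (sip_ge0 H1L_gip).
- move=> q w Qq Vw; have [mq bq q0] := potential_base Qq.
  exact: (energy_coercive oU mW W0 mM MB mq bq (VH1 Vw) hk q0).
- move=> q w v Qq Vw Vv; have [mq bq q0] := potential_base Qq.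
  apply: (le_trans (energy_bounded oU mW W0 mM MB mq bq (VH1 Vw) (VH1 Vv))).
  by rewrite mulrDl lerD2l -mulrA ler_wpM2l// Psnorm.
- move=> q h w v Qq Lh Qqh Vw Vv.
  have [mq bq _] := potential_base Qq; have [mqh bqh _] := potential_base Qqh.
  rewrite !aE (energyE oU mW W0 mM MB mqh bqh (VH1 Vw) (VH1 Vv)).
  rewrite (energyE oU mW W0 mM MB mq bq (VH1 Vw) (VH1 Vv)) -addrA; congr (_ + _).
  have [Lq _] := L2_mul_bounded mU mW W0 mq bq (VL2 Vw).
  have [Lhw _] := LI_L2 Lh Vw.
  have := sip_linear sipL2 1 Lq Lhw (VL2 Vv); rewrite mul1r => <-.
  by apply: eq_Rintegral => x _ /=; ring.
- move=> t h k w v Lh Lk Vw Vv.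
  have [L1 _] := LI_L2 Lh Vw; have [L2' _] := LI_L2 Lk Vw.
  rewrite /potential_form -(sip_linear sipL2 t L1 L2' (VL2 Vv)).
  by apply: eq_Rintegral => x _; ring.
- move=> h w w' v Lh Vw Vw' Vv.
  have [L1 _] := LI_L2 Lh Vw; have [L2' _] := LI_L2 Lh Vw'.
  rewrite /potential_form -(sip_linearB sipL2 L1 L2' (VL2 Vv)).
  by apply: eq_Rintegral => x _ /=; ring.
- move=> t h w u v Lh Vw Vu Vv; have [L1 _] := LI_L2 Lh Vw.
  exact: (sip_linear_r sipL2 t (VL2 Vu) (VL2 Vv) L1).
- move=> h w v Lh Vw Vv; have [L1 L2'] := LI_L2 Lh Vw.
  apply: (le_trans (snorm_CS sipL2 L1 (VL2 Vv))).
  apply: (@le_trans _ _ (ninf h * (snorm ip w * snorm ip v))).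
    by rewrite mulrA ler_wpM2r ?snorm_ge0.
  have E (a b x y : R) : a * b * x * y = b * (a * (x * y)) by ring.
  by rewrite [leRHS]E; apply: ler_wpM2l; [exact: Linfty_norm_ge0|exact: Psnorm].
- by move=> h; exact: Linfty_norm_ge0.
- exact: Linfty0.
- by move=> t h Lh; have [] := Linfty_scale t Lh.
- by move=> t h t0 Lh; have [_] := Linfty_scale t Lh; apply.
Qed.

Lemma potential_formE h w v :
  potential_form h w v = \int[mu]_(x in U) (W x * h (base_pt x) * w x * v x).
Proof. by apply: eq_Rintegral => x _; rewrite !mulrA. Qed.

Section derivative.
Variables (kappa Ca c m : R) (E : ('rV[R]_d -> R) -> 'rV[R]_(d + 1) -> R).
Variable lf : ('rV[R]_(d + 1) -> R) -> R.
Local Notation a := (fun q w v => a_C Omega s A w v q).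
Hypothesis F : coercive_family V gip a potential_form Q LI ninf kappa Ca c.
Hypothesis S : solution_map V gip a Q E lf m.
Local Notation lin_sol := (lin_sol V a potential_form E).

Lemma lin_solP q h psi : lin_sol q h psi <-> linearized_solution Omega s A (E q) q h psi.
Proof.
by split => -[Vp hp]; split => // v Vv; rewrite hp// potential_formE.
Qed.

Variable q : 'rV[R]_d -> R.
Hypothesis Qq : Q q.

Lemma frechet_derivative_exists : exists D, frechet_derivative Omega s qbar E q D.
Proof.
have [D DP] : exists D, forall h, LI h -> lin_sol q h (D h).
  (* Choice needs a value for every function, so the implication is kept inside and 0 serves outside
     L^oo. *)
  have /choice[D DP] h : exists psi, LI h -> lin_sol q h psi.
    have [Lh|Lh] := pselect (LI h); last by exists (fun=> 0) => /Lh.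
    by have [psi hp] := lin_sol_exists F S Qq Lh; exists psi.
  by exists D.
have VD h : LI h -> V (D h) by case/DP.
have kappa0 := cf_kappa F; have c0 := cf_c F; have m0 := sm_m S.
exists D; split => //.
- move=> t h k Lh Lk.
  have Lhk : LI (fun x => t * h x + k x).
    exact: Linfty_lin.
  have h1 := lin_sol_lin F S t Qq Lh Lk (DP _ Lh) (DP _ Lk).
  by apply: H1L_aeB (lin_sol_uniq F Qq (DP _ Lhk) h1); [exact: VD|case: h1].
- exists (c * (m / kappa) / kappa) => h Lh; rewrite gradC_normE; last exact: VH1 (VD _ Lh).
  have := lin_sol_bound F S Qq Lh (DP _ Lh).
  by rewrite (_ : c * ninf h * _ / _ = c * (m / kappa) / kappa * ninf h)//; ring.
- move=> e e0; pose K := (c / kappa) ^+ 2 * (m / kappa).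
  have K0 : 0 <= K by rewrite !mulr_ge0 ?sqr_ge0 ?invr_ge0 ?(ltW kappa0).
  have K1 : 0 < K + 1 by rewrite ltr_wpDl.
  (* The remainder is at most K |h|^2, and K |h| <= e once (K + 1) |h| <= e. *)
  exists (e / (K + 1)); first by rewrite divr_gt0.
  move=> h Lh Qqh; rewrite ler_pdivlMr// => he.
  have Vd := sipB H1L_gip (sipB H1L_gip (sm_V S Qqh) (sm_V S Qq)) (VD _ Lh).
  rewrite gradC_normE; last exact: VH1 Vd.
  apply: (le_trans (lin_sol_remainder F S Qq Lh Qqh (DP _ Lh))); rewrite -/K.
  rewrite ler_wpM2r ?Linfty_norm_ge0//; apply: le_trans he.
  by rewrite mulrC ler_wpM2l ?Linfty_norm_ge0// lerDl.
Qed.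

Lemma frechet_derivative_lin_sol D : frechet_derivative Omega s qbar E q D ->
  forall h, LI h -> lin_sol q h (D h).
Proof.
move=> [VD Dlin _ Dfr] h Lh.
have [psi sp] := lin_sol_exists F S Qq Lh.
apply: (lin_sol_eq0 F Qq sp (VD _ Lh)).
apply: (derivative_uniq F S _ Qq VD _ _ Lh sp).
- by move=> p k; apply: potential_directions.
- move=> t k l Lk Ll; apply: H1L_snorm_aeB (Dlin t _ _ Lk Ll).
    by apply: VD; exact: Linfty_lin.
  by apply: (sip_lin H1L_gip); exact: VD.
- move=> e e0; have [delta delta0 hd] := Dfr e e0; exists delta => // k Lk Qqk kd.
  rewrite -gradC_normE; first exact: hd.
  exact: VH1 (sipB H1L_gip (sipB H1L_gip (sm_V S Qqk) (sm_V S Qq)) (VD _ Lk)).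
Qed.

End derivative.

(** The eigenpairs of the single potential [q0] measure [f] and all traces, while [E q] ranges over
    all potentials; the gradient norm, free of q, mediates. Absolute values stand in for the signs
    of [d_s] and [M]. *)
Lemma trace_solution_map (tr : ('rV[R]_(d + 1) -> R) -> 'rV[R]_d -> R) M q0 lam phi f E :
  (forall w, V w -> Hr Omega s lam phi (tr w) /\
     Hr_norm Omega s lam phi (tr w) <= M * gradC_norm Omega s w) ->
  eigenpairs Omega A q0 lam phi -> Hr_dual Omega s lam phi f ->
  (forall q, Q q -> extension_solution Omega s A tr f q (E q)) ->
  solution_map V gip (fun q w v => a_C Omega s A w v q) Q E (fun v => d_s s * f (tr v))
    (`|d_s s| * (Hr_dual_norm Omega s lam phi f * `|M|)).
Proof.
move=> hM hphi hf hE; have dn := Hr_dual_norm_ge0 oOmega hphi hf.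
split.
- by rewrite !mulr_ge0.
- by move=> q /hE[].
- by move=> q v /hE[_ h] /h.
- move=> v Vv; have [Hv hv] := hM _ Vv.
  rewrite normrM -!mulrA ler_wpM2l//.
  apply: (le_trans (Hr_dual_norm_bound oOmega hphi hf Hv)); rewrite ler_wpM2l//.
  apply: (le_trans hv); rewrite gradC_normE; last exact: VH1.
  by rewrite ler_wpM2r ?snorm_ge0// ler_norm.
Qed.

End extension_problem.

Theorem lemma3p8 (R : realType) (d : nat) (hd : d = 2%N \/ d = 3%N)
    (Omega : set 'rV[R]_d) (hOmega : open_convex_polytope Omega)
    (A : 'rV[R]_d -> 'M[R]_d) (hA : coefficient Omega A)
    (qbar : R) (hqbar : 0 < qbar) (s : R) (hs : 0 < s < 1)
    (tr : ('rV[R]_(d + 1) -> R) -> 'rV[R]_d -> R)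
    (htr : trace_operator Omega s A qbar tr) :
  exists C : R,
    forall (q0 : 'rV[R]_d -> R) (lam : nat -> R) (phi : nat -> 'rV[R]_d -> R),
      potential Omega qbar q0 -> eigenpairs Omega A q0 lam phi ->
    forall f : ('rV[R]_d -> R) -> R, Hr_dual Omega s lam phi f ->
    forall E : ('rV[R]_d -> R) -> 'rV[R]_(d + 1) -> R,
      (forall q, potential Omega qbar q ->
         extension_solution Omega s A tr f q (E q)) ->
    forall q, potential Omega qbar q ->
      (exists D, frechet_derivative Omega s qbar E q D) /\
      (forall D, frechet_derivative Omega s qbar E q D ->
       forall h, Linfty Omega h ->
        [/\ linearized_solution Omega s A (E q) q h (D h),
            forall psi, linearized_solution Omega s A (E q) q h psi ->
              psi = D h %[ae lebesgue_rV in cylinder Omega] &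
            gradC_norm Omega s (D h) <=
              C * Hr_dual_norm Omega s lam phi f * Linfty_norm Omega h]).
Proof.
have d0 : (0 < d)%N by case: hd => ->.
have [kappa [Ca [c F]]] := extension_family qbar d0 hOmega hA hs.
case: htr => _ _ [M hM].
(* One 1/kappa bounds E q, the other solves the linearized equation, and [c] bounds the variation of
   the form; |d_s| |M| is what remains of the bound on the right-hand side after the dual norm of
   [f] is taken out. *)
exists (c / kappa / kappa * (`|d_s s| * `|M|)) => q0 lam phi Qq0 hphi f hf E hE q Qq.
have S := trace_solution_map hOmega (hM _ _ _ Qq0 hphi) hphi hf hE.
split; first exact: (frechet_derivative_exists d0 hOmega hs F S Qq).
move=> D hD h Lh.
have sD := frechet_derivative_lin_sol hOmega hqbar hs F S Qq hD Lh.
have [VD _] := sD.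
split.
- exact/lin_solP.
- move=> psi /lin_solP sp; have [Vp _] := sp.
  exact: (H1L_aeB d0 hOmega hs Vp VD (lin_sol_uniq F Qq sp sD)).
- rewrite gradC_normE//; last by case: VD.
  apply: (le_trans (lin_sol_bound F S Qq Lh sD)); rewrite le_eqVlt; apply/orP; left; apply/eqP.
  by rewrite !mulrA; ring.
Qed.
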